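(* Let $u$ be the solution on $\mathbb{Z}^4\times\mathbb{R}$ of $\partial_t^2u-\Delta u=0$ with $u(\cdot,0)=0$ and $\partial_tu(\cdot,0)=f$. (1) If $$1\le p<r\le\infty,\qquad 0<q<\infty,\qquad \frac1p>\frac12+\frac1r+\frac1{3q},$$ then there exists $C=C(p,q,r)$ such that $\|u\|_{L^q_tl^r}\le C\|f\|_{l^p}$. (2) If $(\frac1p,\frac1r)$ lies on the segment with vertices $(\frac34,\frac12)$ and $(1,0)$, then the same conclusion $\|u\|_{L^q_tl^r}\le C\|f\|_{l^p}$, $C=C(p,q,r)$, holds for $(p,q,r)$ satisfying $\frac1r+\frac1{3q}<\frac12$ (with $0<q<\infty$) or $(p,q,r)=(\frac43,\infty,2)$.
   Context: $\Delta u(x,t)=\sum_{y\in\mathbb{Z}^4,\ |x-y|_1=1}(u(y,t)-u(x,t))$ is the discrete Laplacian, $l^p=l^p(\mathbb{Z}^4)$ with counting measure, and $\|u\|_{L^q_tl^r}=\big(\int_{\mathbb{R}}\|u(\cdot,t)\|_{l^r}^q\,dt\big)^{1/q}$ for $0<q<\infty$ and $\|u\|_{L^\infty_tl^r}=\operatorname{ess\,sup}_t\|u(\cdot,t)\|_{l^r}$. ''The solution'' means $u(x,t)=\sum_{y\in\mathbb{Z}^4}G(x-y,t)f(y)$, where $$G(x,t)=\frac{1}{(2\pi)^4}\int_{[-\pi,\pi]^4}e^{ix\cdot\xi}\,\frac{\sin(t\,\omega(\xi))}{\omega(\xi)}\,d\xi,\qquad \omega(\xi)=\Big(\sum_{j=1}^4(2-2\cos\xi_j)\Big)^{1/2}.$$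 *)

(* Defs.v *)
From HB Require Import structures.
From mathcomp Require Import all_boot all_order all_algebra.
From mathcomp Require Import all_classical all_reals all_analysis.
From mathcomp Require Import complex.

Set Implicit Arguments.
Unset Strict Implicit.
Unset Printing Implicit Defensive.
Import Order.TTheory GRing.Theory Num.Theory.
Import numFieldNormedType.Exports.

Local Open Scope classical_set_scope.
Local Open Scope ring_scope.
Local Open Scope complex_scope.

Definition lattice4 : Type := 'rV[int]_4.
HB.instance Definition _ := GRing.Zmodule.copy lattice4 'rV[int]_4.
HB.instance Definition _ := isPointed.Build lattice4 0.
HB.instance Definition _ := @isMeasurable.Build default_measure_display
  lattice4 discrete_measurable discrete_measurable0
  discrete_measurableC discrete_measurableU.

(* Against the counting measure this is the absolutely convergent sum. *)
Definition cintegral d (T : measurableType d) (R : realType)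
    (mu : {measure set T -> \bar R}) (D : set T) (F : T -> R[i]) : R[i] :=
  (\int[mu]_(x in D) complex.Re (F x))
    +i* (\int[mu]_(x in D) complex.Im (F x)).

Section FundamentalSolution.
Context {R : realType}.

Definition coord4 (xi : R * R * R * R) (j : 'I_4) : R :=
  let: (a, b, c, d) := xi in tnth [tuple a; b; c; d] j.

Definition box4 : set (R * R * R * R) :=
  [set xi | forall j, - pi <= coord4 xi j <= pi].

Local Notation mR := (measurableTypeR R).

Definition leb4 : {measure set (mR * mR * mR * mR) -> \bar R} :=
  (@lebesgue_measure R \x @lebesgue_measure R
     \x @lebesgue_measure R \x @lebesgue_measure R)%E.

Definition dot4 (x : lattice4) (xi : R * R * R * R) : R :=
  \sum_(j < 4) (x ord0 j)%:~R * coord4 xi j.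

Definition cexpi (theta : R) : R[i] := cos theta +i* sin theta.

Definition omega (xi : R * R * R * R) : R :=
  Num.sqrt (\sum_(j < 4) (2 - 2 * cos (coord4 xi j))).

(* On [box4], [omega] vanishes only at the origin, a null set, so the value
   given by [x / 0 = 0] there is immaterial. *)
Definition G (x : lattice4) (t : R) : R[i] :=
  (((2 * pi) ^+ 4)^-1)%:C *
  cintegral leb4 box4
    (fun xi => cexpi (dot4 x xi) * (sin (t * omega xi) / omega xi)%:C).

Definition solution (f : lattice4 -> R[i]) (x : lattice4) (t : R) : R[i] :=
  cintegral (@counting lattice4 R) [set: lattice4] (fun y => G (x - y) t * f y).

Definition lnorm (p : \bar R) (g : lattice4 -> R[i]) : \bar R :=
  Lnorm (@counting lattice4 R) p (fun x => (Normc.normc (g x))%:E).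

Definition mixed_norm (q r : \bar R) (u : lattice4 -> R -> R[i]) : \bar R :=
  Lnorm (@lebesgue_measure R) q (fun t => lnorm r (u ^~ t)).

Definition strichartz (p q r : \bar R) : Prop :=
  exists C : R, forall f : lattice4 -> R[i], (lnorm p f < +oo)%E ->
    (mixed_norm q r (solution f) <= C%:E * lnorm p f)%E.

End FundamentalSolution.

(* Main.v *)
From HB Require Import structures.
Require Import Defs.
From mathcomp Require Import all_boot all_order all_algebra.
From mathcomp Require Import all_classical all_reals all_analysis.
From mathcomp Require Import measurable_realfun.
From mathcomp Require Import complex ring lra.

(** The estimate interpolates between two bounds for the convolution with the
    kernel [G], and then integrates in time.

    The first bound is uniform in time: the convolution maps [l^(4/3)] to [l^2].
    The multiplier is at most [1 / omega], and in four dimensions multiplication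
    by [1 / omega] takes Fourier transforms of functions in [l^(4/3)] to square
    integrable functions ([weighted_parseval], [wave_kernel_l43_l2]). To see it,
    [f] is normalised, frequencies are cut into dyadic shells and, at [omega ~ l],
    [f] is split at the height [l^3]; Parseval's identity handles the flat
    part, the [l^1] norm and the volume of the shell handle the tall part, and
    both contributions sum as geometric series.

    The second bound is dispersive: [G] is at most a constant times
    [|t|^(-3/2) log |t|] for large [t], uniformly in space
    ([dispersive_estimate], [wave_kernel_decay]). Completing a square and using
    the Fresnel integral, [sin (t omega) / omega] is written as a superposition
    over [u > 0] of phases [u^2 omega^2 + t^2 / (4 u^2)] ([fresnel_window]). As
    [omega^2] is a sum over the coordinates, the inverse Fourier transform of
    each term is a product of four Bessel functions, of order [n_j] and argument
    [2 u^2]; van der Corput's lemma bounds each of them by a constant times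
    [|4 u^4 - n_j^2|^(-1/4)] ([bessel_integral_bound]). The integral of the
    resulting bound over [u >= sqrt t] is as desired. For smaller [u] the
    integral would be too large, but there the phase [t^2 / (4 u^2)] oscillates
    fast, and an integration by parts gains the factor [u^4 / t^2], up to terms of
    lower order ([oscillating_by_parts], [norm_Ibox_window_le]).

    For the interpolation, [f] is cut into layers between consecutive powers of
    [2]. On a layer with [N] points and height [h], let [A] be the constant of the
    first bound and [d] the supremum of the kernel. The convolution is at most
    [h min (d N, A N^(1/2))] and its [l^2] norm at most [A h N^(3/4)], so its
    [l^r] norm is at most [h A^(1-D) d^D N^((1+1/r+D)/2)] whenever
    [0 <= D <= 1 - 2/r]. As [N] is at most a constant times [(|f|_p / h)^p], the
    layers sum up if [(1 + 1/r + D) / 2 < 1/p] ([interpolation_lr],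
    [interpolation_sup]). With [d] of the order of [|t|^(-3/2)], up to an
    arbitrarily small power, the [q]-th power of the resulting bound is integrable
    in time if [D > 2 / (3 q)] ([strichartz_finite_time]).

    It remains to choose [D]. In the first part, the hypothesis places
    [2 / (3 q)] below both [1 - 2/r] and [2/p - 1 - 1/r]. On the segment of the
    second part these two numbers coincide, and the hypothesis is again that they
    exceed [2 / (3 q)]. The isolated triple is the first bound alone. *)

Set Implicit Arguments.
Unset Strict Implicit.
Unset Printing Implicit Defensive.
Import Order.TTheory GRing.Theory Num.Theory.
Import numFieldNormedType.Exports.

(** * Calculus and van der Corput's lemma *)

Section Calculus.
Local Open Scope classical_set_scope.
Local Open Scope ring_scope.
Context {R : realType}.
Implicit Types (f g F G A : R -> R) (x a b l m : R).
Local Notation mu := (@lebesgue_measure R).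

Lemma der_cst c x : is_derive x 1 (fun=> c : R) 0.
Proof. exact: is_derive_cst. Qed.

Lemma der_id x : is_derive x 1 (fun y : R => y) 1.
Proof. exact: is_derive_id. Qed.

Lemma der_add f g x l m : is_derive x 1 f l -> is_derive x 1 g m ->
  is_derive x 1 (fun y => f y + g y) (l + m).
Proof. exact: is_deriveD. Qed.

Lemma der_opp f x l : is_derive x 1 f l -> is_derive x 1 (fun y => - f y) (- l).
Proof. exact: is_deriveN. Qed.

Lemma der_mul f g x l m : is_derive x 1 f l -> is_derive x 1 g m ->
  is_derive x 1 (fun y => f y * g y) (f x * m + g x * l).
Proof. exact: is_deriveM. Qed.

Lemma der_exp f n x l : is_derive x 1 f l ->
  is_derive x 1 (fun y => f y ^+ n) (n%:R * f x ^+ n.-1 * l).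
Proof. by move=> /(is_deriveX n); rewrite exprfctE. Qed.

Lemma der_inv f x l : f x != 0 -> is_derive x 1 f l ->
  is_derive x 1 (fun y => (f y)^-1) (- (f x) ^- 2 * l).
Proof. exact: is_deriveV. Qed.

Lemma der_comp f g x l m : is_derive (g x) 1 f l -> is_derive x 1 g m ->
  is_derive x 1 (fun y => f (g y)) (l * m).
Proof. exact: is_derive1_comp. Qed.

Lemma der_sin f x l : is_derive x 1 f l ->
  is_derive x 1 (fun y => sin (f y)) (cos (f x) * l).
Proof. by move=> h; apply: der_comp. Qed.

Lemma der_cos f x l : is_derive x 1 f l ->
  is_derive x 1 (fun y => cos (f y)) (- sin (f x) * l).
Proof. by move=> h; apply: der_comp. Qed.

Lemma der_atan f x l : is_derive x 1 f l ->
  is_derive x 1 (fun y => atan (f y)) ((1 + f x ^+ 2)^-1 * l).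
Proof. by move=> h; apply: der_comp. Qed.

Lemma der_ln f x l : 0 < f x -> is_derive x 1 f l ->
  is_derive x 1 (fun y => ln (f y)) ((f x)^-1 * l).
Proof. by move=> fx0 h; apply: der_comp h; exact: is_derive1_ln. Qed.

Lemma der_eq f x l m : is_derive x 1 f l -> l = m -> is_derive x 1 f m.
Proof. by move=> + <-. Qed.

Lemma der_cont f x l : is_derive x 1 f l -> {for x, continuous f}.
Proof.
by move=> h; apply/differentiable_continuous/derivable1_diffP; exact: ex_derive.
Qed.

Local Notation "f ~~> x" := {for x, continuous f} (at level 70).

Lemma cont_cst (c : R) x : (fun=> c : R) ~~> x.
Proof. exact: cvg_cst. Qed.

Lemma cont_id x : (fun y : R => y) ~~> x.
Proof. exact: cvg_id. Qed.

Lemma cont_add f g x : f ~~> x -> g ~~> x -> (fun y => f y + g y) ~~> x.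
Proof. exact: cvgD. Qed.

Lemma cont_opp f x : f ~~> x -> (fun y => - f y) ~~> x.
Proof. exact: cvgN. Qed.

Lemma cont_mul f g x : f ~~> x -> g ~~> x -> (fun y => f y * g y) ~~> x.
Proof. exact: cvgM. Qed.

Lemma cont_sum (I : Type) (r : seq I) (k : I -> R -> R) x :
  (forall i, k i ~~> x) -> (fun y => \sum_(i <- r) k i y) ~~> x.
Proof.
move=> ck; elim: r => [|i r ih].
  by rewrite (_ : (fun _ => _) = fun=> 0); [exact: cont_cst|apply/funext => y; rewrite big_nil].
rewrite (_ : (fun _ => _) = fun y => k i y + \sum_(j <- r) k j y); first exact: cont_add.
by apply/funext => y; rewrite big_cons.
Qed.

Lemma cont_exp f n x : f ~~> x -> (fun y => f y ^+ n) ~~> x.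
Proof.
by move=> cf; apply: (@continuous_comp _ _ _ f (fun z => z ^+ n)) => //; exact: exprn_continuous.
Qed.

Lemma cont_inv f x : f x != 0 -> f ~~> x -> (fun y => (f y)^-1) ~~> x.
Proof. by move=> fx0 cf; exact: cvgV. Qed.

Lemma cont_sin f x : f ~~> x -> (fun y => sin (f y)) ~~> x.
Proof. by move=> cf; apply: continuous_comp => //; exact: continuous_sin. Qed.

Lemma cont_cos f x : f ~~> x -> (fun y => cos (f y)) ~~> x.
Proof. by move=> cf; apply: continuous_comp => //; exact: continuous_cos. Qed.

End Calculus.

(** The library rules speak of sums and products of functions, which do not
    unify with an explicit formula; the pointwise rules above let these tactics
    peel the formula from the outside. Nonvanishing denominators are left as
    subgoals, and [der_eq] compares the derivative found with the wanted one. *)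
Ltac der_step :=
  lazymatch goal with
  | |- is_derive _ _ (fun=> ?c) _ => exact: (@der_cst _ c)
  | |- is_derive _ _ (fun y => y) _ => exact: der_id
  | |- is_derive _ _ (fun y => @GRing.add _ (@?f y) (@?g y)) _ => eapply (@der_add _ f g)
  | |- is_derive _ _ (fun y => @GRing.opp _ (@?f y)) _ => eapply (@der_opp _ f)
  | |- is_derive _ _ (fun y => @GRing.exp _ (@?f y) ?n) _ => eapply (@der_exp _ f n)
  | |- is_derive _ _ (fun y => @GRing.mul _ (@?f y) (@?g y)) _ => eapply (@der_mul _ f g)
  | |- is_derive _ _ (fun y => @GRing.inv _ (@?f y)) _ => eapply (@der_inv _ f)
  | |- is_derive _ _ (fun y => @sin _ (@?f y)) _ => eapply (@der_sin _ f)
  | |- is_derive _ _ (fun y => @cos _ (@?f y)) _ => eapply (@der_cos _ f)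
  | |- is_derive _ _ (fun y => @atan _ (@?f y)) _ => eapply (@der_atan _ f)
  | |- is_derive _ _ (fun y => @ln _ (@?f y)) _ => eapply (@der_ln _ f)
  end.

Ltac der_tac :=
  repeat first [ eassumption | der_step ].

Ltac cont_step :=
  lazymatch goal with
  | |- prop_for _ (inPhantom (continuous (fun=> ?c))) => exact: (@cont_cst _ c)
  | |- prop_for _ (inPhantom (continuous (fun y => y))) => exact: cont_id
  | |- prop_for _ (inPhantom (continuous (fun y => @GRing.add _ (@?f y) (@?g y)))) => apply: (@cont_add _ f g)
  | |- prop_for _ (inPhantom (continuous (fun y => @GRing.opp _ (@?f y)))) => apply: (@cont_opp _ f)
  | |- prop_for _ (inPhantom (continuous (fun y => @GRing.exp _ (@?f y) ?n))) => apply: (@cont_exp _ f n)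
  | |- prop_for _ (inPhantom (continuous (fun y => @GRing.mul _ (@?f y) (@?g y)))) => apply: (@cont_mul _ f g)
  | |- prop_for _ (inPhantom (continuous (fun y => @GRing.inv _ (@?f y)))) => apply: (@cont_inv _ f)
  | |- prop_for _ (inPhantom (continuous (fun y => @sin _ (@?f y)))) => apply: (@cont_sin _ f)
  | |- prop_for _ (inPhantom (continuous (fun y => @cos _ (@?f y)))) => apply: (@cont_cos _ f)
  end.

Ltac cont_tac :=
  repeat first [ eassumption | cont_step ].

Section Calculus2.
Local Open Scope classical_set_scope.
Local Open Scope ring_scope.
Context {R : realType}.
Implicit Types (f g F G A : R -> R) (x a b l m : R).
Local Notation mu := (@lebesgue_measure R).

Lemma continuous_itv f a b :
  (forall x, a <= x <= b -> {for x, continuous f}) ->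
  {within `[a, b], continuous f}.
Proof.
move=> cf; apply: continuous_in_subspaceT => x; rewrite inE/= in_itv/=.
exact: cf.
Qed.

Lemma continuous_integrable_itv f a b :
  (forall x, a <= x <= b -> {for x, continuous f}) ->
  mu.-integrable `[a, b] (EFin \o f).
Proof.
move=> cf; apply: continuous_compact_integrable; first exact: segment_compact.
exact: continuous_itv.
Qed.

Lemma Rintegral_FTC F f a b : a <= b ->
  (forall x, a <= x <= b -> is_derive x 1 F (f x)) ->
  (forall x, a <= x <= b -> {for x, continuous f}) ->
  \int[mu]_(x in `[a, b]) f x = F b - F a.
Proof.
rewrite le_eqVlt => /predU1P[<-|ab] dF cf.
  by rewrite set_itv1 Rintegral_set1 subrr.
rewrite /Rintegral (@continuous_FTC2 _ f F)//.
- exact: continuous_itv.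
- split.
  + move=> x /[!in_itv]/= /andP[ax xb].
    by apply: ex_derive; apply: dF; rewrite (ltW ax) (ltW xb).
  + by apply/cvg_at_right_filter/(@der_cont _ _ _ (f a))/dF; rewrite lexx ltW.
  + by apply/cvg_at_left_filter/(@der_cont _ _ _ (f b))/dF; rewrite lexx ltW.
- move=> x /[!in_itv]/= /andP[ax xb]; rewrite derive1E.
  by apply: derive_val; apply: dF; rewrite (ltW ax) (ltW xb).
Qed.

(** Replacing the integrand by the derivative of a bounded function, up to an
    error that also has a bounded primitive. *)
Lemma Rintegral_le_antiderivative f G g A (al : R -> R) a b : a <= b ->
  (forall x, a <= x <= b -> {for x, continuous f}) ->
  (forall x, a <= x <= b -> is_derive x 1 G (g x)) ->
  (forall x, a <= x <= b -> {for x, continuous g}) ->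
  (forall x, a <= x <= b -> is_derive x 1 A (al x)) ->
  (forall x, a <= x <= b -> {for x, continuous al}) ->
  (forall x, a <= x <= b -> `|f x - g x| <= al x) ->
  `|\int[mu]_(x in `[a, b]) f x| <= `|G b - G a| + (A b - A a).
Proof.
move=> ab cf dG cg dA ca fga.
rewrite -(Rintegral_FTC ab dG cg) -(Rintegral_FTC ab dA ca).
have if_ := continuous_integrable_itv cf.
have ig := continuous_integrable_itv cg.
have ia := continuous_integrable_itv ca.
have cfg x : a <= x <= b -> {for x, continuous (fun y => f y - g y)}.
  by move=> xab; apply: cvgB; [exact: cf|exact: cg].
have ifg := continuous_integrable_itv cfg.
have -> : \int[mu]_(x in `[a, b]) f x =
    \int[mu]_(x in `[a, b]) g x + \int[mu]_(x in `[a, b]) (f x - g x).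
  by rewrite -RintegralD//; apply: eq_Rintegral => x _; rewrite addrC subrK.
apply: (le_trans (ler_normD _ _)); rewrite lerD2l.
apply: (le_trans (le_normr_Rintegral _ ifg)) => //.
apply: le_Rintegral => //; first exact: integrable_norm.
Qed.

(** The vector field [h = phi1 / (phi1^2 + d^2)] is a bounded substitute
    for [1 / phi'], so the phase may be integrated by parts without cutting
    out a neighbourhood of the stationary point; both error terms are
    at most derivatives of arctangents. *)
Lemma van_der_corput_ge0 (phi phi1 phi2 : R -> R) a b x0 k : a <= b -> 0 < k ->
  (forall x, is_derive x 1 phi (phi1 x)) ->
  (forall x, is_derive x 1 phi1 (phi2 x)) -> continuous phi2 ->
  (forall x, a <= x <= b -> 0 <= phi2 x) ->
  (forall x, a <= x <= b -> k * `|x - x0| <= `|phi1 x|) ->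
  `|\int[mu]_(x in `[a, b]) cos (phi x)| <= 9 / Num.sqrt k.
Proof.
move=> ab k0 dphi dphi1 cphi2 phi2_ge0 phi1_ge.
set d := Num.sqrt k.
have d0 : 0 < d by rewrite sqrtr_gt0.
have d2 : d ^+ 2 = k by rewrite sqr_sqrtr// ltW.
have P0 x : 0 < phi1 x ^+ 2 + d ^+ 2 by rewrite ltr_wpDl ?sqr_ge0 ?exprn_gt0.
have Q0 x : 0 < d ^+ 2 + k ^+ 2 * (x - x0) ^+ 2.
  by rewrite ltr_pwDl ?exprn_gt0// mulr_ge0 ?sqr_ge0.
pose h x := phi1 x / (phi1 x ^+ 2 + d ^+ 2).
pose h1 x := phi2 x * (d ^+ 2 - phi1 x ^+ 2) / (phi1 x ^+ 2 + d ^+ 2) ^+ 2.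
have dh x : is_derive x 1 h (h1 x).
  have := dphi1 x => ?.
  rewrite /h; eapply der_eq; first by (der_tac; rewrite gt_eqF).
  by rewrite /h1 /=; have := P0 x => /lt0r_neq0 ?; field.
pose G x := sin (phi x) * h x.
pose g x := cos (phi x) * phi1 x * h x + sin (phi x) * h1 x.
have dG x : is_derive x 1 G (g x).
  have := dphi x => ?; have := dh x => ?.
  by rewrite /G; eapply der_eq; [der_tac|rewrite /g; ring].
pose A x := d^-1 * atan (d^-1 * phi1 x) + d^-1 * atan (d * (x - x0)).
pose al x := phi2 x / (phi1 x ^+ 2 + d ^+ 2)
             + d ^+ 2 / (d ^+ 2 + k ^+ 2 * (x - x0) ^+ 2).
have dA x : is_derive x 1 A (al x).
  have := dphi1 x => ?.
  rewrite /A; eapply der_eq; first by der_tac.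
  rewrite /al -d2 /=; have := P0 x => /lt0r_neq0 P0'; have := Q0 x => /lt0r_neq0.
  rewrite -d2 => Q0'.
  have ->: 1 + (d^-1 * phi1 x) ^+ 2 = (phi1 x ^+ 2 + d ^+ 2) / d ^+ 2 by field; exact: lt0r_neq0.
  have ->: 1 + (d * (x - x0)) ^+ 2 = (d ^+ 2 + (d ^+ 2) ^+ 2 * (x - x0) ^+ 2) / d ^+ 2.
    by field; exact: lt0r_neq0.
  move: P0' Q0'; move: (phi1 x ^+ 2 + d ^+ 2) (d ^+ 2 + _ * _) => P Q P0' Q0'.
  by field; rewrite P0' Q0' lt0r_neq0.
have c1 x : {for x, continuous phi1} := der_cont (dphi1 x).
have c0 x : {for x, continuous phi} := der_cont (dphi x).
have ch x : {for x, continuous h} := der_cont (dh x).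
have cal x : {for x, continuous al}.
  have := c1 x => ?; have := cphi2 x => ?.
  by rewrite /al; cont_tac; rewrite gt_eqF.
have ch1 x : {for x, continuous h1}.
  have := c1 x => ?; have := cphi2 x => ?.
  by rewrite /h1; cont_tac; rewrite expf_neq0// gt_eqF.
have cg x : {for x, continuous g}.
  have := c1 x => ?; have := c0 x => ?; have := ch x => ?; have := ch1 x => ?.
  by rewrite /g; cont_tac.
have hle x : `|h x| <= (2 * d)^-1.
  rewrite /h normrM normfV (gtr0_norm (P0 x)) ler_pdivrMr//.
  rewrite mulrC ler_pdivlMr ?mulr_gt0// -(real_normK (num_real (phi1 x))).
  by have := sqr_ge0 (`|phi1 x| - d); lra.
have Gle x : `|G x| <= (2 * d)^-1.
  rewrite /G normrM -[leRHS]mul1r ler_pM//; exact: sin_max.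
have Ale x y : A y - A x <= 2 * pi / d.
  rewrite /A -!mulrDr -mulrBr mulrC ler_pM2r ?invr_gt0//.
  have := atan_ltpi2 (d^-1 * phi1 y); have := atan_ltpi2 (d * (y - x0)).
  have := atan_gtNpi2 (d^-1 * phi1 x); have := atan_gtNpi2 (d * (x - x0)).
  lra.
apply: (le_trans (@Rintegral_le_antiderivative _ G g A al _ _ ab _ _ _ _ _ _)) => //.
  by move=> x _; have := c0 x => ?; cont_tac.
- move=> x xab.
  have -> : cos (phi x) - g x =
     cos (phi x) * (d ^+ 2 / (phi1 x ^+ 2 + d ^+ 2)) - sin (phi x) * h1 x.
    rewrite /g /h; have := P0 x => /lt0r_neq0 P0'; field => //.
  apply: (le_trans (ler_normB _ _)); rewrite addrC; apply: lerD.
    rewrite normrM -[leRHS]mul1r ler_pM//; first exact: sin_max.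
    rewrite /h1 !normrM (ger0_norm (phi2_ge0 _ xab)) -mulrA ler_wpM2l ?phi2_ge0//.
    rewrite normfV (ger0_norm (sqr_ge0 (phi1 x ^+ 2 + d ^+ 2))) ler_pdivrMr ?exprn_gt0//.
    rewrite expr2 mulrA mulVf ?lt0r_neq0// mul1r.
    by rewrite ler_norml; have := sqr_ge0 (phi1 x); have := sqr_ge0 d; lra.
  rewrite normrM -[leRHS]mul1r ler_pM//; first exact: cos_max.
  rewrite ger0_norm ?divr_ge0 ?sqr_ge0 ?(ltW (P0 x))// ler_pM2l ?exprn_gt0//.
  rewrite lef_pV2 ?posrE// addrC lerD2r.
  rewrite -(real_normK (num_real (phi1 x))) -(real_normK (num_real (x - x0))).
  by rewrite -exprMn ler_pXn2r ?phi1_ge// nnegrE ?mulr_ge0// ltW.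
apply: (@le_trans _ _ (d^-1 + 2 * pi / d)).
  apply: lerD => //; apply: (le_trans (ler_normB _ _)).
  have := Gle a; have := Gle b; rewrite invfM; lra.
rewrite -/d -[X in X + _]mul1r -mulrDl ler_pM2r ?invr_gt0//.
by have := @pihalf_lt2 R; lra.
Qed.
End Calculus2.

(** * A uniform bound for Bessel integrals *)

Section BesselBound.
Local Open Scope classical_set_scope.
Local Open Scope ring_scope.
Context {R : realType}.
Local Notation mu := (@lebesgue_measure R).
Implicit Types (a b c n s x th : R).

Lemma Rintegral_split (f : R -> R) a b c : a <= c <= b ->
  (forall x, a <= x <= b -> {for x, continuous f}) ->
  \int[mu]_(x in `[a, b]) f x =
  \int[mu]_(x in `[a, c]) f x + \int[mu]_(x in `[c, b]) f x.
Proof.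
move=> /andP[ac cb] cf; have If := continuous_integrable_itv cf.
have := @Rintegral_itvB _ f (BLeft a) (BRight b) c If.
rewrite !bnd_simp => /(_ ac cb) /eqP; rewrite subr_eq => /eqP ->.
rewrite addrC Rintegral_itv_obnd_cbnd//.
apply: integrableS If => // x /=; rewrite !in_itv/= => /andP[cx ->].
by rewrite (le_trans ac (ltW cx)).
Qed.

Lemma van_der_corput (phi phi1 phi2 : R -> R) a b x0 k : a <= b -> 0 < k ->
  (forall x, is_derive x 1 phi (phi1 x)) ->
  (forall x, is_derive x 1 phi1 (phi2 x)) -> continuous phi2 ->
  (forall x, a <= x <= b -> 0 <= phi2 x) \/
    (forall x, a <= x <= b -> phi2 x <= 0) ->
  (forall x, a <= x <= b -> k * `|x - x0| <= `|phi1 x|) ->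
  `|\int[mu]_(x in `[a, b]) cos (phi x)| <= 9 / Num.sqrt k.
Proof.
move=> ab k0 dphi dphi1 cphi2 [phi2_ge0|phi2_le0] phi1_ge.
  exact: (van_der_corput_ge0 ab k0 dphi dphi1 _ phi2_ge0 phi1_ge).
under eq_Rintegral do rewrite -cosN.
apply: (@van_der_corput_ge0 _ (fun x => - phi x) (fun x => - phi1 x)
  (fun x => - phi2 x) _ _ x0) => //.
- by move=> x; apply: cont_opp; exact: cphi2.
- by move=> x xab; rewrite oppr_ge0; exact: phi2_le0.
- by move=> x xab; rewrite normrN; exact: phi1_ge.
Qed.

Lemma two_div_pi x : 2 / pi * (x / 2) = x / pi.
Proof. by move: (lt0r_neq0 (@pi_gt0 R)); move: (pi : R) => P P0; field. Qed.

(** Jordan's inequality; a point below the chord would force the slope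
    [cos] to pass strictly above [2 / pi] after having been strictly below, but
    [cos] decreases. *)
Lemma sin_ge_chord x : 0 <= x <= pi / 2 -> 2 / pi * x <= sin x.
Proof.
move=> /andP[x0 xpi]; rewrite leNgt; apply/negP => sx.
have pi0 := @pi_gt0 R.
pose g y : R := sin y - 2 / pi * y.
have dg (y : R) : is_derive y 1 g (cos y - 2 / pi).
  by rewrite /g; eapply der_eq; [der_tac|ring].
have cg (y : R) : {for y, continuous g} := der_cont (dg y).
have x_gt0 : 0 < x.
  rewrite lt_neqAle x0 andbT; apply/eqP => x0'; move: sx.
  by rewrite -x0' sin0 mulr0 ltxx.
have x_lt : x < pi / 2.
  rewrite lt_neqAle xpi andbT; apply/eqP => x0'; move: sx.
  by rewrite x0' sin_pihalf ltNge two_div_pi divff ?lexx// lt0r_neq0.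
have [c1 /[!in_itv]/= /andP[c1a c1b] h1] := MVT x_gt0 (fun y _ => dg y)
  (continuous_itv (fun y _ => cg y)).
have [c2 /[!in_itv]/= /andP[c2a c2b] h2] := MVT x_lt (fun y _ => dg y)
  (continuous_itv (fun y _ => cg y)).
have g0 : g 0 = 0 by rewrite /g sin0 mulr0 subrr.
have gpi : g (pi / 2) = 0.
  by rewrite /g sin_pihalf two_div_pi divff ?subrr// lt0r_neq0.
have gx : g x < 0 by rewrite /g subr_lt0.
have l1 : cos c1 < 2 / pi.
  rewrite -subr_lt0; move: gx; rewrite -[g x]subr0 -[X in _ - X]g0 h1 subr0.
  by rewrite pmulr_llt0.
have l2 : 2 / pi < cos c2.
  rewrite -subr_gt0; move: gx; rewrite -oppr_gt0 -[- g x]add0r -[X in X - _]gpi h2.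
  by rewrite pmulr_lgt0// subr_gt0.
have c12 := lt_trans c1b c2a.
have : cos c2 < cos c1 by rewrite ltr_cos ?in_itv//=; lra.
by have := lt_trans l1 l2; lra.
Qed.

Lemma norm_sin_ge_chord x : `|x| <= pi / 2 -> 2 / pi * `|x| <= `|sin x|.
Proof.
move=> xpi; apply: (le_trans (@sin_ge_chord `|x| _)); first by rewrite xpi normr_ge0.
by have [x0|x0] := leP 0 x; [rewrite (ger0_norm x0)|
  rewrite (ltr0_norm x0) sinN -normrN]; exact: ler_norm.
Qed.

Lemma one_subr_cos x : 1 - cos x = 2 * sin (x / 2) ^+ 2.
Proof.
rewrite [in LHS](_ : x = (x / 2) *+ 2) ?cos_mulr2n; last by rewrite mulr2n; field.
by rewrite cos2sin2 mulr2n; ring.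
Qed.

Lemma sinB_prod x y :
  sin x - sin y = 2 * sin ((x - y) / 2) * cos ((x + y) / 2).
Proof.
set u := (x - y) / 2; set v := (x + y) / 2.
have -> : x = v + u by rewrite /u /v; field.
have -> : y = v - u by rewrite /u /v; field.
by rewrite sinD sinB; ring.
Qed.

Lemma cosD_prod x y :
  cos x + cos y = 2 * cos ((x - y) / 2) * cos ((x + y) / 2).
Proof.
set u := (x - y) / 2; set v := (x + y) / 2.
have -> : x = v + u by rewrite /u /v; field.
have -> : y = v - u by rewrite /u /v; field.
by rewrite cosD cosB; ring.
Qed.

(** In the oscillatory region the phase has the stationary point
    [- asin (n / s)] and its derivative vanishes there to first order: in
    [sin x - sin x0 = 2 sin ((x - x0) / 2) cos ((x + x0) / 2)] Jordan's
    inequality bounds the sine, and the cosine is at least [cos x0 / 2]. *)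
Lemma bessel_phase_stationary n s : 0 < s -> `|n| <= s ->
  exists x0, forall x, - (pi / 2) <= x <= pi / 2 ->
    Num.sqrt (s ^+ 2 - n ^+ 2) / pi * `|x - x0| <= `|n + s * sin x|.
Proof.
move=> s0 ns; have pi0 := @pi_gt0 R.
have nsb : -1 <= - (n / s) <= 1.
  by rewrite -ler_norml normrN normrM normfV (gtr0_norm s0) ler_pdivrMr ?mul1r.
exists (asin (- (n / s))) => x /andP[xl xr]; set x0 := asin _.
have x0l : - (pi / 2) <= x0 := asin_geNpi2 nsb.
have x0r : x0 <= pi / 2 := asin_lepi2 nsb.
have sx0 : sin x0 = - (n / s) by rewrite asinK// in_itv.
have -> : n + s * sin x = s * (sin x - sin x0).
  by rewrite sx0; field; exact: lt0r_neq0.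
have -> : Num.sqrt (s ^+ 2 - n ^+ 2) = s * cos x0.
  rewrite cos_asin// -{2}(gtr0_norm s0) -sqrtr_sqr -sqrtrM ?sqr_ge0//.
  by congr Num.sqrt; field; exact: lt0r_neq0.
rewrite sinB_prod !normrM (gtr0_norm s0) (@ger0_norm _ 2)// -!mulrA.
rewrite ler_pM2l//.
have c0 : 0 <= cos x0 by apply: cos_ge0_pihalf; rewrite x0l.
have cx : 0 <= cos x by apply: cos_ge0_pihalf; rewrite xl.
have cm : 0 <= cos ((x + x0) / 2) by apply: cos_ge0_pihalf; lra.
have cle : cos x0 / 2 <= `|cos ((x + x0) / 2)|.
  rewrite (ger0_norm cm); have := cosD_prod x x0.
  have := ler_wpM2r cm (cos_le1 ((x - x0) / 2)); lra.
have sle : `|x - x0| / pi <= `|sin ((x - x0) / 2)|.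
  apply: le_trans (@norm_sin_ge_chord ((x - x0) / 2) _); last first.
    by rewrite ler_norml; lra.
  have -> : `|(x - x0) / 2| = `|x - x0| / 2.
    by rewrite normrM; congr (_ * _); rewrite ger0_norm.
  by rewrite two_div_pi.
have := ler_pM (divr_ge0 (normr_ge0 (x - x0)) (ltW pi0)) (divr_ge0 c0 (ler0n _ 2)) sle cle.
set u := `|x - x0|; set v := `|sin _|; set w := `|cos _| => h.
by rewrite mulrCA mulrA (mulrC pi^-1) mulrC; lra.
Qed.

(** As [s < n], the derivative of the phase is at least [n - s] plus a multiple of
    the squared distance to [- pi / 2]; a constant plus a square dominates a
    linear function, and [z] is that distance, scaled. *)
Lemma bessel_phase_nonstationary_gt0 n s : 0 <= s -> s < n ->
  forall x, - (pi / 2) <= x <= pi / 2 ->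
    Num.sqrt (n ^+ 2 - s ^+ 2) / pi * `|x + pi / 2| <= n + s * sin x.
Proof.
move=> s0 sn x /andP[xl xr]; have pi0 := @pi_gt0 R.
set y := x + pi / 2; have y0 : 0 <= y by rewrite /y; lra.
have ypi : y <= pi by rewrite /y; lra.
have sxE : sin x = 2 * sin (y / 2) ^+ 2 - 1.
  rewrite -one_subr_cos /y cosDpihalf; ring.
have yl := @sin_ge_chord (y / 2) ltac:(lra).
set z := y / pi; have z0 : 0 <= z by rewrite divr_ge0// ltW.
have z1 : z <= 1 by rewrite ler_pdivrMr// mul1r.
have zs : z ^+ 2 <= sin (y / 2) ^+ 2.
  rewrite ler_pXn2r ?nnegrE//; last first.
    by apply: le_trans yl; rewrite mulr_ge0 ?divr_ge0// ltW.
  by apply: le_trans yl; rewrite two_div_pi.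
rewrite (ger0_norm y0) mulrAC -mulrA -/z.
apply: (@le_trans _ _ (n - s + 2 * s * z ^+ 2)); last first.
  by rewrite sxE; have := ler_wpM2l s0 zs; lra.
have A0 : 0 <= n - s by lra.
rewrite -(ger0_norm (_ : 0 <= n - s + 2 * s * z ^+ 2)); last first.
  by have := mulr_ge0 s0 (sqr_ge0 z); lra.
rewrite -[X in _ * X <= _](ger0_norm z0) -!sqrtr_sqr -sqrtrM; last first.
  by rewrite subr_ge0 ler_pXn2r ?nnegrE//; lra.
rewrite ler_sqrt ?sqr_ge0//.
have z2 : z ^+ 2 <= 1 by rewrite expr_le1.
have p1 : 0 <= (n - s) ^+ 2 * (1 - z ^+ 2) by rewrite mulr_ge0 ?sqr_ge0// subr_ge0.
have p2 : 0 <= (n - s) * s * z ^+ 2 := mulr_ge0 (mulr_ge0 A0 s0) (sqr_ge0 z).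
have p3 : 0 <= (s * z ^+ 2) ^+ 2 by rewrite sqr_ge0.
rewrite -subr_ge0 (_ : _ - _ = (n - s) ^+ 2 * (1 - z ^+ 2) + 2 * ((n - s) * s * z ^+ 2) + 4 * (s * z ^+ 2) ^+ 2); last by ring.
lra.
Qed.

(** Both regions in one statement: away from some [x0] the derivative of the
    phase grows with slope [|s^2 - n^2|^(1/2)]. *)
Lemma bessel_phase_ge n s : 0 <= s ->
  exists x0, forall x, - (pi / 2) <= x <= pi / 2 ->
    Num.sqrt `|s ^+ 2 - n ^+ 2| / pi * `|x - x0| <= `|n + s * sin x|.
Proof.
move=> s0; have [ns|sn] := leP `|n| s.
  have n2 : n ^+ 2 <= s ^+ 2.
    by rewrite -(real_normK (num_real n)) ler_pXn2r ?nnegrE.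
  move: s0; rewrite le_eqVlt => /predU1P[s0|s0].
    exists 0 => x _; have -> : n = 0 by apply/eqP; rewrite -normr_le0 s0.
    by rewrite -s0 expr0n subrr normr0 sqrtr0 !mul0r.
  by rewrite ger0_norm ?subr_ge0//; exact: bessel_phase_stationary.
have n2 : s ^+ 2 <= n ^+ 2.
  by rewrite -(real_normK (num_real n)) ler_pXn2r ?nnegrE// ltW.
rewrite distrC ger0_norm ?subr_ge0//.
have [n0|n0] := leP 0 n.
  exists (- (pi / 2)) => x xpi; rewrite opprK.
  apply: (le_trans (bessel_phase_nonstationary_gt0 s0 _ xpi)); last exact: ler_norm.
  by rewrite -(ger0_norm n0).
exists (pi / 2) => x /andP[xl xr].
have -> : n + s * sin x = - (- n + s * sin (- x)) by rewrite sinN; ring.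
have -> : x - pi / 2 = - (- x + pi / 2) by ring.
rewrite !normrN -sqrrN.
apply: (le_trans (@bessel_phase_nonstationary_gt0 (- n) s s0 _ (- x) _)).
- by rewrite -(ltr0_norm n0).
- lra.
- exact: ler_norm.
Qed.

Lemma norm_Rintegral_cos_le (phi : R -> R) :
  (forall x : R, {for x, continuous (fun y : R => cos (phi y))}) ->
  `|\int[mu]_(x in `[- pi, pi]) cos (phi x)| <= 8.
Proof.
move=> cphi; have pi0 := @pi_gt0 R; have pi4 := @pihalf_lt2 R.
apply: (le_trans (le_normr_Rintegral _ _)) => //.
    by apply: continuous_integrable_itv => x _; exact: cphi.
  apply: (@le_trans _ _ (\int[mu]_(x in `[- pi, pi]) (cst 1 x))).
    apply: le_Rintegral => //.
    - apply: integrable_norm; apply: continuous_integrable_itv => x _; exact: cphi.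
    - by apply: continuous_integrable_itv => x _; exact: cvg_cst.
    - by move=> x _; exact: cos_max.
  rewrite (@Rintegral_FTC _ (fun y => y)); [lra|lra|].
  by move=> x _; exact: cvg_cst.
Qed.

(** For an integer [n], the integral is the Bessel function [2 pi J_n (s)] times a
    cosine. On each of three pieces the derivative of the phase grows with slope
    [m / pi] away from one point, so that van der Corput's lemma applies. *)
Lemma bessel_integral_bound th n s : 0 <= s ->
  `|\int[mu]_(x in `[- pi, pi]) cos (th + n * x - s * cos x)| ^+ 4 *
    (1 + `|s ^+ 2 - n ^+ 2|) <= 10 ^+ 7.
Proof.
move=> s0; have pi0 := @pi_gt0 R; have pi4 := @pihalf_lt2 R.
set phi := (fun x => th + n * x - s * cos x).
pose phi1 x := n + s * sin x; pose phi2 x := s * cos x.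
have d1 x : is_derive x 1 phi (phi1 x).
  by rewrite /phi; eapply der_eq; [der_tac|rewrite /phi1; ring].
have d2 x : is_derive x 1 phi1 (phi2 x).
  by rewrite /phi1; eapply der_eq; [der_tac|rewrite /phi2; ring].
have c2 : continuous phi2 by move=> x; rewrite /phi2; change {for x, continuous (fun y => s * cos y)}; cont_tac.
have cphi x : {for x, continuous (fun y => cos (phi y))}.
  by have := der_cont (d1 x) => ?; cont_tac.
set I := \int[mu]_(x in _) _.
have I2pi : `|I| <= 8.
  exact: norm_Rintegral_cos_le.
have [->|sn] := eqVneq `|s ^+ 2 - n ^+ 2| 0.
  rewrite addr0 mulr1; apply: (@le_trans _ _ (8 ^+ 4)); last lra.
  by rewrite ler_pXn2r ?nnegrE.
set m := Num.sqrt `|s ^+ 2 - n ^+ 2|.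
have m0 : 0 < m by rewrite sqrtr_gt0 lt_neqAle eq_sym sn normr_ge0.
have k0 : 0 < m / pi by rewrite divr_gt0.
have [x0 hx0] := bessel_phase_ge n s0.
rewrite -/m in hx0.
(* The second derivative has a sign on each of the three pieces, and the
   reflections [x -> - pi - x] and [x -> pi - x] carry the outer pieces to the
   middle one, where the first derivative has been bounded. *)
have I1 : `|\int[mu]_(x in `[- pi, - (pi / 2)]) cos (phi x)| <= 9 / Num.sqrt (m / pi).
  apply: (van_der_corput (x0 := - pi - x0) _ k0 d1 d2) => //.
  - lra.
  - right => x /andP[xl xr]; rewrite /phi2; apply: mulr_ge0_le0 => //.
    by rewrite -oppr_ge0 -cosDpi cos_ge0_pihalf//; lra.
  - move=> x /andP[xl xr]; have := hx0 (- pi - x) ltac:(lra).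
    rewrite (_ : - pi - x = - (x + pi)) ?sinN ?sinDpi ?opprK; last by ring.
    by rewrite (_ : - (x + pi) - x0 = - (x - (- pi - x0))) ?normrN//; ring.
have I2 : `|\int[mu]_(x in `[- (pi / 2), pi / 2]) cos (phi x)| <= 9 / Num.sqrt (m / pi).
  apply: (van_der_corput (x0 := x0) _ k0 d1 d2) => //.
  - lra.
  - left => x /andP[xl xr]; rewrite /phi2; apply: mulr_ge0 => //.
    by rewrite cos_ge0_pihalf//; lra.
have I3 : `|\int[mu]_(x in `[pi / 2, pi]) cos (phi x)| <= 9 / Num.sqrt (m / pi).
  apply: (van_der_corput (x0 := pi - x0) _ k0 d1 d2) => //.
  - lra.
  - right => x /andP[xl xr]; rewrite /phi2; apply: mulr_ge0_le0 => //.
    by rewrite -[x](subrK pi) cosDpi oppr_le0 cos_ge0_pihalf//; lra.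
  - move=> x /andP[xl xr]; have := hx0 (pi - x) ltac:(lra).
    have -> : sin (pi - x) = sin x by rewrite addrC sinDpi sinN opprK.
    by rewrite (_ : pi - x - x0 = - (x - (pi - x0))) ?normrN//; ring.
have Isum : `|I| <= 27 / Num.sqrt (m / pi).
  rewrite /I (@Rintegral_split _ _ _ (- (pi / 2))); [|lra|by move=> x _; exact: cphi].
  rewrite (@Rintegral_split _ (- (pi / 2)) _ (pi / 2)); [|lra|by move=> x _; exact: cphi].
  rewrite [leRHS](_ : _ = 9 / Num.sqrt (m / pi) + (9 / Num.sqrt (m / pi) + 9 / Num.sqrt (m / pi))); last by ring.
  by rewrite (le_trans (ler_normD _ _))// lerD// (le_trans (ler_normD _ _))// lerD.
have I4 : `|I| ^+ 4 <= 27 ^+ 4 * pi ^+ 2 / `|s ^+ 2 - n ^+ 2|.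
  apply: (@le_trans _ _ ((27 / Num.sqrt (m / pi)) ^+ 4)).
    by rewrite ler_pXn2r ?nnegrE ?divr_ge0 ?sqrtr_ge0.
  rewrite expr_div_n (_ : Num.sqrt (m / pi) ^+ 4 = (Num.sqrt (m / pi) ^+ 2) ^+ 2); last by rewrite -exprM.
  rewrite sqr_sqrtr ?(ltW k0)// expr_div_n sqr_sqrtr ?normr_ge0//.
  rewrite le_eqVlt; apply/orP; left; apply/eqP.
  move: (lt0r_neq0 pi0); move: (pi : R) => P P0; field.
  by rewrite sn P0.
rewrite mulrDr mulr1; apply: (@le_trans _ _ (8 ^+ 4 + 27 ^+ 4 * 4 ^+ 2)); last lra.
apply: lerD; first by rewrite ler_pXn2r ?nnegrE.
rewrite -ler_pdivlMr; last by rewrite lt_neqAle eq_sym sn normr_ge0.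
apply: (le_trans I4); rewrite ler_pM2r ?invr_gt0; last by rewrite lt_neqAle eq_sym sn normr_ge0.
by rewrite ler_pM2l ?exprn_gt0// ler_pXn2r ?nnegrE//; lra.
Qed.

End BesselBound.

(** * Products of measures and the frequency box *)

Section BoundedIntegrable.
Local Open Scope classical_set_scope.
Local Open Scope ring_scope.
Context d (T : measurableType d) (R : realType).

Lemma le_norm_integrable (m : {measure set T -> \bar R}) (D : set T)
    (f : T -> R) (M : R) :
  measurable D -> (m D < +oo)%E -> measurable_fun setT f ->
  (forall x, `|f x| <= M) -> m.-integrable D (EFin \o f).
Proof.
move=> mD fD mf fM; apply: measurable_bounded_integrable => //.
  exact/measurable_funTS.
exists M; split; first exact: num_real.
by move=> N MN z _; exact: le_trans (fM z) (ltW MN).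
Qed.

End BoundedIntegrable.

Section ProductIntegral.
Local Open Scope classical_set_scope.
Local Open Scope ring_scope.
Context d1 d2 (T1 : measurableType d1) (T2 : measurableType d2) (R : realType).
Variable m1 : {sigma_finite_measure set T1 -> \bar R}.
Variable m2 : {sigma_finite_measure set T2 -> \bar R}.
Variables (D1 : set T1) (D2 : set T2).
Hypotheses (mD1 : measurable D1) (mD2 : measurable D2).
Hypotheses (fin1 : (m1 D1 < +oo)%E) (fin2 : (m2 D2 < +oo)%E).
Variables (f : T1 * T2 -> R) (M : R).
Hypotheses (mf : measurable_fun setT f) (fM : forall z, `|f z| <= M).

Let mX : measurable (D1 `*` D2). Proof. exact: measurableX. Qed.

Lemma measure_setX_lty : ((m1 \x m2)%E (D1 `*` D2) < +oo)%E.
Proof.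
rewrite product_measure1E// lte_mul_pinfty// ge0_fin_numE//.
Qed.

Lemma integrable_setX : (m1 \x m2)%E.-integrable (D1 `*` D2) (EFin \o f).
Proof. exact: (le_norm_integrable mX measure_setX_lty mf fM). Qed.

Let integrable_setXT :
  (m1 \x m2)%E.-integrable setT ((EFin \o f) \_ (D1 `*` D2)).
Proof. exact/(integrable_mkcond _ mX)/integrable_setX. Qed.

Let integrable_xsection x : m2.-integrable D2 (EFin \o (fun y => f (x, y))).
Proof.
by apply: (le_norm_integrable (M := M)) => //; exact: (measurableT_comp mf).
Qed.

Let integrable_ysection y : m1.-integrable D1 (EFin \o (fun x => f (x, y))).
Proof.
by apply: (le_norm_integrable (M := M)) => //; exact: (measurableT_comp mf).
Qed.

Lemma Rintegral_setX :
  \int[(m1 \x m2)%E]_(z in D1 `*` D2) f z =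
  \int[m1]_(x in D1) \int[m2]_(y in D2) f (x, y).
Proof.
rewrite /Rintegral integral_mkcond -integral12_prod_meas1//; congr fine.
rewrite [RHS]integral_mkcond; apply: eq_integral => x _.
rewrite /fubini_F [RHS]patchE; case: ifPn => xD1; last first.
  by rewrite integral0_eq// => y _; rewrite patchE ifN// in_setX negb_and xD1.
rewrite fineK; last exact: integrable_fin_num (integrable_xsection x).
rewrite [RHS]integral_mkcond; apply: eq_integral => y _.
by rewrite !patchE in_setX/= xD1.
Qed.

Lemma Rintegral_setX_swap :
  \int[(m1 \x m2)%E]_(z in D1 `*` D2) f z =
  \int[m2]_(y in D2) \int[m1]_(x in D1) f (x, y).
Proof.
rewrite /Rintegral integral_mkcond -integral21_prod_meas1//; congr fine.
rewrite [RHS]integral_mkcond; apply: eq_integral => y _.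
rewrite /fubini_G [RHS]patchE; case: ifPn => yD2; last first.
  by rewrite integral0_eq// => x _; rewrite patchE ifN// in_setX negb_and yD2 orbT.
rewrite fineK; last exact: integrable_fin_num (integrable_ysection y).
rewrite [RHS]integral_mkcond; apply: eq_integral => x _.
by rewrite !patchE in_setX/= yD2 andbT.
Qed.

End ProductIntegral.

Section SigmaFiniteProduct.
Local Open Scope classical_set_scope.
Local Open Scope ring_scope.
Local Open Scope ereal_scope.
Context d1 d2 (T1 : measurableType d1) (T2 : measurableType d2) (R : realType).
Variable m1 : {sigma_finite_measure set T1 -> \bar R}.
Variable m2 : {sigma_finite_measure set T2 -> \bar R}.

(** A synonym that carries the sigma-finite structure, so that products can
    be iterated. *)
Definition sf_product : set (T1 * T2) -> \bar R := m1 \x m2.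

HB.instance Definition _ := Measure.on sf_product.

Lemma sf_product_sigma_finite : sigma_finite setT sf_product.
Proof.
have /sigma_finiteP[F [FT ndF Foo]] := sigma_finiteT m1.
have /sigma_finiteP[E [ET ndE Eoo]] := sigma_finiteT m2.
exists (fun n => F n `*` E n).
  apply/esym/seteqP; split => // -[x y] _.
  have [n _ Fx] : (\bigcup_i F i) x by rewrite -FT.
  have [k _ Ey] : (\bigcup_i E i) y by rewrite -ET.
  exists (maxn n k) => //; split.
  - by apply: (subsetPset _ _ (ndF _ _ (leq_maxl n k))).
  - by apply: (subsetPset _ _ (ndE _ _ (leq_maxr n k))).
move=> n; have [mF Fn] := Foo n; have [mE En] := Eoo n; split.
  exact: measurableX.
exact: measure_setX_lty.
Qed.

HB.instance Definition _ := Measure_isSigmaFinite.Build _ _ _ sf_product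
  sf_product_sigma_finite.

End SigmaFiniteProduct.

Section Oscillation.
Local Open Scope classical_set_scope.
Local Open Scope ring_scope.
Context (R : realType).

(** All phases [th] at once, so that the bound passes to products. *)
Definition oscillation_le d (T : measurableType d) (m : {measure set T -> \bar R})
    (D : set T) (phi : T -> R) (M : R) :=
  forall th, `|\int[m]_(x in D) cos (th + phi x)| <= M.

Lemma sin_cosB (x : R) : sin x = cos (x - pi / 2).
Proof. by rewrite cosBpihalf. Qed.

Lemma measurable_cos d (T : measurableType d) (f : T -> R) :
  measurable_fun setT f -> measurable_fun setT (fun x => cos (f x)).
Proof.
by move=> mf; apply: measurableT_comp mf; apply: continuous_measurable_fun; exact: continuous_cos.
Qed.

Lemma measurable_sin d (T : measurableType d) (f : T -> R) :
  measurable_fun setT f -> measurable_fun setT (fun x => sin (f x)).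
Proof.
by move=> mf; apply: measurableT_comp mf; apply: continuous_measurable_fun; exact: continuous_sin.
Qed.

Lemma integrable_cos d (T : measurableType d) (m : {measure set T -> \bar R})
    (D : set T) (phi : T -> R) : measurable D -> (m D < +oo)%E ->
  measurable_fun setT phi -> m.-integrable D (EFin \o (fun x => cos (phi x))).
Proof.
move=> mD fD mphi; apply: (le_norm_integrable (M := 1)) => //.
  exact: measurable_cos.
by move=> x; exact: cos_max.
Qed.

Context d1 d2 (T1 : measurableType d1) (T2 : measurableType d2).
Variable m1 : {sigma_finite_measure set T1 -> \bar R}.
Variable m2 : {sigma_finite_measure set T2 -> \bar R}.
Variables (D1 : set T1) (D2 : set T2).
Hypotheses (mD1 : measurable D1) (mD2 : measurable D2).
Hypotheses (fin1 : (m1 D1 < +oo)%E) (fin2 : (m2 D2 < +oo)%E).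

(** After Fubini, the inner integral of [cos (th + phi x + psi y)] is a
    combination of [cos (th + psi y)] and [sin (th + psi y)], with coefficients
    bounded by [M1]; hence the factor [2]. *)
Lemma oscillation_le_prod (phi : T1 -> R) (psi : T2 -> R) (M1 M2 : R) :
  measurable_fun setT phi -> measurable_fun setT psi ->
  oscillation_le m1 D1 phi M1 -> oscillation_le m2 D2 psi M2 ->
  oscillation_le (m1 \x m2)%E (D1 `*` D2) (fun z => phi z.1 + psi z.2)
    (2 * (M1 * M2)).
Proof.
move=> mphi mpsi phiM psiM th.
have mf : measurable_fun setT (fun z : T1 * T2 => cos (th + (phi z.1 + psi z.2))).
  apply/measurable_cos/measurable_funD; first exact: measurable_cst.
  by apply: measurable_funD; apply: measurableT_comp.
rewrite (Rintegral_setX_swap mD1 mD2 fin1 fin2 mf (fun z => cos_max _)).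
pose c := \int[m1]_(x in D1) cos (0 + phi x).
pose s := \int[m1]_(x in D1) cos (- (pi / 2) + phi x).
have Ic t : m1.-integrable D1 (EFin \o (fun x => cos (t + phi x))).
  by apply: integrable_cos => //; exact: measurable_funD.
have Id t : m2.-integrable D2 (EFin \o (fun x => cos (t + psi x))).
  by apply: integrable_cos => //; exact: measurable_funD.
have -> : \int[m2]_(y in D2) \int[m1]_(x in D1) cos (th + (phi x + psi y)) =
   \int[m2]_(y in D2) (c * cos (th + psi y) - s * cos (- (pi / 2) + th + psi y)).
  apply: eq_Rintegral => y _.
  have Icc t k : m1.-integrable D1 (EFin \o (fun x => cos (t + phi x) * k)).
    by apply: eq_integrable (integrableZr mD1 k (Ic t)).
  rewrite /c /s -!RintegralZr// -RintegralB//.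
  apply: eq_Rintegral => x _.
  rewrite add0r -addrA !(addrC (- (pi / 2))) -!sin_cosB -cosD.
  by congr cos; ring.
have Idc t k : m2.-integrable D2 (EFin \o (fun x => k * cos (t + psi x))).
  by apply: eq_integrable (integrableZl mD2 k (Id t)).
rewrite RintegralB// !RintegralZl//.
apply: (le_trans (ler_normB _ _)).
rewrite !normrM mulr_natl mulr2n; apply: lerD; apply: ler_pM => //;
  by first [exact: phiM | exact: psiM].
Qed.
End Oscillation.

Section Box.
Local Open Scope classical_set_scope.
Local Open Scope ring_scope.
Context (R : realType).
Local Notation mR := (measurableTypeR R).
Local Notation mu := (@lebesgue_measure R).
Local Notation I := (`[- pi, pi]%classic : set mR).

Lemma box4E : @box4 R = (I `*` I) `*` I `*` I.
Proof.
apply/seteqP; split=> -[[[a b] c] d] /=.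
  move=> h; have := h (@Ordinal 4 0 isT); have := h (@Ordinal 4 1 isT).
  have := h (@Ordinal 4 2 isT); have := h (@Ordinal 4 3 isT).
  by rewrite /coord4 !(tnth_nth 0)/= !in_itv/=.
rewrite !in_itv/= => -[[[ha hb] hc] hd] [[|[|[|[|//]]]] ?];
  by rewrite /coord4 !(tnth_nth 0).
Qed.

Lemma measurable_box4 : measurable (@box4 R : set (mR * mR * mR * mR)).
Proof. by rewrite box4E; do 3! (apply: measurableX => //). Qed.

Lemma lebesgue_measure_pi : mu I = (2 * pi)%:E.
Proof.
rewrite lebesgue_measure_itv/= lte_fin; have := @pi_gt0 R => pi0.
by rewrite (_ : - pi < pi) ?opprK -?EFinD ?mulr2n ?mulrDl ?mul1r//; lra.
Qed.

Lemma leb4_cube (K : set mR) : measurable K ->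
  (@leb4 R (K `*` K `*` K `*` K) = mu K * mu K * mu K * mu K)%E.
Proof.
move=> mK; have mK2 : measurable (K `*` K) by exact: measurableX.
have mK3 : measurable (K `*` K `*` K) by exact: measurableX.
have e2 : ((mu \x mu) (K `*` K) = mu K * mu K)%E by exact: product_measure1E.
have e3 : ((mu \x mu \x mu) (K `*` K `*` K) = mu K * mu K * mu K)%E.
  by rewrite -e2; exact: product_measure1E.
by rewrite -e3; exact: product_measure1E.
Qed.

Lemma leb4_box4 : @leb4 R (@box4 R) = ((2 * pi) ^+ 4)%:E.
Proof.
rewrite box4E; apply: etrans (leb4_cube _) _; first exact: measurable_itv.
by rewrite lebesgue_measure_pi -!EFinM; congr EFin; ring.
Qed.

Lemma leb4_box4_lty : (@leb4 R (@box4 R) < +oo)%E.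
Proof. by rewrite leb4_box4 ltry. Qed.

Lemma measurable_coord4 j :
  measurable_fun (setT : set (mR * mR * mR * mR)) (fun xi => @coord4 R xi j).
Proof.
have m1 : measurable_fun (setT : set (mR * mR * mR * mR)) (fun z => z.1.1.1).
  by do 2 (apply: measurableT_comp => //).
have m2 : measurable_fun (setT : set (mR * mR * mR * mR)) (fun z => z.1.1.2).
  by do 2 (apply: measurableT_comp => //).
have m3 : measurable_fun (setT : set (mR * mR * mR * mR)) (fun z => z.1.2).
  by apply: measurableT_comp.
have m4 : measurable_fun (setT : set (mR * mR * mR * mR)) (fun z => z.2).
  exact: measurable_snd.
case: j => [[|[|[|[|//]]]] ?].
- by apply: eq_measurable_fun m1 => -[[[a b] c] d] _; rewrite /coord4 (tnth_nth 0).
- by apply: eq_measurable_fun m2 => -[[[a b] c] d] _; rewrite /coord4 (tnth_nth 0).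
- by apply: eq_measurable_fun m3 => -[[[a b] c] d] _; rewrite /coord4 (tnth_nth 0).
- by apply: eq_measurable_fun m4 => -[[[a b] c] d] _; rewrite /coord4 (tnth_nth 0).
Qed.

Lemma measurable_sum_coord4 (F : 'I_4 -> R -> R) :
  (forall j, measurable_fun (setT : set mR) (F j)) ->
  measurable_fun (setT : set (mR * mR * mR * mR)) (fun xi => \sum_(j < 4) F j (@coord4 R xi j)).
Proof.
by move=> mF; apply: measurable_sum => j; apply: measurableT_comp; [exact: mF|exact: measurable_coord4].
Qed.

Lemma oscillation_le_box4 (phi : 'I_4 -> R -> R) (M : 'I_4 -> R) :
  (forall j, measurable_fun (setT : set mR) (phi j)) ->
  (forall j, oscillation_le mu I (phi j) (M j)) ->
  oscillation_le (@leb4 R) (@box4 R)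
    (fun xi => \sum_(j < 4) phi j (@coord4 R xi j)) (8 * \prod_(j < 4) M j).
Proof.
move=> mphi phiM; rewrite box4E.
have fI : (mu I < +oo)%E by rewrite lebesgue_measure_pi ltry.
pose j0 := @Ordinal 4 0 isT; pose j1 := @Ordinal 4 1 isT.
pose j2 := @Ordinal 4 2 isT; pose j3 := @Ordinal 4 3 isT.
have sumE (V : nmodType) (F : 'I_4 -> V) : \sum_(j < 4) F j = F j0 + F j1 + F j2 + F j3.
  rewrite !big_ord_recr/= big_ord0 add0r; congr (F _ + F _ + F _ + F _); exact: val_inj.
have prodE (F : 'I_4 -> R) : \prod_(j < 4) F j = F j0 * F j1 * F j2 * F j3.
  rewrite !big_ord_recr/= big_ord0 mul1r; congr (F _ * F _ * F _ * F _); exact: val_inj.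
have mI : measurable I by exact: measurable_itv.
have mI2 : measurable (I `*` I) by exact: measurableX.
have mI3 : measurable (I `*` I `*` I) by exact: measurableX.
pose mu1 : {sigma_finite_measure set mR -> \bar R} := mu.
pose mu2 : {sigma_finite_measure set (mR * mR)%type -> \bar R} := sf_product mu1 mu1.
pose mu3 : {sigma_finite_measure set (mR * mR * mR)%type -> \bar R} := sf_product mu2 mu1.
have h2 := @oscillation_le_prod R _ _ _ _ mu1 mu1 I I mI mI fI fI _ _ _ _ (mphi j0) (mphi j1) (phiM j0) (phiM j1).
have f2 : (mu2 (I `*` I) < +oo)%E := measure_setX_lty mI mI fI fI.
have m2 : measurable_fun setT (fun z : mR * mR => phi j0 z.1 + phi j1 z.2).
  by apply: measurable_funD; apply: measurableT_comp.
have h3 := @oscillation_le_prod R _ _ _ _ mu2 mu1 _ I mI2 mI f2 fI _ _ _ _ m2 (mphi j2) h2 (phiM j2).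
have f3 : (mu3 (I `*` I `*` I) < +oo)%E := measure_setX_lty mI2 mI f2 fI.
have m3 : measurable_fun setT (fun z : mR * mR * mR => phi j0 z.1.1 + phi j1 z.1.2 + phi j2 z.2).
  by apply: measurable_funD; [exact: (measurableT_comp m2)|apply: measurableT_comp].
have h4 := @oscillation_le_prod R _ _ _ _ mu3 mu1 _ I mI3 mI f3 fI _ _ _ _ m3 (mphi j3) h3 (phiM j3).
move=> th; have := h4 th; rewrite prodE.
rewrite (_ : 2 * (2 * (2 * (M j0 * M j1) * M j2) * M j3) = 8 * (M j0 * M j1 * M j2 * M j3)); last by ring.
set L := (X in `|X| <= _ -> _); set K := (X in _ -> `|X| <= _).
suff -> : K = L by [].
by apply: eq_Rintegral => -[[[a b] c] d] _; rewrite sumE /coord4 !(tnth_nth 0).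
Qed.

End Box.

(** * The Schroedinger kernel and Bessel's inequality *)

Section BoxAlgebra.
Local Open Scope classical_set_scope.
Local Open Scope ring_scope.
Context (R : realType).
Local Notation mR := (measurableTypeR R).
Local Notation mR4 := (mR * mR * mR * mR)%type.
Local Notation mu := (@lebesgue_measure R).
Implicit Types (f g : mR4 -> R).

(** Bounded measurable functions form an algebra on which the integral over the
    box is linear, so that no integrability has to be checked. *)
Definition bmeas f := measurable_fun setT f /\ exists M, forall x, `|f x| <= M.

Lemma bmeas_cst c : bmeas (fun=> c).
Proof. by split; [exact: measurable_cst|exists `|c|]. Qed.

Lemma bmeas_add f g : bmeas f -> bmeas g -> bmeas (fun x => f x + g x).
Proof.
move=> [mf [M fM]] [mg [N gN]]; split; first exact: measurable_funD.
by exists (M + N) => x; rewrite (le_trans (ler_normD _ _))// lerD.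
Qed.

Lemma bmeas_mul f g : bmeas f -> bmeas g -> bmeas (fun x => f x * g x).
Proof.
move=> [mf [M fM]] [mg [N gN]]; split; first exact: measurable_funM.
by exists (M * N) => x; rewrite normrM ler_pM.
Qed.

Lemma bmeas_opp f : bmeas f -> bmeas (fun x => - f x).
Proof.
move=> [mf [M fM]]; split; first exact: measurable_funN.
by exists M => x; rewrite normrN.
Qed.

Lemma bmeas_norm f : bmeas f -> bmeas (fun x => `|f x|).
Proof.
move=> [mf [M fM]]; split; first exact: measurableT_comp.
by exists M => x; rewrite normr_id.
Qed.

Lemma bmeas_sub f g : bmeas f -> bmeas g -> bmeas (fun x => f x - g x).
Proof. by move=> bf bg; apply: bmeas_add => //; exact: bmeas_opp. Qed.

Lemma bmeas_sqr f : bmeas f -> bmeas (fun x => f x ^+ 2).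
Proof. by move=> bf; apply: (bmeas_mul bf bf). Qed.

Lemma bmeas_sum (I : Type) (r : seq I) (F : I -> mR4 -> R) :
  (forall i, bmeas (F i)) -> bmeas (fun x => \sum_(i <- r) F i x).
Proof.
move=> bF; elim: r => [|i r ih].
  rewrite (_ : (fun x => _) = (fun=> 0)); first exact: bmeas_cst.
  by apply/funext => x; rewrite big_nil.
rewrite (_ : (fun x => _) = (fun x => F i x + \sum_(j <- r) F j x)).
  exact: bmeas_add.
by apply/funext => x; rewrite big_cons.
Qed.

Lemma bmeas_cos f : measurable_fun setT f -> bmeas (fun x => cos (f x)).
Proof.
by move=> mf; split; [exact: measurable_cos|exists 1 => x; exact: cos_max].
Qed.

Lemma bmeas_sin f : measurable_fun setT f -> bmeas (fun x => sin (f x)).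
Proof.
by move=> mf; split; [exact: measurable_sin|exists 1 => x; exact: sin_max].
Qed.

Definition Ibox f : R := \int[@leb4 R]_(xi in @box4 R) f xi.

Lemma bmeas_integrable f : bmeas f -> (@leb4 R).-integrable (@box4 R) (EFin \o f).
Proof.
move=> [mf [M fM]]; exact: (le_norm_integrable (@measurable_box4 R) (@leb4_box4_lty R) mf fM).
Qed.

Lemma eq_Ibox f g : (forall x, box4 x -> f x = g x) -> Ibox f = Ibox g.
Proof. by move=> fg; apply: eq_Rintegral => x; rewrite inE => /fg. Qed.

Lemma IboxD f g : bmeas f -> bmeas g ->
  Ibox (fun x => f x + g x) = Ibox f + Ibox g.
Proof.
by move=> /bmeas_integrable If /bmeas_integrable Ig; rewrite /Ibox RintegralD//; exact: measurable_box4.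
Qed.

Lemma IboxB f g : bmeas f -> bmeas g ->
  Ibox (fun x => f x - g x) = Ibox f - Ibox g.
Proof.
by move=> /bmeas_integrable If /bmeas_integrable Ig; rewrite /Ibox RintegralB//; exact: measurable_box4.
Qed.

Lemma IboxZ c f : bmeas f -> Ibox (fun x => c * f x) = c * Ibox f.
Proof.
by move=> /bmeas_integrable If; rewrite /Ibox RintegralZl//; exact: measurable_box4.
Qed.

Lemma Ibox_cst c : Ibox (fun=> c) = c * (2 * pi) ^+ 4.
Proof.
by rewrite /Ibox Rintegral_cst ?leb4_box4//; exact: measurable_box4.
Qed.

Lemma le_Ibox f g : bmeas f -> bmeas g -> (forall x, box4 x -> f x <= g x) ->
  Ibox f <= Ibox g.
Proof.
move=> /bmeas_integrable If /bmeas_integrable Ig fg.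
by apply: le_Rintegral => //; exact: measurable_box4.
Qed.

Lemma Ibox_ge0 f : (forall x, box4 x -> 0 <= f x) -> 0 <= Ibox f.
Proof. by move=> f0; exact: Rintegral_ge0. Qed.

Lemma le_normr_Ibox f : bmeas f -> `|Ibox f| <= Ibox (fun x => `|f x|).
Proof.
move=> /bmeas_integrable If; apply: le_normr_Rintegral => //; exact: measurable_box4.
Qed.

Lemma Ibox_sum (I : Type) (r : seq I) (F : I -> mR4 -> R) :
  (forall i, bmeas (F i)) ->
  Ibox (fun x => \sum_(i <- r) F i x) = \sum_(i <- r) Ibox (F i).
Proof.
move=> bF; elim: r => [|i r ih].
  rewrite [RHS]big_nil -[RHS](@mul0r R ((2 * pi) ^+ 4)) -Ibox_cst.
  by apply: eq_Ibox => x _; rewrite big_nil.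
rewrite big_cons -ih -IboxD//; last exact: bmeas_sum.
by apply: eq_Ibox => x _; rewrite big_cons.
Qed.

Definition symbol (xi : mR4) : R := \sum_(j < 4) (2 - 2 * cos (coord4 xi j)).

Lemma measurable_symbol : measurable_fun setT symbol.
Proof.
apply: (measurable_sum_coord4 (F := fun _ x => 2 - 2 * cos x)) => j.
apply: measurable_funB; first exact: measurable_cst.
by apply: measurable_funM; [exact: measurable_cst|exact: measurable_cos].
Qed.

Lemma measurable_linear (n : 'I_4 -> R) :
  measurable_fun setT (fun xi : mR4 => \sum_(j < 4) n j * coord4 xi j).
Proof.
apply: (measurable_sum_coord4 (F := fun j x => n j * x)) => j.
by apply: measurable_funM; [exact: measurable_cst|exact: measurable_id].
Qed.

Lemma measurable_dot4 (x : lattice4) : measurable_fun setT (dot4 x : mR4 -> R).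
Proof. exact: measurable_linear. Qed.

Lemma measurable_affine_phase (n : 'I_4 -> R) (th s : R) : measurable_fun setT
  (fun xi : mR4 => th + \sum_(j < 4) n j * coord4 xi j + s * symbol xi).
Proof.
apply: measurable_funD.
  by apply: measurable_funD; [exact: measurable_cst|exact: measurable_linear].
by apply: measurable_funM; [exact: measurable_cst|exact: measurable_symbol].
Qed.

Lemma AGM4 (a b c d : R) : a * b * c * d <= (a ^+ 4 + b ^+ 4 + c ^+ 4 + d ^+ 4) / 4.
Proof.
have e2 (x y : R) : x * y <= (x ^+ 2 + y ^+ 2) / 2 by have := sqr_ge0 (x - y); lra.
have := e2 (a * b) (c * d); have := e2 (a ^+ 2) (b ^+ 2); have := e2 (c ^+ 2) (d ^+ 2).
lra.
Qed.

(** Fubini factors the kernel of [exp (i s Delta)] into Bessel functions;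
    the arithmetic-geometric inequality replaces their product by a sum of
    fourth powers, one for each coordinate, which can be integrated in time
    separately. *)
Lemma schroedinger_kernel_bound (n : 'I_4 -> R) (th s : R) : 0 <= s ->
  `|Ibox (fun xi => cos (th + \sum_(j < 4) n j * coord4 xi j + s * symbol xi))| <=
  2 * 10 ^+ 7 * \sum_(j < 4) (1 + `|(2 * s) ^+ 2 - n j ^+ 2|)^-1.
Proof.
move=> s0; pose K j : R := 10 ^+ 7 / (1 + `|(2 * s) ^+ 2 - n j ^+ 2|).
have D0 j : 0 < 1 + `|(2 * s) ^+ 2 - n j ^+ 2| by rewrite ltr_pwDl.
have K0 j : 0 <= K j by rewrite divr_ge0 ?exprn_ge0// ltW.
pose M j := Num.sqrt (Num.sqrt (K j)).
have M4 j : M j ^+ 4 = K j by rewrite (exprM _ 2 2) !sqr_sqrtr ?sqrtr_ge0.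
have M0 j : 0 <= M j by rewrite sqrtr_ge0.
have hM j : oscillation_le mu `[- pi, pi] (fun x => n j * x - 2 * s * cos x) (M j).
  move=> t; have := @bessel_integral_bound R t (n j) (2 * s) ltac:(lra).
  rewrite -ler_pdivlMr// -/(K j) -M4 ler_pXn2r ?nnegrE//.
  by under eq_Rintegral do rewrite -addrA.
have mphi j : measurable_fun (setT : set mR) (fun x => n j * x - 2 * s * cos x).
  apply: measurable_funB.
    by apply: measurable_funM; [exact: measurable_cst|exact: measurable_id].
  by apply: measurable_funM; [exact: measurable_cst|exact: measurable_cos].
have := oscillation_le_box4 mphi hM (th + 8 * s).
set L := (X in `|X| <= _ -> _).
have <- : Ibox (fun xi => cos (th + \sum_(j < 4) n j * coord4 xi j + s * symbol xi)) = L.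
  apply: eq_Ibox => xi _; congr cos.
  rewrite /symbol !sumrB sumr_const card_ord -!mulr_sumr.
  by rewrite -mulr_natr; ring.
move=> /le_trans; apply.
have -> : \prod_(j < 4) M j = M ord0 * M (inord 1) * M (inord 2) * M (inord 3).
  rewrite !big_ord_recr/= big_ord0 mul1r.
  by congr (M _ * M _ * M _ * M _); apply: val_inj; rewrite /= ?inordK.
have := AGM4 (M ord0) (M (inord 1)) (M (inord 2)) (M (inord 3)).
rewrite !M4.
have <- : \sum_(j < 4) K j = K ord0 + K (inord 1) + K (inord 2) + K (inord 3).
  rewrite !big_ord_recr/= big_ord0 add0r.
  by congr (K _ + K _ + K _ + K _); apply: val_inj; rewrite /= ?inordK.
rewrite /K -mulr_sumr; lra.
Qed.

(** A phase with one nontrivial integer frequency oscillates with constant [0]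
    in that coordinate, and the product bound passes this to the box. *)
Lemma Ibox_character (n : 'I_4 -> int) (th : R) (j0 : 'I_4) : n j0 != 0 ->
  Ibox (fun xi => cos (th + \sum_(j < 4) (n j)%:~R * coord4 xi j)) = 0.
Proof.
move=> n0; pose M j : R := if j == j0 then 0 else 8.
have hM j : oscillation_le mu `[- pi, pi] (fun x => (n j)%:~R * x) (M j).
  move=> t; rewrite /M; case: eqP => [->|_].
    have nz : (n j0)%:~R != 0 :> R by rewrite intr_eq0.
    have pi0 := @pi_gt0 R; have pipi : - pi <= pi :> R by lra.
    have dF (x : R) : - pi <= x <= pi -> is_derive x 1 (fun x => sin (t + (n j0)%:~R * x) / (n j0)%:~R) (cos (t + (n j0)%:~R * x)).
      by move=> _; eapply der_eq; [der_tac|field].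
    have cF (x : R) : - pi <= x <= pi -> {for x, continuous (fun x : R => cos (t + (n j0)%:~R * x))}.
      by move=> _; cont_tac.
    rewrite (Rintegral_FTC pipi dF cF) -mulrBl normr_le0 mulf_eq0.
    apply/orP; left; rewrite subr_eq0; apply/eqP.
    have per (k : nat) y : sin (y + k%:R * (2 * pi)) = sin y :> R.
      have := periodicn (@sinD2pi R) k y.
      by move=> h; rewrite -[RHS]h; congr sin; rewrite -[pi *+ 2 *+ k]mulr_natl -[pi *+ 2]mulr_natl.
    case: (n j0) => k.
      by rewrite -(per k (_ + _ * - pi)); congr sin; rewrite -pmulrn; ring.
    by rewrite NegzE -(per k.+1); congr sin; rewrite mulrNz -pmulrn; ring.
  by apply: norm_Rintegral_cos_le => x; cont_tac.
have mphi j : measurable_fun (setT : set mR) (fun x => (n j)%:~R * x).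
  by apply: measurable_funM; [exact: measurable_cst|exact: measurable_id].
have := oscillation_le_box4 mphi hM th.
rewrite (bigD1 j0)//= {1}/M eqxx mul0r mulr0 normr_le0 => /eqP h.
exact: h.
Qed.

Definition trig_re (F : seq lattice4) (c : lattice4 -> R) (xi : mR4) : R :=
  \sum_(x <- F) c x * cos (dot4 x xi).
Definition trig_im (F : seq lattice4) (c : lattice4 -> R) (xi : mR4) : R :=
  \sum_(x <- F) c x * sin (dot4 x xi).

Lemma bmeas_cos_dot4 (x : lattice4) : bmeas (fun xi => cos (dot4 x xi)).
Proof. exact: (bmeas_cos (measurable_dot4 x)). Qed.

Lemma bmeas_sin_dot4 (x : lattice4) : bmeas (fun xi => sin (dot4 x xi)).
Proof. exact: (bmeas_sin (measurable_dot4 x)). Qed.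

Lemma bmeas_trig_re F c : bmeas (trig_re F c).
Proof.
apply: bmeas_sum => x; apply: bmeas_mul; first exact: bmeas_cst.
exact: bmeas_cos_dot4.
Qed.

Lemma bmeas_trig_im F c : bmeas (trig_im F c).
Proof.
apply: bmeas_sum => x; apply: bmeas_mul; first exact: bmeas_cst.
exact: bmeas_sin_dot4.
Qed.

Lemma dot4B (x y : lattice4) (xi : mR4) : dot4 (x - y) xi = dot4 x xi - dot4 y xi.
Proof.
rewrite /dot4 -sumrB; apply: eq_bigr => j _.
by rewrite !mxE rmorphB/= mulrBl.
Qed.

Lemma Ibox_cos_dot4 (x : lattice4) :
  Ibox (fun xi => cos (dot4 x xi)) = (x == 0)%:R * (2 * pi) ^+ 4.
Proof.
have [->|x0] := eqVneq x 0.
  rewrite mul1r -[RHS]mul1r -Ibox_cst; apply: eq_Ibox => xi _.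
  by rewrite /dot4 big1 ?cos0// => j _; rewrite mxE mul0r.
have [j xj] : exists j, x ord0 j != 0.
  apply/existsP; rewrite -negb_forall; apply: contra x0 => /forallP x0.
  by apply/eqP/rowP => j; rewrite mxE; exact/eqP.
rewrite mul0r -[RHS](Ibox_character 0 xj); apply: eq_Ibox => xi _.
by rewrite add0r.
Qed.

Lemma Ibox_trig_sqr (F : seq lattice4) c : uniq F ->
  Ibox (fun xi => trig_re F c xi ^+ 2 + trig_im F c xi ^+ 2) =
  (2 * pi) ^+ 4 * \sum_(x <- F) c x ^+ 2.
Proof.
move=> uF.
transitivity (Ibox (fun xi => \sum_(x <- F) \sum_(y <- F)
    c x * c y * cos (dot4 (x - y) xi))).
  apply: eq_Ibox => xi _; rewrite !expr2 /trig_re /trig_im.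
  rewrite !big_distrlr/= -big_split/=; apply: eq_bigr => x _.
  by rewrite -big_split/=; apply: eq_bigr => y _; rewrite dot4B cosB; ring.
rewrite Ibox_sum; last first.
  move=> x; apply: bmeas_sum => y; apply: bmeas_mul; first exact: bmeas_cst.
  exact: bmeas_cos_dot4.
rewrite mulr_sumr big_seq [RHS]big_seq; apply: eq_bigr => x xF.
rewrite Ibox_sum; last first.
  move=> y; apply: bmeas_mul; first exact: bmeas_cst.
  exact: bmeas_cos_dot4.
rewrite (bigD1_seq x)//= big1 ?addr0; last first.
  move=> y yx; rewrite IboxZ; last exact: bmeas_cos_dot4.
  by rewrite Ibox_cos_dot4 subr_eq0 eq_sym (negbTE yx) mul0r mulr0.
rewrite IboxZ; last exact: bmeas_cos_dot4.
by rewrite Ibox_cos_dot4 subrr eqxx mul1r; ring.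
Qed.

(** Bessel's inequality for the real parts of the Fourier coefficients of
    [A + i B]: expand the square of the distance to the trigonometric polynomial
    that has these coefficients. *)
Lemma bessel_inequality (F : seq lattice4) (A B : mR4 -> R) : uniq F ->
  bmeas A -> bmeas B ->
  \sum_(x <- F) Ibox (fun xi => A xi * cos (dot4 x xi) - B xi * sin (dot4 x xi)) ^+ 2
  <= (2 * pi) ^+ 4 * Ibox (fun xi => A xi ^+ 2 + B xi ^+ 2).
Proof.
move=> uF bA bB.
pose u x := Ibox (fun xi => A xi * cos (dot4 x xi) - B xi * sin (dot4 x xi)).
rewrite -/(u _); set N : R := (2 * pi) ^+ 4.
have N0 : 0 < N by rewrite exprn_gt0// mulr_gt0// pi_gt0.
pose c x := u x / N.
have bP := bmeas_trig_re F c; have bS := bmeas_trig_im F c.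
have bcs x : bmeas (fun xi => A xi * cos (dot4 x xi) - B xi * sin (dot4 x xi)).
  apply: bmeas_sub; apply: bmeas_mul => //.
  - exact: bmeas_cos_dot4.
  - exact: bmeas_sin_dot4.
have h : 0 <= Ibox (fun xi => (A xi - trig_re F c xi) ^+ 2 + (B xi + trig_im F c xi) ^+ 2).
  by apply: Ibox_ge0 => xi _; rewrite addr_ge0 ?sqr_ge0.
have cross : Ibox (fun xi => A xi * trig_re F c xi - B xi * trig_im F c xi) =
    \sum_(x <- F) c x * u x.
  transitivity (Ibox (fun xi => \sum_(x <- F) c x *
      (A xi * cos (dot4 x xi) - B xi * sin (dot4 x xi)))).
    apply: eq_Ibox => xi _; rewrite /trig_re /trig_im !mulr_sumr -sumrB.
    by apply: eq_bigr => x _; ring.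
  rewrite Ibox_sum; last by move=> x; apply: bmeas_mul => //; exact: bmeas_cst.
  by apply: eq_bigr => x _; rewrite IboxZ.
have bAP : bmeas (fun xi => A xi * trig_re F c xi - B xi * trig_im F c xi).
  by apply: bmeas_sub; exact: bmeas_mul.
have bAB : bmeas (fun xi => A xi ^+ 2 + B xi ^+ 2) by apply: bmeas_add; exact: bmeas_sqr.
have bPS : bmeas (fun xi => trig_re F c xi ^+ 2 + trig_im F c xi ^+ 2).
  by apply: bmeas_add; exact: bmeas_sqr.
move: h; rewrite (_ : Ibox _ = Ibox (fun xi => (A xi ^+ 2 + B xi ^+ 2) -
   2 * (A xi * trig_re F c xi - B xi * trig_im F c xi) +
   (trig_re F c xi ^+ 2 + trig_im F c xi ^+ 2))); last first.
  by apply: eq_Ibox => xi _; ring.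
rewrite IboxD//; last first.
  by apply: bmeas_sub => //; apply: bmeas_mul => //; exact: bmeas_cst.
rewrite IboxB//; last by apply: bmeas_mul => //; exact: bmeas_cst.
rewrite IboxZ// cross Ibox_trig_sqr//.
have -> : \sum_(x <- F) c x * u x = N^-1 * \sum_(x <- F) u x ^+ 2.
  by rewrite mulr_sumr; apply: eq_bigr => x _; rewrite /c; ring.
have -> : \sum_(x <- F) c x ^+ 2 = N^-1 * (N^-1 * \sum_(x <- F) u x ^+ 2).
  by rewrite !mulr_sumr; apply: eq_bigr => x _; rewrite /c; ring.
rewrite -/N [N * _]mulrA divff ?lt0r_neq0// mul1r => h.
rewrite mulrC -ler_pdivrMr// mulrC; lra.
Qed.

End BoxAlgebra.

(** * A weighted Parseval inequality *)

Section WeightedParseval.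
Local Open Scope classical_set_scope.
Local Open Scope ring_scope.
Context (R : realType).
Local Notation mR := (measurableTypeR R).
Local Notation mR4 := (mR * mR * mR * mR)%type.
Local Notation mu := (@lebesgue_measure R).

Definition dyadic (l : R) (j : nat) : R := l / 2 ^+ j.

Lemma dyadic_gt0 l j : 0 < l -> 0 < dyadic l j.
Proof. by move=> l0; rewrite divr_gt0 ?exprn_gt0. Qed.

Lemma dyadicS l j : dyadic l j.+1 = dyadic l j / 2.
Proof. by rewrite /dyadic exprSr invfM mulrA. Qed.

Lemma dyadicSl l j : dyadic l j.+1 = dyadic (l / 2) j.
Proof. by rewrite /dyadic exprS invfM mulrA. Qed.

Lemma sum_dyadic_sqrV l J : 0 < l ->
  \sum_(j < J.+1) (dyadic l j) ^- 2 <= 4 / 3 * (dyadic l J) ^- 2.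
Proof.
move=> l0; elim: J => [|J ih].
  rewrite big_ord_recr big_ord0/= add0r.
  by rewrite -[leLHS]mul1r ler_pM2r ?invr_gt0 ?exprn_gt0 ?dyadic_gt0//; lra.
rewrite big_ord_recr/= dyadicS (_ : (dyadic l J / 2) ^- 2 = 4 * dyadic l J ^- 2).
  by move: ih; set x := dyadic l J ^- 2; lra.
by rewrite -exprVn invfM invrK exprMn exprVn; ring.
Qed.

(** The two halves of a dyadic scale, cut at [a], are geometric series dominated
    by their term nearest to [a]; the constants do not depend on [J]. *)
Lemma sum_dyadic_above l a J : 0 < l -> 0 <= a ->
  \sum_(j < J) (a <= dyadic l j)%R%:R * (a ^+ 2 / dyadic l j ^+ 2) <= 4 / 3.
Proof.
move=> l0 a0; elim: J => [|J ih]; first by rewrite big_ord0; lra.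
have [aJ|aJ] := leP a (dyadic l J); last first.
  by rewrite big_ord_recr/= (lt_geF aJ) mul0r addr0.
apply: (@le_trans _ _ (a ^+ 2 * \sum_(j < J.+1) (dyadic l j) ^- 2)).
  rewrite mulr_sumr; apply: ler_sum => j _.
  rewrite ler_piMl ?lern1 ?leq_b1//.
  by rewrite divr_ge0 ?sqr_ge0.
apply: (@le_trans _ _ (a ^+ 2 * (4 / 3 * (dyadic l J) ^- 2))).
  by rewrite ler_wpM2l ?sqr_ge0// sum_dyadic_sqrV.
suff : a ^+ 2 / dyadic l J ^+ 2 <= 1 by rewrite mulrCA; lra.
rewrite ler_pdivrMr ?exprn_gt0 ?dyadic_gt0// mul1r.
by rewrite ler_pXn2r ?nnegrE// ltW// dyadic_gt0.
Qed.

Lemma sum_dyadic l J : 0 < l -> \sum_(j < J) dyadic l j <= 2 * l.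
Proof.
move=> l0; suff -> : \sum_(j < J) dyadic l j = 2 * l - 2 * dyadic l J.
  by have := dyadic_gt0 J l0; lra.
elim: J => [|J ih]; first by rewrite big_ord0 /dyadic expr0 divr1 subrr.
by rewrite big_ord_recr/= ih dyadicS; field.
Qed.

Lemma sum_dyadic_below l a J : 0 < l -> 0 <= a ->
  \sum_(j < J) (dyadic l j < a)%R%:R * dyadic l j <= 2 * a.
Proof.
move=> + a0; elim: J l => [|J ih] l l0; first by rewrite big_ord0 mulr_ge0.
have [la|al] := ltP l a.
  apply: (@le_trans _ _ (\sum_(j < J.+1) dyadic l j)).
    apply: ler_sum => j _; rewrite ler_piMl ?lern1 ?leq_b1//.
    by rewrite ltW// dyadic_gt0.
  by apply: (le_trans (sum_dyadic _ l0)); rewrite ler_pM2l// ltW.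
rewrite big_ord_recl/= (_ : dyadic l 0 = l) ?(le_gtF al) ?mul0r ?add0r; last first.
  by rewrite /dyadic expr0 divr1.
under eq_bigr do rewrite /bump leq0n add1n dyadicSl.
by apply: ih; rewrite divr_gt0.
Qed.

Lemma dyadic_le_eps l K e : 0 < e -> exists J, K * dyadic l J <= e.
Proof.
move=> e0; pose m := Num.truncn (`|K * l| / e).
exists m; rewrite /dyadic mulrA ler_pdivrMr ?exprn_gt0//.
apply: (le_trans (ler_norm _)); rewrite -ler_pdivrMl// mulrC.
apply: (@le_trans _ _ (m.+1%:R)); first exact/ltW/truncnS_gt.
by rewrite -natrX ler_nat ltn_expl.
Qed.

Definition low_freq (l : R) : mR4 -> R := \1_[set xi | symbol xi <= l ^+ 2].

Lemma measurable_low_freq l : measurable [set xi : mR4 | symbol xi <= l ^+ 2].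
Proof.
rewrite (_ : [set xi | _] = @symbol R @^-1` `]-oo, l ^+ 2]); last first.
  by apply/seteqP; split => xi /=; rewrite in_itv.
by rewrite -[X in measurable X]setTI; apply: measurable_symbol.
Qed.

Lemma low_freqE l xi : low_freq l xi = (symbol xi <= l ^+ 2)%R%:R.
Proof.
rewrite /low_freq indicE; congr (nat_of_bool _)%:R.
by apply/idP/idP => [/set_mem//|h]; exact/mem_set.
Qed.

Lemma bmeas_low_freq l : bmeas (low_freq l).
Proof.
split; first by apply: measurable_indic; exact: measurable_low_freq.
by exists 1 => xi; rewrite low_freqE normr_nat lern1 leq_b1.
Qed.

Lemma coord4_le_symbol (xi : mR4) j : box4 xi ->
  `|coord4 xi j| <= pi / 2 * Num.sqrt (symbol xi).
Proof.
move=> bxi; have pi0 := @pi_gt0 R.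
have term i : 2 - 2 * cos (coord4 xi i) = (2 * sin (coord4 xi i / 2)) ^+ 2.
  by rewrite exprMn; have := one_subr_cos (coord4 xi i); lra.
have le_sym : (2 * sin (coord4 xi j / 2)) ^+ 2 <= symbol xi.
  rewrite -term /symbol (bigD1 j)//= lerDl; apply: sumr_ge0 => i _.
  by rewrite term sqr_ge0.
have xj : `|coord4 xi j / 2| <= pi / 2.
  have := bxi j; rewrite -ler_norml => h.
  by rewrite normrM [X in _ * X]ger0_norm// ler_pM2r.
have := norm_sin_ge_chord xj.
have -> : `|coord4 xi j / 2| = `|coord4 xi j| / 2.
  by rewrite normrM; congr (_ * _); rewrite ger0_norm.
rewrite two_div_pi ler_pdivrMr// => h.
have : `|2 * sin (coord4 xi j / 2)| <= Num.sqrt (symbol xi).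
  by rewrite -sqrtr_sqr ler_sqrt// (le_trans _ le_sym) ?sqr_ge0.
rewrite normrM ger0_norm// => h2.
apply: (le_trans h); rewrite mulrC -mulrA ler_pM2l//; lra.
Qed.

(** Jordan's inequality puts the low frequencies in a cube of side [pi * l]. *)
Lemma low_freq_volume l : 0 <= l -> Ibox (low_freq l) <= (pi * l) ^+ 4.
Proof.
move=> l0; have pi0 := @pi_gt0 R.
pose K : set mR := `[- (pi / 2 * l), pi / 2 * l]%classic.
have mK : measurable K by exact: measurable_itv.
have muK : mu K = (pi * l)%:E.
  rewrite /K lebesgue_measure_itv/= lte_fin; case: ltP => h.
    by rewrite -EFinD; congr EFin; lra.
  have pl : 0 <= pi * l by rewrite mulr_ge0// ltW.
  by congr EFin; lra.
have e4 : @leb4 R (K `*` K `*` K `*` K) = ((pi * l) ^+ 4)%:E.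
  by apply: etrans (leb4_cube mK) _; rewrite muK -!EFinM; congr EFin; ring.
rewrite /Ibox /Rintegral -lee_fin -e4 fineK; last first.
  by apply: integrable_fin_num; [exact: measurable_box4|exact/bmeas_integrable/bmeas_low_freq].
rewrite integral_indic; [|exact: measurable_box4|exact: measurable_low_freq].
apply: le_measure; rewrite ?inE.
- by apply: measurableI; [exact: measurable_low_freq|exact: measurable_box4].
- by do 3 (apply: measurableX => //).
move=> xi [/= sxi bxi].
have cK j : K (coord4 xi j).
  rewrite /K /= in_itv/= -ler_norml.
  apply: (le_trans (coord4_le_symbol _ bxi)); rewrite ler_pM2l ?divr_gt0//.
  by rewrite -(ger0_norm l0) -sqrtr_sqr ler_sqrt// sqr_ge0.
move: xi cK {sxi bxi} => [[[a b] c] d] cK.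
have := cK (@Ordinal 4 0 isT); have := cK (@Ordinal 4 1 isT).
have := cK (@Ordinal 4 2 isT); have := cK (@Ordinal 4 3 isT).
by rewrite /coord4 !(tnth_nth 0).
Qed.

Lemma trig_re_split E (f g h : lattice4 -> R) xi : (forall y, f y = g y + h y) ->
  trig_re E f xi = trig_re E g xi + trig_re E h xi.
Proof.
by move=> fgh; rewrite /trig_re -big_split/=; apply: eq_bigr => y _; rewrite fgh mulrDl.
Qed.

Lemma trig_im_split E (f g h : lattice4 -> R) xi : (forall y, f y = g y + h y) ->
  trig_im E f xi = trig_im E g xi + trig_im E h xi.
Proof.
by move=> fgh; rewrite /trig_im -big_split/=; apply: eq_bigr => y _; rewrite fgh mulrDl.
Qed.

Definition trig_sqr E (f : lattice4 -> R) xi := trig_re E f xi ^+ 2 + trig_im E f xi ^+ 2.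

Lemma bmeas_trig_sqr E f : bmeas (trig_sqr E f).
Proof.
by apply: bmeas_add; apply: bmeas_sqr; [exact: bmeas_trig_re|exact: bmeas_trig_im].
Qed.

Lemma trig_sqr_ge0 E f xi : 0 <= trig_sqr E f xi.
Proof. by rewrite addr_ge0 ?sqr_ge0. Qed.

Lemma trig_sqr_le E f xi : trig_sqr E f xi <= 2 * (\sum_(y <- E) `|f y|) ^+ 2.
Proof.
have S0 : 0 <= \sum_(y <- E) `|f y| by apply: sumr_ge0.
have h (c : lattice4 -> R) : (forall y, `|c y| <= 1) ->
    (\sum_(y <- E) f y * c y) ^+ 2 <= (\sum_(y <- E) `|f y|) ^+ 2.
  move=> c1; rewrite -[leLHS]real_normK ?num_real// ler_pXn2r ?nnegrE//.
  apply: (le_trans (ler_norm_sum _ _ _)); apply: ler_sum => y _.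
  by rewrite normrM ler_piMr.
rewrite mulr_natl mulr2n; apply: lerD; apply: h => y.
  exact: cos_max.
exact: sin_max.
Qed.

(** Splitting [f] at the height [l^3]: the flat part is controlled by
    Parseval, and the tall part by its [l^1] norm and the volume of the
    frequencies below [l]. Cube roots [a] of [|f|] keep the scaling visible. *)
Lemma low_freq_trig_sqr E (f a : lattice4 -> R) l : uniq E -> 0 < l ->
  (forall y, 0 <= a y) -> (forall y, `|f y| = a y ^+ 3) ->
  Ibox (fun xi => low_freq l xi * trig_sqr E f xi) <=
  pi ^+ 4 * (32 * \sum_(y <- E) (a y <= l)%R%:R * a y ^+ 6 +
    4 * l ^+ 3 * (\sum_(y <- E) a y ^+ 4) * \sum_(y <- E) (l < a y)%R%:R * a y ^+ 3).
Proof.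
move=> uE l0 a0 fa.
pose g y := (a y <= l)%R%:R * f y; pose h y := (l < a y)%R%:R * f y.
have fgh y : f y = g y + h y.
  by rewrite /g /h; case: leP => _; rewrite ?mul1r ?mul0r ?addr0 ?add0r.
set S := \sum_(y <- E) a y ^+ 4; pose T := \sum_(y <- E) `|h y|.
have TE : T = \sum_(y <- E) (l < a y)%R%:R * a y ^+ 3.
  by apply: eq_bigr => y _; rewrite normrM fa ger0_norm.
have T0 : 0 <= T by apply: sumr_ge0.
have lTS : l * T <= S.
  rewrite TE mulr_sumr; apply: ler_sum => y _; case: ltP => ly.
    by rewrite mul1r [leRHS]exprS ler_wpM2r ?exprn_ge0// ltW.
  by rewrite mul0r mulr0 exprn_ge0.
rewrite -TE.
have bl := bmeas_low_freq l.
apply: (@le_trans _ _ (Ibox (fun xi => 2 * trig_sqr E g xi + 4 * T ^+ 2 * low_freq l xi))).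
  apply: le_Ibox.
  - by apply: bmeas_mul => //; exact: bmeas_trig_sqr.
  - apply: bmeas_add; apply: bmeas_mul => //; first exact: bmeas_cst.
      exact: bmeas_trig_sqr.
    exact: bmeas_cst.
  move=> xi _; rewrite low_freqE; case: (symbol xi <= _).
    rewrite mul1r mulr1.
    have := trig_sqr_le E h xi; rewrite -/T.
    have : trig_sqr E f xi <= 2 * trig_sqr E g xi + 2 * trig_sqr E h xi.
      rewrite /trig_sqr (trig_re_split _ _ fgh) (trig_im_split _ _ fgh).
      have := sqr_ge0 (trig_re E g xi - trig_re E h xi).
      have := sqr_ge0 (trig_im E g xi - trig_im E h xi).
      by rewrite !sqrrB !sqrrD; lra.
    lra.
  by rewrite mul0r mulr0 addr0 mulr_ge0// trig_sqr_ge0.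
rewrite IboxD; last 2 first.
- by apply: bmeas_mul; [exact: bmeas_cst|exact: bmeas_trig_sqr].
- by apply: bmeas_mul => //; exact: bmeas_cst.
rewrite !IboxZ//; last exact: bmeas_trig_sqr.
rewrite Ibox_trig_sqr//.
have -> : \sum_(x <- E) g x ^+ 2 = \sum_(y <- E) (a y <= l)%R%:R * a y ^+ 6.
  apply: eq_bigr => y _; rewrite /g exprMn -[f y ^+ 2]real_normK ?num_real// fa.
  by rewrite -exprM; case: (a y <= l); rewrite ?expr1n ?expr0n.
set U := \sum_(y <- E) _ * a y ^+ 6.
have vol := low_freq_volume (ltW l0).
have p4 : 0 <= pi ^+ 4 :> R by rewrite exprn_ge0// pi_ge0.
have : 4 * T ^+ 2 * Ibox (low_freq l) <= 4 * T ^+ 2 * (pi * l) ^+ 4.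
  by rewrite ler_wpM2l// mulr_ge0 ?sqr_ge0.
have : 4 * T * l ^+ 3 * pi ^+ 4 * (l * T) <= 4 * T * l ^+ 3 * pi ^+ 4 * S.
  by rewrite ler_wpM2l// mulr_ge0// mulr_ge0 ?exprn_ge0 ?(ltW l0)// mulr_ge0.
rewrite (_ : (2 * pi) ^+ 4 = 16 * pi ^+ 4); last by ring.
rewrite (_ : (pi * l) ^+ 4 = l ^+ 4 * pi ^+ 4); last by ring.
clear; move: (pi ^+ 4) => P; move: (Ibox _) => V; lra.
Qed.

(** Below the last shell nothing but the boundedness of [w] is used; that term
    vanishes as [J] grows. The scale starts at [4] because [symbol <= 16]. *)
Lemma dyadic_cover (w : mR4 -> R) (W : R) J xi : box4 xi ->
  0 <= w xi <= W -> w xi * symbol xi <= 1 ->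
  w xi <= \sum_(j < J) 4 * (dyadic 4 j) ^- 2 * low_freq (dyadic 4 j) xi
          + W * low_freq (dyadic 4 J) xi.
Proof.
move=> bxi /andP[w0 wW] w1.
have W0 := le_trans w0 wW.
have d0 j : 0 < dyadic 4 j by exact: dyadic_gt0.
have low01 l : 0 <= low_freq l xi by rewrite low_freqE.
elim: J => [|J ih].
  rewrite big_ord0 add0r low_freqE (_ : symbol xi <= _) ?mulr1//.
  rewrite /dyadic expr0 divr1 /symbol.
  apply: (@le_trans _ _ (\sum_(j < 4) (4 : R))); last by rewrite sumr_const card_ord -mulr_natl; lra.
  by apply: ler_sum => j _; have := cos_geN1 (coord4 xi j); lra.
have S0 : 0 <= \sum_(j < J) 4 * (dyadic 4 j) ^- 2 * low_freq (dyadic 4 j) xi.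
  by apply: sumr_ge0 => j _; rewrite !mulr_ge0// invr_ge0 exprn_ge0 ?ltW.
rewrite big_ord_recr/=; move: ih S0; set S := \sum_(j < J) _ => ih S0.
have dJ2 : dyadic 4 J.+1 ^+ 2 = dyadic 4 J ^+ 2 / 4 by rewrite dyadicS expr_div_n; lra.
have t0 : 0 <= 4 * dyadic 4 J ^- 2 * low_freq (dyadic 4 J) xi.
  by rewrite !mulr_ge0// invr_ge0 exprn_ge0 ?ltW.
have D2 : 0 < dyadic 4 J ^+ 2 by rewrite exprn_gt0.
have [h1|h1] := leP (symbol xi) (dyadic 4 J.+1 ^+ 2).
  have lJ : low_freq (dyadic 4 J) xi = 1.
    by rewrite low_freqE (_ : _ <= _)//; move: h1; rewrite dJ2; lra.
  have lJ1 : low_freq (dyadic 4 J.+1) xi = 1 by rewrite low_freqE h1.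
  by move: ih t0; rewrite lJ lJ1; lra.
have lJ1 : low_freq (dyadic 4 J.+1) xi = 0 by rewrite low_freqE lt_geF.
rewrite lJ1 mulr0 addr0; move: ih t0; rewrite !low_freqE.
have [h2|h2] := leP (symbol xi) (dyadic 4 J ^+ 2); last by rewrite !mulr0; lra.
rewrite !mulr1 => _ _; have : w xi <= 4 / dyadic 4 J ^+ 2.
  rewrite ler_pdivlMr//; have : w xi * (dyadic 4 J ^+ 2 / 4) <= w xi * symbol xi.
    by rewrite ler_wpM2l// ltW// -dJ2.
  lra.
lra.
Qed.

(** The endpoint Hardy-Littlewood-Sobolev inequality for [1 / omega], in
    frequency space: heights and frequencies are paired dyadically, and each
    value of [f] meets a geometric series on either side of its own
    frequency. *)
Lemma weighted_parseval E (f a : lattice4 -> R) (w : mR4 -> R) S : uniq E ->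
  S = \sum_(y <- E) a y ^+ 4 ->
  (forall y, 0 <= a y) -> (forall y, `|f y| = a y ^+ 3) ->
  bmeas w -> (forall xi, 0 <= w xi) ->
  (forall xi, box4 xi -> w xi * symbol xi <= 1) ->
  Ibox (fun xi => w xi * trig_sqr E f xi) <= pi ^+ 4 * (171 * S + 32 * S ^+ 2).
Proof.
move=> uE SE a0 fa bw w0 w1; have [mw [W wW]] := bw.
have W0 : 0 <= W by apply: le_trans (wW (0, 0, 0, 0)).
have d0 j : 0 < dyadic 4 j by exact: dyadic_gt0.
have S0 : 0 <= S by rewrite SE; apply: sumr_ge0 => y _; rewrite exprn_ge0.
set B := \sum_(y <- E) `|f y|.
have p4 : 0 <= pi ^+ 4 :> R by rewrite exprn_ge0// pi_ge0.
apply/ler_addgt0Pr => e e0.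
have [J hJ] := dyadic_le_eps 4 (W * (2 * B ^+ 2) * pi ^+ 4 * 64) e0.
pose I j := Ibox (fun xi => low_freq (dyadic 4 j) xi * trig_sqr E f xi).
have bI j : bmeas (fun xi => low_freq (dyadic 4 j) xi * trig_sqr E f xi).
  by apply: bmeas_mul; [exact: bmeas_low_freq|exact: bmeas_trig_sqr].
have bZ c j : bmeas (fun xi => c * (low_freq (dyadic 4 j) xi * trig_sqr E f xi)).
  by apply: bmeas_mul; [exact: bmeas_cst|exact: bI].
have step1 : Ibox (fun xi => w xi * trig_sqr E f xi) <=
    \sum_(j < J) 4 * dyadic 4 j ^- 2 * I j + W * I J.
  have -> : \sum_(j < J) 4 * dyadic 4 j ^- 2 * I j + W * I J = Ibox (fun xi =>
     \sum_(j < J) 4 * dyadic 4 j ^- 2 * (low_freq (dyadic 4 j) xi * trig_sqr E f xi)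
     + W * (low_freq (dyadic 4 J) xi * trig_sqr E f xi)).
    rewrite IboxD//; last by apply: bmeas_sum => j; exact: bZ.
    by rewrite Ibox_sum// IboxZ//; congr (_ + _); apply: eq_bigr => j _; rewrite IboxZ.
  apply: le_Ibox.
  - by apply: bmeas_mul => //; exact: bmeas_trig_sqr.
  - by apply: bmeas_add; [apply: bmeas_sum => j; exact: bZ|exact: bZ].
  move=> xi bxi.
  have wWx : 0 <= w xi <= W by rewrite w0 (le_trans (ler_norm _)).
  have := ler_wpM2r (trig_sqr_ge0 E f xi) (dyadic_cover J bxi wWx (w1 _ bxi)).
  rewrite mulrDl mulr_suml -[W * _ * _]mulrA => /le_trans; apply; rewrite lerD2r.
  by apply: ler_sum => j _; rewrite mulrA.
have IJ : I J <= 2 * B ^+ 2 * (pi * dyadic 4 J) ^+ 4.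
  apply: (@le_trans _ _ (Ibox (fun xi => 2 * B ^+ 2 * low_freq (dyadic 4 J) xi))).
    apply: le_Ibox => //.
      by apply: bmeas_mul; [exact: bmeas_cst|exact: bmeas_low_freq].
    by move=> xi _; rewrite mulrC ler_wpM2r ?trig_sqr_le.
  rewrite IboxZ; last exact: bmeas_low_freq.
  by apply: ler_wpM2l; [rewrite mulr_ge0 ?sqr_ge0|exact: low_freq_volume (ltW (d0 J))].
have rest : W * I J <= e.
  apply: le_trans hJ; apply: (le_trans (ler_wpM2l W0 IJ)).
  have dJ4 : dyadic 4 J <= 4 :> R.
    by rewrite /dyadic ler_pdivrMr ?exprn_gt0// ler_peMr// exprn_ege1// ler1n.
  have : dyadic 4 J ^+ 4 <= 64 * dyadic 4 J.
    rewrite exprSr ler_wpM2r ?(ltW (d0 J))//.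
    have -> : 64 = 4 ^+ 3 :> R by ring.
    by rewrite ler_pXn2r ?nnegrE// ltW.
  move=> dJ; have C0 : 0 <= W * (2 * B ^+ 2) * pi ^+ 4.
    by do 3 (apply: mulr_ge0 => //); exact: sqr_ge0.
  have := ler_wpM2l C0 dJ; rewrite [(pi * _) ^+ 4]exprMn.
  by clear; move: (dyadic 4 J) (pi : R) => x P; lra.
have main : \sum_(j < J) 4 * dyadic 4 j ^- 2 * I j <= pi ^+ 4 * (171 * S + 32 * S ^+ 2).
  pose U j := \sum_(y <- E) (a y <= dyadic 4 j)%R%:R * a y ^+ 6.
  pose T j := \sum_(y <- E) (dyadic 4 j < a y)%R%:R * a y ^+ 3.
  have hI j : 4 * dyadic 4 j ^- 2 * I j <=
      pi ^+ 4 * (128 * (dyadic 4 j ^- 2 * U j) + 16 * S * (dyadic 4 j * T j)).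
    have := low_freq_trig_sqr uE (d0 j) a0 fa; rewrite -/(I j) -SE -/(U j) -/(T j) => h.
    have c0 : 0 <= 4 * dyadic 4 j ^- 2 by rewrite mulr_ge0// invr_ge0 exprn_ge0 ?ltW.
    apply: (le_trans (ler_wpM2l c0 h)); rewrite le_eqVlt; apply/orP; left; apply/eqP.
    have := lt0r_neq0 (d0 j); move: (dyadic 4 j) (pi ^+ 4) (U j) (T j) => x P u t x0.
    by field.
  apply: (@le_trans _ _ (\sum_(j < J) pi ^+ 4 * (128 * (dyadic 4 j ^- 2 * U j) + 16 * S * (dyadic 4 j * T j)))).
    by apply: ler_sum => j _; exact: hI.
  rewrite -mulr_sumr ler_wpM2l// big_split/= -!mulr_sumr.
  have hU : \sum_(j < J) dyadic 4 j ^- 2 * U j <= 4 / 3 * S.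
    rewrite (eq_bigr (fun j : 'I_J => \sum_(y <- E) a y ^+ 4 *
       ((a y <= dyadic 4 j)%R%:R * (a y ^+ 2 / dyadic 4 j ^+ 2)))); last first.
      move=> j _; rewrite /U mulr_sumr; apply: eq_bigr => y _.
      by rewrite (exprD _ 4 2); ring.
    rewrite exchange_big/= SE mulr_sumr; apply: ler_sum => y _.
    by rewrite -mulr_sumr mulrC ler_wpM2r ?exprn_ge0// sum_dyadic_above.
  have hT : \sum_(j < J) dyadic 4 j * T j <= 2 * S.
    rewrite (eq_bigr (fun j : 'I_J => \sum_(y <- E) a y ^+ 3 *
       ((dyadic 4 j < a y)%R%:R * dyadic 4 j))); last first.
      move=> j _; rewrite /T mulr_sumr; apply: eq_bigr => y _; ring.
    rewrite exchange_big/= SE mulr_sumr; apply: ler_sum => y _.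
    rewrite -mulr_sumr [leRHS](_ : _ = a y ^+ 3 * (2 * a y)); last by ring.
    by rewrite ler_wpM2l ?exprn_ge0// sum_dyadic_below.
  have := ler_wpM2l S0 hT; move: hU; clear -S0.
  move: (\sum_(j < J) dyadic 4 j ^- 2 * U j) (\sum_(j < J) dyadic 4 j * T j) => u t.
  rewrite expr2; lra.
by apply: (le_trans step1); exact: lerD.
Qed.

End WeightedParseval.

(** * Fresnel integrals *)

Section Fresnel.
Local Open Scope classical_set_scope.
Local Open Scope ring_scope.
Context {R : realType}.
Implicit Types (f g F G : R -> R) (x y a b : R).
Local Notation mu := (@lebesgue_measure R).

Lemma increment_le F G f g a b : a <= b ->
  (forall x, a <= x <= b -> is_derive x 1 F (f x)) ->
  (forall x, a <= x <= b -> {for x, continuous f}) ->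
  (forall x, a <= x <= b -> is_derive x 1 G (g x)) ->
  (forall x, a <= x <= b -> {for x, continuous g}) ->
  (forall x, a <= x <= b -> f x <= g x) -> F b - F a <= G b - G a.
Proof.
move=> ab dF cf dG cg fg.
rewrite -(Rintegral_FTC ab dF cf) -(Rintegral_FTC ab dG cg).
apply: le_Rintegral => //.
- exact: continuous_integrable_itv.
- exact: continuous_integrable_itv.
Qed.

(** The integral from [0] is only available to the right of [0]; primitives from
    points further and further to the left are glued. *)
Lemma continuous_antiderivative f : (forall x, {for x, continuous f}) ->
  exists F, F 0 = 0 /\ forall x, is_derive x 1 F (f x).
Proof.
move=> cf.
pose P a x := \int[mu]_(t in `[a, x]) f t - \int[mu]_(t in `[a, 0]) f t.
have Pshift a b x : b <= a -> a <= x -> a <= 0 -> P b x = P a x.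
  move=> ba ax a0; rewrite /P.
  have split y : a <= y -> \int[mu]_(t in `[b, y]) f t =
     \int[mu]_(t in `[b, a]) f t + \int[mu]_(t in `[a, y]) f t.
    move=> ay; apply: Rintegral_split; first by rewrite ba.
    by move=> *; exact: cf.
  by rewrite (split _ ax) (split _ a0); lra.
pose F x := P (Num.min x 0 - 1) x.
exists F; split; first by rewrite /F /P subrr.
move=> x; pose a := Num.min x 0 - 2.
have m0 (z : R) : Num.min z 0 <= 0 by rewrite ge_min lexx orbT.
have mx (z : R) : Num.min z 0 <= z by rewrite ge_min lexx.
have aF z : x - 1 < z -> F z = P a z.
  move=> xz; rewrite /F (@Pshift (Num.min z 0 - 1) a)//.
  - rewrite /a; have : Num.min x 0 - 1 <= Num.min z 0.
      by rewrite le_min; apply/andP; split; [have := mx x|have := m0 x]; lra.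
    lra.
  - by have := mx z; lra.
  - by have := m0 z; lra.
have ax : a < x by rewrite /a; have := mx x; lra.
have fa : mu.-integrable `[a, x + 1] (EFin \o f).
  by apply: continuous_integrable_itv => *; exact: cf.
have [dP P'] := @continuous_FTC1_closed _ f a x (x + 1) ltac:(lra) fa ax (cf x).
have dPx : is_derive x 1 (P a) (f x).
  have d1 : is_derive x 1 (fun z => \int[mu]_(t in `[a, z]) f t) (f x).
    by apply: DeriveDef; [exact: dP|rewrite -derive1E P'].
  have := der_add d1 (der_cst (- \int[mu]_(t in `[a, 0]) f t) x).
  by rewrite addr0.
apply: near_eq_is_derive dPx; near=> z; rewrite aF//.
near: z; apply: lt_nbhsr; lra.
Unshelve. all: by end_near.
Qed.

(** A primitive whose derivative is at most [1 / (2 x^2)] is squeezed between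
    two monotone functions, hence converges. *)
Lemma tail_limit F f : (forall x, 1 <= x -> is_derive x 1 F (f x)) ->
  (forall x, 1 <= x -> {for x, continuous f}) ->
  (forall x, 1 <= x -> `|f x| <= 1 / 2 * x ^- 2) ->
  exists K, forall x, 1 <= x -> `|F x - K| <= (2 * x)^-1.
Proof.
move=> dF cf fle.
have key x y : 1 <= x -> x <= y -> `|F y - F x| <= (2 * x)^-1 - (2 * y)^-1.
  move=> x1 xy.
  have pos z : x <= z <= y -> z != 0 by move=> ?; rewrite gt_eqF//; lra.
  have dH z : x <= z <= y -> is_derive z 1 (fun z => - (2 * z)^-1) (1 / 2 * z ^- 2).
    move=> /pos z0; eapply der_eq; [der_tac|field]; rewrite ?mulf_neq0//.
  have cH z : x <= z <= y -> {for z, continuous (fun z : R => 1 / 2 * z ^- 2)}.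
    by move=> /pos z0; cont_tac; rewrite expf_neq0.
  have dF' z : x <= z <= y -> is_derive z 1 F (f z) by move=> ?; apply: dF; lra.
  have cf' z : x <= z <= y -> {for z, continuous f} by move=> ?; apply: cf; lra.
  have dN z : x <= z <= y -> is_derive z 1 (fun z => - F z) (- f z).
    by move=> zxy; apply: der_opp; exact: dF'.
  have cN z : x <= z <= y -> {for z, continuous (fun z => - f z)}.
    by move=> zxy; apply: cont_opp; exact: cf'.
  have fle' z : x <= z <= y -> `|f z| <= 1 / 2 * z ^- 2 by move=> ?; apply: fle; lra.
  have h1 := increment_le xy dF' cf' dH cH (fun z zxy => le_trans (ler_norm _) (fle' z zxy)).
  have h2 : - F y - - F x <= - (2 * y)^-1 - - (2 * x)^-1.
    apply: (increment_le xy dN cN dH cH) => z zxy.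
    by apply: le_trans (fle' z zxy); rewrite -normrN ler_norm.
  rewrite ler_norml; lra.
pose A := [set F x - (2 * x)^-1 | x in [set x | 1 <= x]].
have inv0 (x : R) : 1 <= x -> 0 < (2 * x)^-1 by move=> ?; rewrite invr_gt0; lra.
have ub y : 1 <= y -> ubound A (F y + (2 * y)^-1).
  move=> y1 _ [x /= x1 <-]; have := inv0 _ x1; have := inv0 _ y1.
  have [xy|yx] := leP x y.
    by have := key _ _ x1 xy; rewrite ler_norml; lra.
  by have := key _ _ y1 (ltW yx); rewrite ler_norml; lra.
have A0 : A !=set0 by exists (F 1 - (2 * 1)^-1); exists 1 => //=.
exists (sup A) => y y1; rewrite ler_norml; apply/andP; split; last first.
  have : F y - (2 * y)^-1 <= sup A.
    by apply: ub_le_sup; [exists (F 1 + (2 * 1)^-1); exact: ub|exists y].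
  lra.
have : sup A <= F y + (2 * y)^-1 by apply: ge_sup => //; exact: ub.
lra.
Qed.

Lemma norm_sin_le x : `|sin x| <= `|x|.
Proof.
wlog x0 : x / 0 <= x => [hw|].
  have [/hw//|x0] := leP 0 x.
  by rewrite -normrN -sinN -[leRHS]normrN; apply: hw; rewrite oppr_ge0 ltW.
have cc (y : R) : {for y, continuous (@cos R)} := @continuous_cos R y.
rewrite (ger0_norm x0) ler_norml; apply/andP; split.
  have := @increment_le (fun x => - x) sin (fun=> -1) cos 0 x x0.
  rewrite sin0 subr0 oppr0 subr0; apply => // y _; first exact: cont_cst.
  exact: cos_geN1.
have := @increment_le sin (fun x => x) cos (fun=> 1) 0 x x0.
by rewrite sin0 !subr0; apply => // y _; exact: cont_cst || exact: cos_le1.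
Qed.

Lemma cos_ge_parabola x : 1 - x ^+ 2 / 2 <= cos x.
Proof.
have := one_subr_cos x.
have : `|sin (x / 2)| ^+ 2 <= `|x / 2| ^+ 2.
  by apply: lerXn2r; rewrite ?nnegrE//; exact: norm_sin_le.
by rewrite !real_normK ?num_real// expr_div_n; lra.
Qed.

Lemma odd_antiderivative F f : F 0 = 0 -> (forall x, is_derive x 1 F (f x)) ->
  (forall x, f (- x) = f x) -> forall x, F (- x) = - F x.
Proof.
move=> F0 dF fe x; have d y : is_derive y 1 (fun y => F y + F (- y)) 0.
  have dN : is_derive y 1 (fun y => F (- y)) (f (- y) * -1).
    by apply: der_comp.
  have dFy := dF y; eapply der_eq; [exact: (der_add dFy dN)|by rewrite fe; lra].
have := is_derive_0_is_cst x 0 d; rewrite oppr0 F0; lra.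
Qed.

(** Meant for [f = cos (x^2)] with [h = sin (x^2)], and for [f = sin (x^2)] with
    [h = - cos (x^2)]: as [h' = 2 x f], an integration by parts absorbs the
    oscillation at infinity. *)
Lemma fresnel_limit F f h : F 0 = 0 -> (forall x, is_derive x 1 F (f x)) ->
  (forall x, {for x, continuous f}) -> (forall x, f (- x) = f x) ->
  (forall x, `|f x| <= 1) -> (forall x, `|h x| <= 1) ->
  (forall x, is_derive x 1 h (2 * x * f x)) ->
  exists K, [/\ forall x, 1 <= x -> `|F x - K| <= x^-1,
    forall x, x <= -1 -> `|F x + K| <= (- x)^-1 &
    forall x, `|F x| <= `|K| + 1].
Proof.
move=> F0 dF cf fe f1 h1 dh.
pose G x := F x - h x * (2 * x)^-1; pose g x := h x / 2 * x ^- 2.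
have nz (x : R) : 1 <= x -> x != 0 by move=> ?; rewrite gt_eqF//; lra.
have dG x : 1 <= x -> is_derive x 1 G (g x).
  move=> /nz x0; have dFx := dF x; have dhx := dh x.
  rewrite /G; eapply der_eq; [der_tac|rewrite /g; field]; by rewrite ?mulf_neq0.
have cg x : 1 <= x -> {for x, continuous g}.
  by move=> /nz x0; have := der_cont (dh x); rewrite /g => ?; cont_tac; rewrite expf_neq0.
have gle x : 1 <= x -> `|g x| <= 1 / 2 * x ^- 2.
  move=> x1; rewrite /g normrM [`|x ^- 2|]ger0_norm ?invr_ge0 ?sqr_ge0//.
  rewrite ler_wpM2r ?invr_ge0 ?sqr_ge0// normrM [`|2^-1|]ger0_norm//.
  by rewrite ler_wpM2r.
have [K HK] := tail_limit dG cg gle.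
have odd := odd_antiderivative F0 dF fe.
have FK x : 1 <= x -> `|F x - K| <= x^-1.
  move=> x1; have x0 : 0 < x by lra.
  have -> : F x - K = (G x - K) + h x * (2 * x)^-1 by rewrite /G; ring.
  apply: (le_trans (ler_normD _ _)); have := HK _ x1.
  have : `|h x * (2 * x)^-1| <= (2 * x)^-1.
    rewrite normrM [X in _ * X]ger0_norm ?ler_piMl// invr_ge0; lra.
  have -> : x^-1 = (2 * x)^-1 + (2 * x)^-1 by field; rewrite gt_eqF.
  lra.
have Fle x : 0 <= x -> `|F x| <= `|K| + 1.
  move=> x0; have [x1|x1] := leP 1 x.
    have -> : F x = (F x - K) + K by ring.
    apply: (le_trans (ler_normD _ _)); rewrite addrC lerD2l.
    by apply: (le_trans (FK _ x1)); rewrite invf_le1//; lra.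
  have lower : - x <= F x.
    have := @increment_le (fun x => - x) F (fun=> -1) f 0 x x0.
    rewrite F0 subr0 oppr0 subr0; apply => // y _.
    - exact: cont_cst.
    - by have := f1 y; rewrite ler_norml => /andP[].
  have upper : F x <= x.
    have := @increment_le F (fun x => x) f (fun=> 1) 0 x x0.
    rewrite F0 !subr0; apply => // y _.
    - exact: cont_cst.
    - by have := f1 y; rewrite ler_norml => /andP[].
  by rewrite ler_norml; have := normr_ge0 K; lra.
exists K; split => // x.
  move=> x1; have := FK (- x) ltac:(lra); rewrite odd.
  by rewrite -normrN opprB opprK addrC.
have [/Fle//|x0] := leP 0 x.
by rewrite -normrN -odd; apply: Fle; lra.
Qed.

(** [C] and [S] are the Fresnel integrals, odd functions with limits [K1] and
    [K2] at infinity, approached at the rate [1 / x]. *)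
Definition fresnel_like (C S : R -> R) (K1 K2 B : R) :=
  [/\ forall x, is_derive x 1 C (cos (x ^+ 2)),
      forall x, is_derive x 1 S (sin (x ^+ 2)),
      forall x, 1 <= x -> `|C x - K1| <= x^-1 /\ `|S x - K2| <= x^-1,
      forall x, x <= -1 -> `|C x + K1| <= (- x)^-1 /\ `|S x + K2| <= (- x)^-1 &
      forall x, `|C x| <= B /\ `|S x| <= B].

(** Positivity of [K1] makes [K1^2 + K2^2] invertible, which is how the sine is
    recovered from the limits. Comparing the cosine with a parabola up to [5/4]
    gives more than the error [4/5] made from there on. *)
Lemma fresnel_exists : exists C S K1 K2 B, fresnel_like C S K1 K2 B /\ 0 < K1.
Proof.
have cc (x : R) : {for x, continuous (fun x : R => cos (x ^+ 2))} by cont_tac.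
have cs (x : R) : {for x, continuous (fun x : R => sin (x ^+ 2))} by cont_tac.
have [C [C0 dC]] := continuous_antiderivative cc.
have [S [S0 dS]] := continuous_antiderivative cs.
have [K1 [CK CNK CB]] : exists K, [/\ forall x, 1 <= x -> `|C x - K| <= x^-1,
    forall x, x <= -1 -> `|C x + K| <= (- x)^-1 & forall x, `|C x| <= `|K| + 1].
  apply: (@fresnel_limit C _ (fun x => sin (x ^+ 2)) C0 dC) => // x.
  - by rewrite sqrrN.
  - exact: cos_max.
  - exact: sin_max.
  - by eapply der_eq; [der_tac|ring].
have [K2 [SK SNK SB]] : exists K, [/\ forall x, 1 <= x -> `|S x - K| <= x^-1,
    forall x, x <= -1 -> `|S x + K| <= (- x)^-1 & forall x, `|S x| <= `|K| + 1].
  apply: (@fresnel_limit S _ (fun x => - cos (x ^+ 2)) S0 dS) => // x.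
  - by rewrite sqrrN.
  - exact: sin_max.
  - by rewrite normrN; exact: cos_max.
  - by eapply der_eq; [der_tac|ring].
exists C, S, K1, K2, (Num.max (`|K1| + 1) (`|K2| + 1)); split.
  split=> // x; first by move=> x1; split; [exact: CK|exact: SK].
    by move=> x1; split; [exact: CNK|exact: SNK].
  by split; rewrite le_max ?CB ?SB ?orbT.
have := CK (5 / 4) ltac:(lra); rewrite ler_norml => /andP[_].
have : (5 / 4) - (5 / 4) ^+ 5 / 10 <= C (5 / 4).
  have := @increment_le (fun x => x - x ^+ 5 / 10) C (fun x => 1 - x ^+ 4 / 2) _ 0 (5 / 4) ltac:(lra).
  rewrite C0 expr0n/= mul0r !subr0; apply => // x xb.
  - by eapply der_eq; [der_tac|field].
  - by cont_tac.
  - by have := cos_ge_parabola (x ^+ 2); rewrite -exprM.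
lra.
Qed.

End Fresnel.

(** * Oscillating integrals with a parameter *)

Section ParametricIntegral.
Local Open Scope classical_set_scope.
Local Open Scope ring_scope.
Context {d1 d2} {T1 : measurableType d1} {T2 : measurableType d2} {R : realType}.
Variable m2 : {sigma_finite_measure set T2 -> \bar R}.
Variables (D2 : set T2).
Hypotheses (mD2 : measurable D2) (fin2 : (m2 D2 < +oo)%E).
Variables (f : T1 * T2 -> R) (M : R).
Hypotheses (mf : measurable_fun setT f) (fM : forall z, `|f z| <= M).

Let integrable_section x : m2.-integrable D2 (EFin \o (fun y => f (x, y))).
Proof.
by apply: (le_norm_integrable (M := M)) => //; exact: (measurableT_comp mf).
Qed.

Lemma norm_Rintegral_section_le x :
  `|\int[m2]_(y in D2) f (x, y)| <= M * fine (m2 D2).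
Proof.
apply: (le_trans (le_normr_Rintegral mD2 (integrable_section x))).
rewrite -Rintegral_cst//; apply: le_Rintegral => //.
- exact: integrable_norm.
- by apply: (le_norm_integrable (M := `|M|)).
Qed.

(** Tonelli's measurability is for nonnegative functions; adding the bound [M]
    makes [f] one. *)
Lemma measurable_Rintegral_section :
  measurable_fun setT (fun x => \int[m2]_(y in D2) f (x, y)).
Proof.
pose g := (fun z => (f z + M)%:E) \_ (setT `*` D2).
have mg : measurable_fun setT g.
  apply/(measurable_restrictT _ _).1; first exact: measurableX.
  by apply/measurable_EFinP/measurable_funTS/measurable_funD.
have g0 z : (0 <= g z)%E.
  rewrite /g patchE; case: ifP => // _; rewrite lee_fin.
  by have := fM z; rewrite ler_norml; lra.
have mF : measurable_fun setT (fubini_F m2 g) by exact: measurable_fun_fubini_tonelli_F.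
have -> : (fun x => \int[m2]_(y in D2) f (x, y)) =
    (fun x => fine (fubini_F m2 g x) - M * fine (m2 D2)).
  apply/funext => x; rewrite -Rintegral_cst//.
  have -> : fine (fubini_F m2 g x) = \int[m2]_(y in D2) (f (x, y) + M).
    rewrite /Rintegral /fubini_F [in RHS]integral_mkcond; congr fine.
    by apply: eq_integral => y _; rewrite /g !patchE in_setX in_setT.
  rewrite RintegralD//; first by rewrite addrK.
  exact: (le_norm_integrable (M := `|M|)).
apply: measurable_funB; last exact: measurable_cst.
exact: (measurableT_comp (fine_measurable measurableT) mF).
Qed.

End ParametricIntegral.

Section FubiniBound.
Local Open Scope classical_set_scope.
Local Open Scope ring_scope.
Context {d1 d2} {T1 : measurableType d1} {T2 : measurableType d2} {R : realType}.
Variable m1 : {sigma_finite_measure set T1 -> \bar R}.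
Variable m2 : {sigma_finite_measure set T2 -> \bar R}.
Variables (D1 : set T1) (D2 : set T2).
Hypotheses (mD1 : measurable D1) (mD2 : measurable D2).
Hypotheses (fin1 : (m1 D1 < +oo)%E) (fin2 : (m2 D2 < +oo)%E).

Lemma norm_Rintegral_swap_le (f : T1 * T2 -> R) (M : R) (q : T2 -> R) :
  measurable_fun setT f -> (forall z, `|f z| <= M) ->
  (forall y, D2 y -> `|\int[m1]_(x in D1) f (x, y)| <= q y) ->
  m2.-integrable D2 (EFin \o q) ->
  `|\int[m1]_(x in D1) \int[m2]_(y in D2) f (x, y)| <= \int[m2]_(y in D2) q y.
Proof.
move=> mf fM fq iq.
rewrite -(Rintegral_setX mD1 mD2 fin1 fin2 mf fM).
rewrite (Rintegral_setX_swap mD1 mD2 fin1 fin2 mf fM).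
have i2 : m2.-integrable D2 (EFin \o (fun y => \int[m1]_(x in D1) f (x, y))).
  have mfs : measurable_fun setT (fun z : T2 * T1 => f (z.2, z.1)).
    by apply: (measurableT_comp mf); apply: measurable_fun_pair.
  apply: (le_norm_integrable (M := M * fine (m1 D1))) => //.
    exact: (measurable_Rintegral_section mD1 fin1 mfs (fun z => fM _)).
  by move=> y; exact: (norm_Rintegral_section_le mD1 fin1 mfs (fun z => fM _)).
apply: (le_trans (le_normr_Rintegral mD2 i2)).
by apply: le_Rintegral => //; exact: integrable_norm.
Qed.

End FubiniBound.

Section OscillatingFamily.
Local Open Scope classical_set_scope.
Local Open Scope ring_scope.
Context {R : realType}.
Local Notation mR := (measurableTypeR R).
Local Notation mR4 := (mR * mR * mR * mR)%type.
Local Notation mu := (@lebesgue_measure R).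
Implicit Types (n : 'I_4 -> R) (w k : R -> R) (a b psi g u : R).

Lemma measurable_invr : measurable_fun (setT : set mR) (fun x : R => x^-1).
Proof.
have -> : (setT : set mR) = [set x | x != 0] `|` [set 0].
  by apply/seteqP; split => // x _ /=; have [->|] := eqVneq x 0; [right|left].
have o : open [set x : R | x != 0].
  rewrite (_ : [set x : R | x != 0] = ~` [set 0]); last first.
    by apply/seteqP; split => x /= /eqP.
  by rewrite openC; exact: closed_eq.
apply/measurable_funU; [exact: open_measurable|exact: measurable_set1|split].
  apply: open_continuous_measurable_fun => // x; rewrite inE/= => x0.
  by apply: (@cont_inv R (fun x => x)) => //; exact: cont_id.
exact: measurable_fun_set1.
Qed.

(** The term [u^2 * symbol xi] is the phase of the Schroedinger group at time
    [u^2], and [g / u^2] is what completing a square adds to it. *)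
Definition wave_phase g psi n u (xi : mR4) : R :=
  psi + g / u ^+ 2 + \sum_(j < 4) n j * coord4 xi j + u ^+ 2 * symbol xi.

Lemma measurable_wave_phase g psi n :
  measurable_fun setT (fun z : mR4 * mR => wave_phase g psi n z.2 z.1).
Proof.
have m1 : measurable_fun setT (fun z : mR4 * mR => z.1) by exact: measurable_fst.
have m2 : measurable_fun setT (fun z : mR4 * mR => z.2) by exact: measurable_snd.
apply: measurable_funD; last first.
  apply: measurable_funM; first exact: measurable_funX.
  exact: (measurableT_comp (@measurable_symbol R) m1).
apply: measurable_funD; last exact: (measurableT_comp (measurable_linear n) m1).
apply: measurable_funD; first exact: measurable_cst.
apply: measurable_funM; first exact: measurable_cst.
by apply: (measurableT_comp measurable_invr); exact: measurable_funX.
Qed.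

Definition oscillating g a b w n psi (xi : mR4) : R :=
  \int[mu]_(u in `[a, b]) (w u * cos (wave_phase g psi n u xi)).

Section Window.
Variables (g a b W : R) (w : R -> R) (n : 'I_4 -> R) (psi : R).
Hypotheses (cw : forall u, {for u, continuous w}) (ab : a <= b).
Hypothesis wW : forall u, a <= u <= b -> `|w u| <= W.

Let D : set mR := `[a, b]%classic.
Let mD : measurable D. Proof. exact: measurable_itv. Qed.
Let fD : (mu D < +oo)%E.
Proof. by rewrite /D lebesgue_measure_itv/=; case: ifP => //; rewrite -EFinD ltry. Qed.

Let f (z : mR4 * mR) : R := \1_D z.2 * w z.2 * cos (wave_phase g psi n z.2 z.1).

Let W0 : 0 <= W.
Proof. by apply: le_trans (normr_ge0 _) (wW (u := a) _); rewrite lexx. Qed.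

Let mf : measurable_fun setT f.
Proof.
apply: measurable_funM; last exact: (measurable_cos (measurable_wave_phase _ _ _)).
apply: measurable_funM; apply: (measurableT_comp _ measurable_snd).
  exact: measurable_indic.
by apply: continuous_measurable_fun => u; exact: cw.
Qed.

Let fW z : `|f z| <= W.
Proof.
rewrite /f normrM -[leRHS]mulr1; apply: ler_pM => //; last exact: cos_max.
rewrite indicE; have [|_] := boolP (z.2 \in D); last by rewrite mul0r normr0.
by rewrite mul1r inE /D/= in_itv/= => /wW.
Qed.

Let oscE xi : oscillating g a b w n psi xi = \int[mu]_(u in D) f (xi, u).
Proof. by apply: eq_Rintegral => u uD; rewrite /f/= indicE uD mul1r. Qed.

Lemma bmeas_oscillating : bmeas (oscillating g a b w n psi).
Proof.
rewrite (_ : oscillating _ _ _ _ _ _ = fun xi => \int[mu]_(u in D) f (xi, u)); last first.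
  by apply/funext => xi; rewrite oscE.
split; first exact: (@measurable_Rintegral_section _ _ mR4 mR R mu D mD fD f W mf fW).
by eexists => xi; exact: (@norm_Rintegral_section_le _ _ mR4 mR R mu D mD fD f W mf fW).
Qed.

(** Integrating in the frequency first, where for each [u] the Schroedinger
    kernel bound applies. *)
Lemma norm_Ibox_oscillating_le k :
  (forall u, a <= u <= b -> {for u, continuous k}) ->
  (forall u, a <= u <= b ->
    `|w u| * (2 * 10 ^+ 7 * \sum_(j < 4) (1 + `|(2 * u ^+ 2) ^+ 2 - n j ^+ 2|)^-1) <= k u) ->
  `|Ibox (oscillating g a b w n psi)| <= \int[mu]_(u in `[a, b]) k u.
Proof.
move=> ck wk.
pose mu1 : {sigma_finite_measure set mR -> \bar R} := mu.
pose mu4 : {sigma_finite_measure set mR4 -> \bar R} := sf_product (sf_product (sf_product mu1 mu1) mu1) mu1.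
have -> : Ibox (oscillating g a b w n psi) =
    \int[mu4]_(xi in @box4 R) \int[mu1]_(u in D) f (xi, u).
  by apply: eq_Ibox => xi _; exact: oscE.
apply: (@norm_Rintegral_swap_le _ _ _ _ R mu4 mu1 _ _ (@measurable_box4 R) mD (@leb4_box4_lty R) fD f W k) => //.
- move=> u uD; have uab : a <= u <= b by move: uD; rewrite /D/= in_itv.
  have -> : \int[mu4]_(xi in @box4 R) f (xi, u) =
      Ibox (fun xi => w u * cos (wave_phase g psi n u xi)).
    by apply: eq_Ibox => xi _; rewrite /f/= indicE mem_set// mul1r.
  rewrite IboxZ; last exact: (bmeas_cos (measurable_affine_phase _ _ _)).
  rewrite normrM; apply: le_trans (wk _ uab); rewrite ler_wpM2l//.
  exact: schroedinger_kernel_bound (sqr_ge0 u).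
- exact: (continuous_integrable_itv ck).
Qed.

End Window.
End OscillatingFamily.

(** * Majorants near the turning point *)

Section LogMajorant.
Local Open Scope classical_set_scope.
Local Open Scope ring_scope.
Context {R : realType}.
Implicit Types (a b c u y rho nu : R).
Local Notation mu := (@lebesgue_measure R).

Lemma Rintegral_sum_itv (I : Type) (r : seq I) (k : I -> R -> R) a b :
  (forall j u, a <= u <= b -> {for u, continuous (k j)}) ->
  \int[mu]_(u in `[a, b]) (\sum_(j <- r) k j u) =
  \sum_(j <- r) \int[mu]_(u in `[a, b]) k j u.
Proof.
move=> ck.
elim: r => [|i r ih].
  rewrite big_nil; under eq_Rintegral do rewrite big_nil.
  by rewrite Rintegral_cst ?mul0r//; exact: measurable_itv.
rewrite big_cons -ih -RintegralD//.
- by apply: eq_Rintegral => u _; rewrite big_cons.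
- by apply: continuous_integrable_itv => u; exact: ck.
- by apply: continuous_integrable_itv => u; by move=> uab; apply: cont_sum => j; exact: ck.
Qed.

(** A majorant of [1 / (1 + c^3 y)] on [0 <= y <= c] that keeps decaying
    beyond, so that its primitive [log_primitive] stays bounded. *)
Definition log_majorant c y : R := ((1 + y / c) * (1 + y / c + c ^+ 3 * y))^-1.
Definition log_primitive c y : R := ln (1 + c ^+ 3 * (y / (1 + y / c))) / c ^+ 3.

Section Fixed.
Variable c : R.
Hypothesis c0 : 0 < c.

Let z0 y : 0 <= y -> 0 < 1 + y / c.
Proof. by move=> y0; rewrite ltr_pwDl// divr_ge0// ltW. Qed.

Let w0 y : 0 <= y -> 0 < 1 + y / c + c ^+ 3 * y.
Proof. by move=> y0; rewrite ltr_wpDr ?z0// mulr_ge0// exprn_ge0// ltW. Qed.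

Let l0 y : 0 <= y -> 1 <= 1 + c ^+ 3 * (y / (1 + y / c)).
Proof.
move=> y0; rewrite lerDl mulr_ge0 ?exprn_ge0 ?(ltW c0)// divr_ge0//.
exact/ltW/z0.
Qed.

Lemma log_majorant_ge0 y : 0 <= y -> 0 <= log_majorant c y.
Proof. by move=> y0; rewrite invr_ge0 mulr_ge0// ltW ?z0 ?w0. Qed.

Lemma der_log_primitive y : 0 <= y ->
  is_derive y 1 (log_primitive c) (log_majorant c y).
Proof.
move=> y0; have := l0 y0; have := lt0r_neq0 (z0 y0); have := lt0r_neq0 (w0 y0).
have cn := lt0r_neq0 c0 => wn zn lp.
have lp0 : 0 < 1 + c ^+ 3 * (y / (1 + y / c)) by lra.
rewrite /log_primitive /log_majorant; eapply der_eq; [der_tac => //|].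
have := lt0r_neq0 lp0.
have -> : 1 + c ^+ 3 * (y / (1 + y / c)) = (1 + y / c + c ^+ 3 * y) / (1 + y / c).
  by field; rewrite cn/=; move: zn; rewrite -[X in X + _](divff cn) -mulrDl mulf_eq0 negb_or => /andP[].
move=> _.
have zn' : c + y != 0.
  by move: zn; rewrite -[X in X + _](divff cn) -mulrDl mulf_eq0 negb_or => /andP[].
have wn' : c + y + c ^+ 3 * y * c != 0.
  rewrite (_ : _ + _ = c * (1 + y / c + c ^+ 3 * y)) ?mulf_neq0//.
  by field.
field; rewrite cn/= zn'/=.
by rewrite wn'.
Qed.

Lemma log_primitive_bound y : 0 <= y ->
  0 <= log_primitive c y <= ln (1 + c ^+ 4) / c ^+ 3.
Proof.
move=> y0; have c30 : 0 < c ^+ 3 by rewrite exprn_gt0.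
apply/andP; split; first by rewrite divr_ge0 ?ln_ge0 ?l0// ltW.
rewrite ler_pM2r ?invr_gt0// ler_ln ?posrE; last 2 first.
- exact: lt_le_trans (l0 y0).
- by rewrite ltr_pwDl// exprn_ge0// ltW.
rewrite lerD2l [c ^+ 4]exprSr ler_pM2l// ler_pdivrMr ?z0//.
by rewrite mulrDr mulr1 mulrCA divff ?lt0r_neq0// mulr1 lerDr ltW.
Qed.

Lemma cont_log_majorant rho u :
  {for u, continuous (fun u => log_majorant c `|u - rho|)}.
Proof.
have cn : {for u, continuous (fun u : R => `|u - rho|)}.
  by apply: (@continuous_comp _ _ _ (fun u => u - rho) (fun x : R => `|x|)); [cont_tac|exact: norm_continuous].
rewrite /log_majorant; cont_tac; rewrite mulf_neq0 ?lt0r_neq0 ?z0 ?w0//.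
Qed.

(** Each of the two sides of [rho] contributes one increment of the bounded
    primitive. *)
Lemma Rintegral_log_majorant rho a b : a <= b ->
  \int[mu]_(u in `[a, b]) log_majorant c `|u - rho| <= 2 * (ln (1 + c ^+ 4) / c ^+ 3).
Proof.
move=> ab; pose m := Num.min (Num.max rho a) b.
have am : a <= m by rewrite /m le_min le_max lexx orbT ab.
have mb : m <= b by rewrite /m ge_min lexx orbT.
have L0 := log_primitive_bound.
rewrite (@Rintegral_split R _ a b m) ?am//; last first.
  by move=> u _; exact: cont_log_majorant.
rewrite mulr_natl mulr2n; apply: lerD.
- have [eam|/eqP nam] := eqVneq m a.
    rewrite eam set_itv1 Rintegral_set1; have /andP[] := L0 0 (lexx 0).
    exact: le_trans.
  have mr : m <= rho.
    rewrite /m ge_min; apply/orP; left; rewrite ge_max lexx/= leNgt.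
    apply/negP => ra; apply: nam; rewrite /m (max_r (ltW ra)) min_l//.
  have d u : a <= u <= m -> is_derive u 1 (fun u => - log_primitive c (rho - u)) (log_majorant c `|u - rho|).
    move=> uam; have ru : 0 <= rho - u by lra.
    have := der_log_primitive ru; rewrite distrC ger0_norm// => dl.
    eapply der_eq; [apply: der_opp; apply: (der_comp dl); der_tac|ring].
  rewrite (Rintegral_FTC am d); last by move=> *; exact: cont_log_majorant.
  have /andP[_ h1] := L0 (rho - a) ltac:(lra).
  have /andP[h2 _] := L0 (rho - m) ltac:(lra).
  lra.
- have [emb|/eqP nmb] := eqVneq m b.
    rewrite emb set_itv1 Rintegral_set1; have /andP[] := L0 0 (lexx 0).
    exact: le_trans.
  have mr : rho <= m.
    rewrite /m le_min le_max lexx/= leNgt; apply/negP => br.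
    by case: nmb; rewrite /m min_r// le_max (ltW br).
  have d u : m <= u <= b -> is_derive u 1 (fun u => log_primitive c (u - rho)) (log_majorant c `|u - rho|).
    move=> umb; have ru : 0 <= u - rho by lra.
    have := der_log_primitive ru; rewrite ger0_norm// => dl.
    have du : is_derive u 1 (fun u : R => u - rho) 1 by eapply der_eq; [der_tac|ring].
    by have := @der_comp R (log_primitive c) (fun u => u - rho) _ _ _ dl du; rewrite mulr1.
  rewrite (Rintegral_FTC mb d); last by move=> *; exact: cont_log_majorant.
  have /andP[_ h1] := L0 (b - rho) ltac:(lra).
  have /andP[h2 _] := L0 (m - rho) ltac:(lra).
  lra.
Qed.

End Fixed.

(** The [u] at which [2 u^2 = |nu|], where the Bessel function of order [nu] and
    argument [2 u^2] stops being oscillatory and its decay is lost. *)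
Definition turning_point nu : R := Num.sqrt (`|nu| / 2).

Lemma turning_point_gap u nu : 0 <= u ->
  u ^+ 3 * `|u - turning_point nu| <= `|(2 * u ^+ 2) ^+ 2 - nu ^+ 2|.
Proof.
move=> u0; set rho := turning_point nu.
have r0 : 0 <= rho by rewrite sqrtr_ge0.
have nu2 : nu ^+ 2 = (2 * rho ^+ 2) ^+ 2.
  rewrite /rho /turning_point sqr_sqrtr; last by rewrite divr_ge0.
  by rewrite -[LHS]real_normK ?num_real//; congr (_ ^+ 2); field.
have -> : (2 * u ^+ 2) ^+ 2 - nu ^+ 2 = 4 * (u + rho) * (u ^+ 2 + rho ^+ 2) * (u - rho).
  by rewrite nu2; ring.
rewrite normrM ler_wpM2r// ger0_norm; last first.
  by rewrite !mulr_ge0 ?addr_ge0 ?sqr_ge0.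
have h1 : 0 <= u * rho ^+ 2 by rewrite mulr_ge0 ?sqr_ge0.
have h2 : 0 <= u ^+ 2 * rho by rewrite mulr_ge0 ?sqr_ge0.
have h3 : 0 <= rho ^+ 3 by rewrite exprn_ge0.
have h4 : 0 <= u ^+ 3 by rewrite exprn_ge0.
rewrite (_ : 4 * _ * _ = 4 * (u ^+ 3 + u * rho ^+ 2 + u ^+ 2 * rho + rho ^+ 3)); last by ring.
lra.
Qed.

Lemma near_majorant c y : 1 <= c -> 0 <= y <= c ->
  (1 + c ^+ 3 * y)^-1 <= 4 * log_majorant c y.
Proof.
move=> c1 /andP[y0 yc]; have c0 : 0 < c by lra.
have p : 0 <= c ^+ 3 * y by rewrite mulr_ge0 ?exprn_ge0 ?(ltW c0).
have z : 0 <= y / c <= 1 by rewrite divr_ge0 ?(ltW c0)//= ler_pdivrMr// mul1r.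
have w : 0 < (1 + y / c) * (1 + y / c + c ^+ 3 * y) by rewrite mulr_gt0//; lra.
rewrite /log_majorant -[leLHS]mul1r ler_pdivrMr; last by lra.
rewrite mulrAC ler_pdivlMr// mul1r; clear w.
move: p z; move: (c ^+ 3 * y) (y / c) => p z p0 zb; nra.
Qed.

(** Below [c] the gap at the turning point weakens from [c^3] to [u^3], and the
    weight [u^4 / c^4] makes up for it; the weight [u^2 / c^4] matters only for
    [u <= 1], where it is at most [c^(-4)]. *)
Lemma low_majorant c u nu : 1 <= c -> 0 < u <= c ->
  (u ^+ 4 + u ^+ 2) / c ^+ 4 * (1 + `|(2 * u ^+ 2) ^+ 2 - nu ^+ 2|)^-1 <=
  8 * log_majorant c `|u - turning_point nu| + 3 / c ^+ 4.
Proof.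
move=> c1 /andP[u0 uc]; set y := `|u - _|.
have c0 : 0 < c by lra.
have y0 : 0 <= y by rewrite /y.
have c4 : 0 < c ^+ 4 by rewrite exprn_gt0.
have c3 : 0 < c ^+ 3 by rewrite exprn_gt0.
have u3 : 0 < u ^+ 3 by rewrite exprn_gt0.
have g0 : 0 <= u ^+ 3 * y by rewrite mulr_ge0// ltW.
have p0 : 0 <= c ^+ 3 * y by rewrite mulr_ge0// ltW.
have := turning_point_gap nu (ltW u0); rewrite -/y => gap.
have step : (u ^+ 4 + u ^+ 2) / c ^+ 4 <=
    (2 * (1 + c ^+ 3 * y)^-1 + (c ^+ 4)^-1) * (1 + u ^+ 3 * y).
  have h4 : u ^+ 4 / c ^+ 4 <= (1 + c ^+ 3 * y)^-1 * (1 + u ^+ 3 * y).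
    rewrite ler_pdivlMl; last by lra.
    rewrite mulrA ler_pdivrMr//.
    have : u ^+ 4 <= c ^+ 4 by apply: lerXn2r; rewrite ?nnegrE; lra.
    have : u * (c ^+ 3 * u ^+ 3 * y) <= c * (c ^+ 3 * u ^+ 3 * y).
      by rewrite ler_wpM2r// mulr_ge0// ltW// mulr_gt0.
    rewrite [u ^+ 4]exprS [c ^+ 4]exprS.
    by move: (u ^+ 3) (c ^+ 3) => U C; lra.
  have c4i : 0 < (c ^+ 4)^-1 by rewrite invr_gt0.
  have i0 : 0 <= (1 + c ^+ 3 * y)^-1 by rewrite invr_ge0; lra.
  have [u1|u1] := leP 1 u.
    have : u ^+ 2 / c ^+ 4 <= u ^+ 4 / c ^+ 4.
      by rewrite ler_pM2r// ler_weXn2l.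
    have : 0 <= (c ^+ 4)^-1 * (1 + u ^+ 3 * y) by rewrite mulr_ge0 ?(ltW c4i)//; lra.
    rewrite mulrDl => h5 h6; rewrite [leRHS]mulrDl -mulrA; lra.
  have : u ^+ 2 / c ^+ 4 <= (c ^+ 4)^-1.
    by rewrite -[leRHS]mul1r ler_pM2r// expr_le1// ltW.
  have : (c ^+ 4)^-1 <= (c ^+ 4)^-1 * (1 + u ^+ 3 * y).
    by rewrite ler_peMr ?(ltW c4i)//; lra.
  have : 0 <= (1 + c ^+ 3 * y)^-1 * (1 + u ^+ 3 * y) by rewrite mulr_ge0//; lra.
  by rewrite mulrDl => h5 h6 h7; rewrite [leRHS]mulrDl -mulrA; lra.
have far : (1 + c ^+ 3 * y)^-1 <= 4 * log_majorant c y + (c ^+ 4)^-1.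
  have c4i : 0 <= (c ^+ 4)^-1 by rewrite invr_ge0 ltW.
  have [yc|cy] := leP y c.
    by have := @near_majorant c y c1 ltac:(rewrite y0 yc); lra.
  have : (1 + c ^+ 3 * y)^-1 <= (c ^+ 4)^-1.
    rewrite lef_pV2 ?posrE//; last by lra.
    have : c ^+ 3 * c <= c ^+ 3 * y by rewrite ler_pM2l// ltW.
    by rewrite -exprSr; lra.
  by have := log_majorant_ge0 c0 y0; lra.
apply: (@le_trans _ _ (2 * (1 + c ^+ 3 * y)^-1 + (c ^+ 4)^-1)); last first.
  by move: far; rewrite -/y; move: (c ^+ 4)^-1 => C; lra.
rewrite ler_pdivrMr; last by lra.
apply: (le_trans step); rewrite ler_wpM2l ?lerD2l//.
by rewrite addr_ge0 ?mulr_ge0 ?invr_ge0 ?(ltW c4)//; lra.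
Qed.

(** Above [c] the gap near the turning point is at least as good as at [c], and
    at distance more than [c] from it the bound is integrable at infinity. *)
Lemma high_majorant c u nu : 1 <= c -> c <= u ->
  (1 + `|(2 * u ^+ 2) ^+ 2 - nu ^+ 2|)^-1 <=
  4 * log_majorant c `|u - turning_point nu| + (c * u ^+ 3)^-1.
Proof.
move=> c1 cu; set y := `|u - _|.
have c0 : 0 < c by lra.
have u0 : 0 < u by lra.
have y0 : 0 <= y by rewrite /y.
have c3 : 0 < c ^+ 3 by rewrite exprn_gt0.
have u3 : 0 < u ^+ 3 by rewrite exprn_gt0.
have cu3 : c ^+ 3 <= u ^+ 3 by apply: lerXn2r; rewrite ?nnegrE; lra.
have g0 : 0 <= u ^+ 3 * y by rewrite mulr_ge0// ltW.
have p0 : 0 <= c ^+ 3 * y by rewrite mulr_ge0// ltW.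
have := turning_point_gap nu (ltW u0); rewrite -/y => gap.
have pi0 : 0 < (c * u ^+ 3)^-1 by rewrite invr_gt0 mulr_gt0.
have [yc|cy] := leP y c.
  have := @near_majorant c y c1 ltac:(rewrite y0 yc).
  have : (1 + `|(2 * u ^+ 2) ^+ 2 - nu ^+ 2|)^-1 <= (1 + c ^+ 3 * y)^-1.
    rewrite lef_pV2 ?posrE; [|lra|lra].
    by have : c ^+ 3 * y <= u ^+ 3 * y; [rewrite ler_wpM2r|lra].
  lra.
have := log_majorant_ge0 c0 y0.
suff : (1 + `|(2 * u ^+ 2) ^+ 2 - nu ^+ 2|)^-1 <= (c * u ^+ 3)^-1 by lra.
have cu0 : 0 < c * u ^+ 3 by rewrite mulr_gt0.
rewrite lef_pV2 ?posrE; [|lra|lra].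
have : c * u ^+ 3 <= u ^+ 3 * y by rewrite mulrC ler_pM2l// ltW.
lra.
Qed.

End LogMajorant.

(** * Integration by parts in the subordination variable *)

Section UniformBound.
Local Open Scope classical_set_scope.
Local Open Scope ring_scope.
Context {R : realType}.
Implicit Types (n : 'I_4 -> R) (w k h : R -> R) (a b c psi g u B : R).
Local Notation mu := (@lebesgue_measure R).
Local Notation mR := (measurableTypeR R).
Local Notation mR4 := (mR * mR * mR * mR)%type.

Lemma Rintegral_lin k h A D a b :
  (forall u, a <= u <= b -> {for u, continuous k}) ->
  (forall u, a <= u <= b -> {for u, continuous h}) ->
  \int[mu]_(u in `[a, b]) (A * k u + D * h u) =
  A * \int[mu]_(u in `[a, b]) k u + D * \int[mu]_(u in `[a, b]) h u.
Proof.
move=> ck ch; have ik := continuous_integrable_itv ck.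
have ih := continuous_integrable_itv ch.
have cc A' k' : (forall u, a <= u <= b -> {for u, continuous k'}) ->
    mu.-integrable `[a, b] (EFin \o (fun u => A' * k' u)).
  move=> ck'; apply: continuous_integrable_itv => u uab.
  by apply: cont_mul; [exact: cont_cst|exact: ck'].
by rewrite RintegralD ?cc// !RintegralZl.
Qed.

Local Notation L c := (ln (1 + c ^+ 4)).

Let le_lin (x y z v : R) : 0 <= z -> x <= y -> z * x + v <= z * y + v.
Proof. by move=> z0 xy; rewrite lerD2r ler_wpM2l. Qed.

Lemma norm_Ibox_low_le g a c w n psi B : 1 <= c -> 0 < a <= c -> 0 <= B ->
  (forall u, {for u, continuous w}) ->
  (forall u, a <= u <= c -> `|w u| <= B * ((u ^+ 4 + u ^+ 2) / c ^+ 4)) ->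
  `|Ibox (oscillating g a c w n psi)| <= 8 * 10 ^+ 7 * B * ((16 * L c + 3) / c ^+ 3).
Proof.
move=> c1 /andP[a0 ac] B0 cw wB; have c0 : 0 < c by lra.
have c4 : 0 < c ^+ 4 by rewrite exprn_gt0.
have wW u : a <= u <= c -> `|w u| <= B * ((c ^+ 4 + c ^+ 2) / c ^+ 4).
  move=> uac; apply: (le_trans (wB _ uac)); rewrite ler_wpM2l//.
  by rewrite ler_pM2r ?invr_gt0//; apply: lerD; apply: lerXn2r; rewrite ?nnegrE; lra.
pose C : R := 2 * 10 ^+ 7 * B.
have C0 : 0 <= C by rewrite !mulr_ge0.
pose kj (j : 'I_4) u := C * 8 * log_majorant c `|u - turning_point (n j)| + C * (3 / c ^+ 4) * 1.
have ck (j : 'I_4) u : a <= u <= c -> {for u, continuous (kj j)}.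
  move=> _; apply: cont_add; apply: cont_mul; do ?exact: cont_cst.
  exact: cont_log_majorant.
have ik j : \int[mu]_(u in `[a, c]) kj j u <= C * ((16 * L c + 3) / c ^+ 3).
  rewrite Rintegral_lin; last 2 first.
  - by move=> u _; exact: cont_log_majorant.
  - by move=> u _; exact: cont_cst.
  have -> : \int[mu]_(u in `[a, c]) 1 = c - a.
    rewrite (@Rintegral_FTC R (fun u => u) (fun=> 1))//.
    by move=> u _; exact: cont_cst.
  have h := Rintegral_log_majorant c0 (turning_point (n j)) ac.
  apply: (le_trans (le_lin _ _ h)); first by rewrite mulr_ge0.
  have -> : C * ((16 * L c + 3) / c ^+ 3) =
     C * 8 * (2 * (L c / c ^+ 3)) + C * (3 / c ^+ 4) * c.
    by field; rewrite lt0r_neq0.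
  rewrite lerD2l ler_wpM2l//; last by lra.
  by rewrite mulr_ge0// divr_ge0// ltW.
apply: (@le_trans _ _ (\int[mu]_(u in `[a, c]) (\sum_(j < 4) kj j u))).
  apply: (norm_Ibox_oscillating_le _ _ cw ac wW).
    by move=> u uac; apply: cont_sum => j; exact: ck.
  move=> u uac; rewrite mulrA mulr_sumr; apply: ler_sum => j _.
  set q := (1 + _)^-1; have q0 : 0 <= q by rewrite invr_ge0 addr_ge0.
  apply: (@le_trans _ _ (C * ((u ^+ 4 + u ^+ 2) / c ^+ 4 * q))).
    rewrite mulrA ler_wpM2r// mulrC /C -mulrA ler_wpM2l//; exact: wB.
  have h := @low_majorant R c u (n j) c1 ltac:(lra).
  apply: (le_trans (ler_wpM2l C0 h)); rewrite /kj le_eqVlt; apply/orP; left.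
  by apply/eqP; ring.
rewrite Rintegral_sum_itv//; apply: (@le_trans _ _ (\sum_(j < 4) C * ((16 * L c + 3) / c ^+ 3))).
  by apply: ler_sum => j _; exact: ik.
by rewrite sumr_const card_ord -mulr_natl /C; lra.
Qed.

Lemma norm_Ibox_high_le g b c n psi : 1 <= c -> c <= b ->
  `|Ibox (oscillating g c b (fun=> 1) n psi)| <= 8 * 10 ^+ 7 * ((8 * L c + 1) / c ^+ 3).
Proof.
move=> c1 cb; have c0 : 0 < c by lra.
have c3 : 0 < c ^+ 3 by rewrite exprn_gt0.
have wW u : c <= u <= b -> `|1 : R| <= 1 by rewrite normr1.
have cw u : {for u, continuous (fun=> 1 : R)} by exact: cont_cst.
have cn := lt0r_neq0 c0.
pose C : R := 2 * 10 ^+ 7.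
have C0 : 0 <= C by rewrite !mulr_ge0.
have nz u : c <= u <= b -> u != 0 by move=> ?; rewrite gt_eqF//; lra.
pose kj (j : 'I_4) u := C * 4 * log_majorant c `|u - turning_point (n j)| + C * (c * u ^+ 3)^-1.
have ci u : c <= u <= b -> {for u, continuous (fun u : R => (c * u ^+ 3)^-1)}.
  by move=> /nz u0; cont_tac; rewrite mulf_neq0 ?expf_neq0// gt_eqF.
have ck (j : 'I_4) u : c <= u <= b -> {for u, continuous (kj j)}.
  move=> ucb; apply: cont_add; apply: cont_mul; do ?exact: cont_cst.
    exact: cont_log_majorant.
  exact: ci.
have ik j : \int[mu]_(u in `[c, b]) kj j u <= C * ((8 * L c + 1) / c ^+ 3).
  rewrite Rintegral_lin//; last by move=> u _; exact: cont_log_majorant.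
  have d u : c <= u <= b -> is_derive u 1 (fun u : R => - (2 * c * u ^+ 2)^-1) (c * u ^+ 3)^-1.
    move=> /nz u0; eapply der_eq; [der_tac; by rewrite ?mulf_neq0 ?expf_neq0 ?pnatr_eq0|].
    by field; rewrite u0 cn.
  rewrite (Rintegral_FTC cb d ci).
  have h := Rintegral_log_majorant c0 (turning_point (n j)) cb.
  apply: (le_trans (le_lin _ _ h)); first by rewrite mulr_ge0.
  have -> : C * ((8 * L c + 1) / c ^+ 3) = C * 4 * (2 * (L c / c ^+ 3)) + C * (c ^+ 3)^-1.
    by field; rewrite lt0r_neq0.
  rewrite lerD2l ler_wpM2l//.
  have : 0 <= (2 * c * b ^+ 2)^-1 by rewrite invr_ge0 mulr_ge0 ?sqr_ge0//; lra.
  have -> : (2 * c * c ^+ 2)^-1 = (c ^+ 3)^-1 / 2 by field; rewrite lt0r_neq0.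
  have : 0 < (c ^+ 3)^-1 by rewrite invr_gt0.
  lra.
apply: (@le_trans _ _ (\int[mu]_(u in `[c, b]) (\sum_(j < 4) kj j u))).
  apply: (norm_Ibox_oscillating_le _ _ cw cb wW).
    by move=> u uac; apply: cont_sum => j; exact: ck.
  move=> u ucb; rewrite normr1 mul1r mulr_sumr; apply: ler_sum => j _.
  have h := @high_majorant R c u (n j) c1 ltac:(lra).
  apply: (le_trans (ler_wpM2l C0 h)); rewrite /kj le_eqVlt; apply/orP; left.
  by apply/eqP; ring.
rewrite Rintegral_sum_itv//; apply: (@le_trans _ _ (\sum_(j < 4) C * ((8 * L c + 1) / c ^+ 3))).
  by apply: ler_sum => j _; exact: ik.
by rewrite sumr_const card_ord -mulr_natl /C; lra.
Qed.

(** Multiplication by [exp (i e xi_j)] on the frequency side. *)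
Definition shift n (j : 'I_4) (e : R) : 'I_4 -> R := fun i => n i + (i == j)%:R * e.

Lemma wave_phase_shift g psi n j e u (xi : mR4) :
  wave_phase g psi (shift n j e) u xi = wave_phase g psi n u xi + e * coord4 xi j.
Proof.
rewrite /wave_phase /shift (_ : \sum_(i < 4) _ = \sum_(i < 4) n i * coord4 xi i + e * coord4 xi j).
  by ring.
under eq_bigr do rewrite mulrDl; rewrite big_split/=; congr (_ + _).
rewrite (bigD1 j)//= eqxx mul1r big1 ?addr0// => i /negbTE ->.
by rewrite !mul0r.
Qed.

Lemma symbol_cos g psi n u (xi : mR4) :
  symbol xi * cos (wave_phase g psi n u xi) =
  \sum_(j < 4) (2 * cos (wave_phase g psi n u xi)
    - cos (wave_phase g psi (shift n j 1) u xi)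
    - cos (wave_phase g psi (shift n j (-1)) u xi)).
Proof.
rewrite /symbol mulr_suml; apply: eq_bigr => j _.
by rewrite !wave_phase_shift mulN1r mul1r cosD cosB; ring.
Qed.

Lemma cont_wave_phase g psi n u (xi : mR4) : u != 0 ->
  {for u, continuous (fun u : R => wave_phase g psi n u xi)}.
Proof. by move=> u0; rewrite /wave_phase; cont_tac; rewrite expf_neq0. Qed.

Lemma cont_oscillating_integrand g psi n w u (xi : mR4) : u != 0 ->
  {for u, continuous w} ->
  {for u, continuous (fun u : R => w u * cos (wave_phase g psi n u xi))}.
Proof. by move=> u0 cw; apply: cont_mul => //; apply/cont_cos/cont_wave_phase. Qed.

Definition bulk_weight c u : R := u ^+ 4 / c ^+ 4.
Definition derivative_weight c u : R := 2 / c ^+ 4 * (3 * u ^+ 2 - 7 * u ^+ 6 / c ^+ 4).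
Definition symbol_weight c u : R := 4 / c ^+ 4 * ((1 - u ^+ 4 / c ^+ 4) * u ^+ 4).
Definition boundary_weight c u : R := 2 / c ^+ 4 * ((1 - u ^+ 4 / c ^+ 4) * u ^+ 3).

(** For [u < c] the term [c^4 / (4 u^2)] makes the phase oscillate faster than
    the kernel bound sees. Integrating it by parts trades the weight [1] for
    weights of size [(u^4 + u^2) / c^4], at the price of one factor [symbol xi], which
    is a second difference of translates of [n]. The factor [1 - (u / c)^4]
    removes the boundary term at [c]. *)
Lemma oscillating_by_parts a c n psi (xi : mR4) : 0 < a <= c ->
  oscillating (c ^+ 4 / 4) a c (fun=> 1) n psi xi =
  oscillating (c ^+ 4 / 4) a c (bulk_weight c) n psi xi +
  oscillating (c ^+ 4 / 4) a c (derivative_weight c) n (psi - pi / 2) xi +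
  \sum_(j < 4) (2 * oscillating (c ^+ 4 / 4) a c (symbol_weight c) n psi xi
    - oscillating (c ^+ 4 / 4) a c (symbol_weight c) (shift n j 1) psi xi
    - oscillating (c ^+ 4 / 4) a c (symbol_weight c) (shift n j (-1)) psi xi)
  + boundary_weight c a * cos (wave_phase (c ^+ 4 / 4) (psi - pi / 2) n a xi).
Proof.
move=> /andP[a0 ac]; set g := c ^+ 4 / 4.
have c0 : c != 0 by rewrite gt_eqF//; lra.
have nz u : a <= u <= c -> u != 0 by move=> ?; rewrite gt_eqF//; lra.
have quarter m u : cos (wave_phase g (psi - pi / 2) m u xi) = sin (wave_phase g psi m u xi).
  by rewrite sin_cosB; congr cos; rewrite /wave_phase; ring.
pose G u : R := boundary_weight c u * sin (wave_phase g psi n u xi).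
pose dG u : R := derivative_weight c u * cos (wave_phase g (psi - pi / 2) n u xi) +
  symbol_weight c u * (symbol xi * cos (wave_phase g psi n u xi)) -
  (1 - bulk_weight c u) * cos (wave_phase g psi n u xi).
have cbulk u : {for u, continuous (bulk_weight c)} by rewrite /bulk_weight; cont_tac.
have cder u : {for u, continuous (derivative_weight c)} by rewrite /derivative_weight; cont_tac.
have csym u : {for u, continuous (symbol_weight c)} by rewrite /symbol_weight; cont_tac.
have cdG u : a <= u <= c -> {for u, continuous dG}.
  move=> /nz u0; have := @cont_wave_phase g psi n u xi u0.
  have := @cont_wave_phase g (psi - pi / 2) n u xi u0 => ? ?.
  by rewrite /dG /derivative_weight /symbol_weight /bulk_weight; cont_tac.
have ddG u : a <= u <= c -> is_derive u 1 G (dG u).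
  move=> /nz u0; have dphi : is_derive u 1 (fun u : R => wave_phase g psi n u xi)
      (2 * u * symbol xi - 2 * g / u ^+ 3).
    by rewrite /wave_phase; eapply der_eq; [der_tac; rewrite expf_neq0|field].
  rewrite /G /boundary_weight; eapply der_eq; [der_tac|].
  rewrite /dG quarter /derivative_weight /symbol_weight /bulk_weight /g.
  move: (sin _) (cos _) (symbol _) => x y s.
  by field; rewrite u0 c0.
have Gc : G c = 0.
  by rewrite /G /boundary_weight divff ?expf_neq0// subrr !mul0r mulr0 mul0r.
have := Rintegral_FTC ac ddG cdG; rewrite Gc sub0r {1}/G -quarter => byparts.
have Ga := esym byparts.
have itg w m p : (forall u, {for u, continuous w}) ->
   mu.-integrable `[a, c] (EFin \o (fun u => w u * cos (wave_phase g p m u xi))).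
  by move=> cw; apply: continuous_integrable_itv => u /nz u0; apply: cont_oscillating_integrand.
have symE : \int[mu]_(u in `[a, c]) (symbol_weight c u * (symbol xi * cos (wave_phase g psi n u xi))) =
  \sum_(j < 4) (2 * oscillating g a c (symbol_weight c) n psi xi
    - oscillating g a c (symbol_weight c) (shift n j 1) psi xi
    - oscillating g a c (symbol_weight c) (shift n j (-1)) psi xi).
  under eq_Rintegral do rewrite symbol_cos mulr_sumr.
  rewrite Rintegral_sum_itv; last first.
    move=> j u /nz u0; have := @cont_wave_phase g psi n u xi u0.
    have := @cont_wave_phase g psi (shift n j 1) u xi u0.
    have := @cont_wave_phase g psi (shift n j (-1)) u xi u0 => ? ? ?.
    by have := csym u => ?; cont_tac.
  apply: eq_bigr => j _; rewrite /oscillating.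
  have i1 := itg _ n psi csym; have i2 := itg _ (shift n j 1) psi csym.
  have i3 := itg _ (shift n j (-1)) psi csym.
  have i12 : mu.-integrable `[a, c] (EFin \o (fun u => 2 * (symbol_weight c u * cos (wave_phase g psi n u xi)))).
    apply: continuous_integrable_itv => u /nz u0; apply: cont_mul; first exact: cont_cst.
    exact: cont_oscillating_integrand.
  have i13 : mu.-integrable `[a, c] (EFin \o (fun u => 2 * (symbol_weight c u * cos (wave_phase g psi n u xi)) -
     symbol_weight c u * cos (wave_phase g psi (shift n j 1) u xi))).
    apply: continuous_integrable_itv => u /nz u0; apply: cont_add; last first.
      by apply/cont_opp/cont_oscillating_integrand.
    apply: cont_mul; first exact: cont_cst.
    exact: cont_oscillating_integrand.
  rewrite -RintegralZl// -!RintegralB//.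
  by apply: eq_Rintegral => u _; ring.
have i1 := itg _ n psi cbulk; have i2 := itg _ n (psi - pi / 2) cder.
have i3 : mu.-integrable `[a, c] (EFin \o (fun u => symbol_weight c u * (symbol xi * cos (wave_phase g psi n u xi)))).
  apply: continuous_integrable_itv => u /nz u0; have := @cont_wave_phase g psi n u xi u0 => ?.
  by have := csym u => ?; cont_tac.
have i4 : mu.-integrable `[a, c] (EFin \o dG) by exact: continuous_integrable_itv.
have iD f h : mu.-integrable `[a, c] (EFin \o f) -> mu.-integrable `[a, c] (EFin \o h) ->
    mu.-integrable `[a, c] (EFin \o (fun u => f u + h u)).
  by move=> if_ ih; apply: eq_integrable (integrableD _ if_ ih).
have i12 := iD _ _ i1 i2; have i123 := iD _ _ i12 i3.
rewrite -symE -[X in _ + X]opprK -byparts /oscillating -!RintegralD//.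
rewrite -RintegralB//.
by apply: eq_Rintegral => u _; rewrite /dG; ring.
Qed.

End UniformBound.

(** * The bound on a window *)

Section Dispersive.
Local Open Scope classical_set_scope.
Local Open Scope ring_scope.
Context {R : realType}.
Implicit Types (n : 'I_4 -> R) (w : R -> R) (a b c t l psi g u B M : R).
Local Notation mu := (@lebesgue_measure R).
Local Notation mR := (measurableTypeR R).
Local Notation mR4 := (mR * mR * mR * mR)%type.

(** The weights that the bound for [u < c] can absorb; all those produced by the
    integration by parts are of this form. *)
Definition low_weight c B w := (forall u, {for u, continuous w}) /\
  forall u, 0 < u <= c -> `|w u| <= B * ((u ^+ 4 + u ^+ 2) / c ^+ 4).

Lemma bmeas_low g a c w n psi B : 1 <= c -> 0 < a <= c -> 0 <= B ->
  low_weight c B w -> bmeas (oscillating g a c w n psi).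
Proof.
move=> c1 /andP[a0 ac] B0 [cw wB].
apply: (@bmeas_oscillating R g a c (B * ((c ^+ 4 + c ^+ 2) / c ^+ 4))) => // u uac.
apply: (le_trans (wB u ltac:(lra))); rewrite ler_wpM2l//.
rewrite ler_pM2r ?invr_gt0 ?exprn_gt0//; last by lra.
by apply: lerD; apply: lerXn2r; rewrite ?nnegrE; lra.
Qed.

Lemma low_bulk c : 1 <= c -> low_weight c 1 (bulk_weight c).
Proof.
move=> c1; have c4 : 0 < c ^+ 4 by rewrite exprn_gt0//; lra.
split=> [u|u /andP[u0 uc]]; first by rewrite /bulk_weight; cont_tac.
rewrite mul1r /bulk_weight ger0_norm; last by apply: divr_ge0; [apply: exprn_ge0; lra|lra].
by rewrite ler_pM2r ?invr_gt0// lerDl sqr_ge0.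
Qed.

Let ratio_le c u : 1 <= c -> 0 < u <= c -> 0 <= u ^+ 4 / c ^+ 4 <= 1.
Proof.
move=> c1 /andP[u0 uc]; have c4 : 0 < c ^+ 4 by rewrite exprn_gt0//; lra.
apply/andP; split; first by apply: divr_ge0; [apply: exprn_ge0; lra|lra].
rewrite ler_pdivrMr// mul1r.
by apply: lerXn2r; rewrite ?nnegrE; lra.
Qed.

Lemma low_derivative c : 1 <= c -> low_weight c 14 (derivative_weight c).
Proof.
move=> c1; have c4 : 0 < c ^+ 4 by rewrite exprn_gt0//; lra.
split=> [u|u uc]; first by rewrite /derivative_weight; cont_tac.
rewrite /derivative_weight.
rewrite (_ : _ * (_ - _) = (6 - 14 * (u ^+ 4 / c ^+ 4)) * (u ^+ 2 / c ^+ 4)); last first.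
  by field; rewrite gt_eqF//; lra.
have h0 : 0 <= u ^+ 2 / c ^+ 4 by rewrite divr_ge0 ?sqr_ge0// ltW.
rewrite normrM [X in _ * X]ger0_norm//.
have := ratio_le c1 uc => /andP[r0 r1].
rewrite [(_ + _) / _]mulrDl [14 * (_ + _)]mulrDr; set x := u ^+ 4 / c ^+ 4 in r0 r1 *.
have : `|6 - 14 * x| * (u ^+ 2 / c ^+ 4) <= 14 * (u ^+ 2 / c ^+ 4).
  by rewrite ler_wpM2r// ler_norml; lra.
lra.
Qed.

Lemma low_symbol c : 1 <= c -> low_weight c 4 (symbol_weight c).
Proof.
move=> c1; have c4 : 0 < c ^+ 4 by rewrite exprn_gt0//; lra.
split=> [u|u uc]; first by rewrite /symbol_weight; cont_tac.
rewrite /symbol_weight.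
have h0 : 0 <= u ^+ 2 / c ^+ 4 by rewrite divr_ge0 ?sqr_ge0// ltW.
rewrite (_ : _ * (_ * _) = 4 * (1 - u ^+ 4 / c ^+ 4) * (u ^+ 4 / c ^+ 4)); last by ring.
have := ratio_le c1 uc => /andP[r0 r1].
rewrite [(_ + _) / _]mulrDl [leRHS]mulrDr; set x := u ^+ 4 / c ^+ 4 in r0 r1 *.
rewrite normrM [X in _ * X]ger0_norm//.
have : `|4 * (1 - x)| * x <= 4 * x by rewrite ler_wpM2r// ler_norml; lra.
lra.
Qed.

Local Notation L c := (ln (1 + c ^+ 4)).

Definition window_const : R := 8 * 10 ^+ 7 * 1272 + 2 * (2 * pi) ^+ 4.

Lemma ln1p4_ge0 c : 0 <= L c.
Proof. by apply: ln_ge0; rewrite lerDl (exprM c 2 2) sqr_ge0. Qed.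

Lemma bmeas_window g a b n psi : a <= b -> bmeas (oscillating g a b (fun=> 1) n psi).
Proof.
move=> ab; apply: (@bmeas_oscillating R g a b 1) => //.
- by move=> u; exact: cont_cst.
- by move=> u _; rewrite normr1.
Qed.

Let boundary_weight_le a c : 1 <= c -> 0 < a -> a <= 1 ->
  `|boundary_weight c a| <= 2 / c ^+ 3.
Proof.
move=> c1 a0 a1; have ac : 0 < a <= c by lra.
have c0 : 0 < c by lra.
have := ratio_le c1 ac => /andP[r0 r1].
have a3 : 0 <= a ^+ 3 by rewrite exprn_ge0// ltW.
have a31 : a ^+ 3 <= 1 by rewrite exprn_ile1// ltW.
have c4 : (c ^+ 4)^-1 <= (c ^+ 3)^-1.
  by rewrite lef_pV2 ?posrE ?exprn_gt0// ler_weXn2l.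
have c4' : 0 < (c ^+ 4)^-1 by rewrite invr_gt0 exprn_gt0.
have q0 : 0 <= (1 - a ^+ 4 / c ^+ 4) * a ^+ 3 by apply: mulr_ge0 => //; lra.
rewrite /boundary_weight ger0_norm; last by apply: mulr_ge0 => //; lra.
have : (1 - a ^+ 4 / c ^+ 4) * a ^+ 3 <= 1 * 1 by apply: ler_pM => //; lra.
rewrite mulr1 => q1; rewrite -[leRHS]mulr1; apply: ler_pM => //; lra.
Qed.

Let window_arith (K P x d : R) : 0 <= K -> 0 <= P -> 0 <= x -> 0 <= d ->
  1 * (K * ((16 * x + 3) * d)) + 14 * (K * ((16 * x + 3) * d)) +
  64 * (K * ((16 * x + 3) * d)) + 2 * P * d + K * ((8 * x + 1) * d) <=
  (K * 1272 + 2 * P) * ((x + 1) * d).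
Proof.
move=> K0 P0 x0 d0; rewrite -subr_ge0.
set lhs := (X in _ <= X); have -> : lhs = (K * 1034 + 2 * P * x) * d by rewrite /lhs; ring.
have k0 : 0 <= K * 1034 by exact: (mulr_ge0 K0 (ler0n R 1034)).
have p0 : 0 <= 2 * P * x by exact: (mulr_ge0 (mulr_ge0 (ler0n R 2) P0) x0).
exact: (mulr_ge0 (addr_ge0 k0 p0) d0).
Qed.

Let second_difference_le (x y z X : R) : `|x| <= 4 * X -> `|y| <= 4 * X ->
  `|z| <= 4 * X -> `|2 * x - y - z| <= 16 * X.
Proof. rewrite !ler_norml; lra. Qed.

(** The bound is uniform in the window, which is what survives when [a -> 0] and
    [b -> oo]. *)
Lemma norm_Ibox_window_le a b c n psi : 1 <= c -> 0 < a <= 1 -> c <= b ->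
  `|Ibox (oscillating (c ^+ 4 / 4) a b (fun=> 1) n psi)| <=
  window_const * ((L c + 1) / c ^+ 3).
Proof.
move=> c1 /andP[a0 a1] cb; set g := c ^+ 4 / 4.
have ac : 0 < a <= c by lra.
have c0 : 0 < c by lra.
have c3 : 0 < c ^+ 3 by rewrite exprn_gt0.
pose Xl := 8 * 10 ^+ 7 * ((16 * L c + 3) / c ^+ 3).
have lowB B w m p : 0 <= B -> low_weight c B w ->
    `|Ibox (oscillating g a c w m p)| <= B * Xl.
  move=> B0 [cw wB]; have := @norm_Ibox_low_le R g a c w m p B c1 ac B0 cw.
  move=> /(_ (fun u uac => wB u ltac:(lra))) /le_trans; apply.
  by rewrite /Xl; lra.
have bl w m p B : 0 <= B -> low_weight c B w -> bmeas (oscillating g a c w m p).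
  by move=> B0; exact: bmeas_low.
have b1 := bl _ n psi _ ler01 (low_bulk c1).
have b2 := bl _ n (psi - pi / 2) _ (ler0n _ 14) (low_derivative c1).
have b3 m := bl _ m psi _ (ler0n _ 4) (low_symbol c1).
pose T j xi := 2 * oscillating g a c (symbol_weight c) n psi xi
    - oscillating g a c (symbol_weight c) (shift n j 1) psi xi
    - oscillating g a c (symbol_weight c) (shift n j (-1)) psi xi.
have b2s : bmeas (fun xi => 2 * oscillating g a c (symbol_weight c) n psi xi).
  by apply: bmeas_mul; [exact: bmeas_cst|exact: b3].
have bT j : bmeas (T j).
  by apply: bmeas_sub => //; exact: bmeas_sub.
pose Y xi := cos (wave_phase g (psi - pi / 2) n a xi).
have bY : bmeas Y by exact: (bmeas_cos (measurable_affine_phase _ _ _)).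
have bYw : bmeas (fun xi => boundary_weight c a * Y xi).
  by apply: bmeas_mul => //; exact: bmeas_cst.
have bh := bmeas_window g n psi cb.
have split xi : oscillating g a b (fun=> 1) n psi xi =
    oscillating g a c (bulk_weight c) n psi xi +
    oscillating g a c (derivative_weight c) n (psi - pi / 2) xi +
    \sum_(j < 4) T j xi + boundary_weight c a * Y xi +
    oscillating g c b (fun=> 1) n psi xi.
  rewrite -oscillating_by_parts//; apply: Rintegral_split; first by lra.
  move=> u uab; apply: cont_oscillating_integrand; last exact: cont_cst.
  by rewrite gt_eqF//; lra.
have -> : Ibox (oscillating g a b (fun=> 1) n psi) =
    Ibox (oscillating g a c (bulk_weight c) n psi) +
    Ibox (oscillating g a c (derivative_weight c) n (psi - pi / 2)) +
    \sum_(j < 4) Ibox (T j) + boundary_weight c a * Ibox Y +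
    Ibox (oscillating g c b (fun=> 1) n psi).
  rewrite (eq_Ibox (g := _) (fun xi _ => split xi)).
  have bs : bmeas (fun xi => \sum_(j < 4) T j xi) by exact: bmeas_sum.
  have b12 := bmeas_add b1 b2; have b12s := bmeas_add b12 bs.
  have b12sY := bmeas_add b12s bYw.
  by rewrite !IboxD// Ibox_sum// IboxZ.
have h1 := lowB _ _ n psi ler01 (low_bulk c1).
have h2 := lowB _ _ n (psi - pi / 2) (ler0n _ 14) (low_derivative c1).
have hT j : `|Ibox (T j)| <= 16 * Xl.
  rewrite /T !IboxB//; last exact: bmeas_sub.
  rewrite IboxZ//; have e0 := lowB _ _ n psi (ler0n _ 4) (low_symbol c1).
  have e1 := lowB _ _ (shift n j 1) psi (ler0n _ 4) (low_symbol c1).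
  have e2 := lowB _ _ (shift n j (-1)) psi (ler0n _ 4) (low_symbol c1).
  exact: second_difference_le e0 e1 e2.
have hs : `|\sum_(j < 4) Ibox (T j)| <= 64 * Xl.
  apply: (le_trans (ler_norm_sum _ _ _)).
  apply: (@le_trans _ _ (\sum_(j < 4) 16 * Xl)); first by apply: ler_sum.
  by rewrite sumr_const card_ord -[leLHS]mulr_natl mulrA -natrM.
have hY : `|boundary_weight c a * Ibox Y| <= 2 * (2 * pi) ^+ 4 / c ^+ 3.
  have bw := boundary_weight_le c1 a0 a1.
  have IY : `|Ibox Y| <= (2 * pi) ^+ 4.
    apply: (le_trans (le_normr_Ibox bY)); rewrite -[leRHS]mul1r -Ibox_cst.
    apply: le_Ibox; [exact: bmeas_norm|exact: bmeas_cst|].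
    by move=> xi _; exact: cos_max.
  rewrite normrM (_ : 2 * (2 * pi) ^+ 4 / c ^+ 3 = 2 / c ^+ 3 * (2 * pi) ^+ 4).
    exact: ler_pM.
  ring.
have hh := norm_Ibox_high_le g n psi c1 cb.
have L0 := ln1p4_ge0 c.
have i0 : 0 < (c ^+ 3)^-1 by rewrite invr_gt0.
have P0 : 0 <= (2 * pi) ^+ 4 :> R by rewrite exprn_ge0// mulr_ge0// pi_ge0.
apply: (@le_trans _ _ (1 * Xl + 14 * Xl + 64 * Xl + 2 * (2 * pi) ^+ 4 / c ^+ 3 +
   8 * 10 ^+ 7 * ((8 * L c + 1) / c ^+ 3))).
  apply: (le_trans (ler_normD _ _)); apply: lerD => //.
  apply: (le_trans (ler_normD _ _)); apply: lerD => //.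
  apply: (le_trans (ler_normD _ _)); apply: lerD => //.
  by apply: (le_trans (ler_normD _ _)); apply: lerD.
rewrite /Xl /window_const.
have K0 : 0 <= 8 * 10 ^+ 7 :> R by rewrite mulr_ge0// exprn_ge0.
move: (8 * 10 ^+ 7) ((2 * pi) ^+ 4) (ln (1 + c ^+ 4)) (c ^+ 3)^-1 K0 P0 L0 (ltW i0).
exact: window_arith.
Qed.

End Dispersive.

(** * Subordination and the dispersive estimate *)

Section Subordination.
Local Open Scope classical_set_scope.
Local Open Scope ring_scope.
Context {R : realType}.
Implicit Types (n : 'I_4 -> R) (a b c t l psi u v M th : R).
Local Notation mu := (@lebesgue_measure R).
Local Notation mR := (measurableTypeR R).
Local Notation mR4 := (mR * mR * mR * mR)%type.

Variables (C S : R -> R) (K1 K2 B : R).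
Hypothesis CS : fresnel_like C S K1 K2 B.

Definition fresnel_phase th v := cos th * C v - sin th * S v.
Definition fresnel_end th := cos th * K1 - sin th * K2.

Let combine_le (p q x y e : R) : `|p| <= 1 -> `|q| <= 1 -> `|x| <= e -> `|y| <= e ->
  `|p * x - q * y| <= 2 * e.
Proof.
move=> p1 q1 xe ye; apply: (le_trans (ler_normB _ _)); rewrite !normrM mulr_natl mulr2n.
have e0 : 0 <= e := le_trans (normr_ge0 _) xe.
by apply: lerD; rewrite -[leRHS]mul1r; apply: ler_pM.
Qed.

Let limit_arith (p q r s e e' i m : R) : `|p - e| <= 2 * m -> `|q - e'| <= 2 * m ->
  `|r + e| <= 2 * m -> `|s - e'| <= 2 * m -> 2 * i = (p + q) - (r + s) ->
  `|i - e| <= 4 * m.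
Proof. by rewrite !ler_norml; lra. Qed.

Lemma der_fresnel_phase th v :
  is_derive v 1 (fresnel_phase th) (cos (th + v ^+ 2)).
Proof.
have [dC dS _ _ _] := CS; have dCv := dC v; have dSv := dS v.
rewrite /fresnel_phase; eapply der_eq; [der_tac|].
by rewrite cosD; ring.
Qed.

Lemma fresnel_phase_near th v : 1 <= v ->
  `|fresnel_phase th v - fresnel_end th| <= 2 * v^-1.
Proof.
move=> v1; have [_ _ CK _ _] := CS; have [h1 h2] := CK v v1.
rewrite (_ : _ - _ = cos th * (C v - K1) - sin th * (S v - K2)).
  by apply: combine_le => //; [exact: cos_max|exact: sin_max].
by rewrite /fresnel_phase /fresnel_end; ring.
Qed.

Lemma fresnel_phase_far th v : v <= -1 ->
  `|fresnel_phase th v + fresnel_end th| <= 2 * (- v)^-1.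
Proof.
move=> v1; have [_ _ _ CK _] := CS; have [h1 h2] := CK v v1.
rewrite (_ : _ + _ = cos th * (C v + K1) - sin th * (S v + K2)).
  by apply: combine_le => //; [exact: cos_max|exact: sin_max].
by rewrite /fresnel_phase /fresnel_end; ring.
Qed.

Lemma fresnel_phase_le th v : `|fresnel_phase th v| <= 2 * B.
Proof.
have [_ _ _ _ CB] := CS; have [h1 h2] := CB v.
by apply: combine_le => //; [exact: cos_max|exact: sin_max].
Qed.

(** Completing the square in [(al u - be / u)^2 = al^2 u^2 - 2 al be + be^2 / u^2]
    gives the window integral in closed form. *)
Lemma fresnel_window th al be a b : 0 < a <= b ->
  2 * al * \int[mu]_(u in `[a, b]) cos (th + al ^+ 2 * u ^+ 2 + be ^+ 2 / u ^+ 2) =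
  (fresnel_phase (th + 2 * al * be) (al * b - be / b) +
   fresnel_phase (th - 2 * al * be) (al * b + be / b)) -
  (fresnel_phase (th + 2 * al * be) (al * a - be / a) +
   fresnel_phase (th - 2 * al * be) (al * a + be / a)).
Proof.
move=> /andP[a0 ab]; have nz u : a <= u <= b -> u != 0 by move=> ?; rewrite gt_eqF//; lra.
pose F u := fresnel_phase (th + 2 * al * be) (al * u - be / u) +
  fresnel_phase (th - 2 * al * be) (al * u + be / u).
pose f u := cos (th + al ^+ 2 * u ^+ 2 + be ^+ 2 / u ^+ 2).
have cf u : a <= u <= b -> {for u, continuous f}.
  by move=> /nz u0; rewrite /f; cont_tac; rewrite expf_neq0.
have cf2 u : a <= u <= b -> {for u, continuous (fun u => 2 * al * f u)}.
  by move=> uab; apply: cont_mul; [exact: cont_cst|exact: cf].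
have dF u : a <= u <= b -> is_derive u 1 F (2 * al * f u).
  move=> /nz u0.
  have d1 : is_derive u 1 (fun u : R => al * u - be / u) (al + be / u ^+ 2).
    by eapply der_eq; [der_tac|field].
  have d2 : is_derive u 1 (fun u : R => al * u + be / u) (al - be / u ^+ 2).
    by eapply der_eq; [der_tac|field].
  have e1 := @der_comp R (fresnel_phase (th + 2 * al * be)) _ _ _ _ (der_fresnel_phase _ _) d1.
  have e2 := @der_comp R (fresnel_phase (th - 2 * al * be)) _ _ _ _ (der_fresnel_phase _ _) d2.
  rewrite /F; eapply der_eq; [exact: (der_add e1 e2)|].
  rewrite (_ : th + 2 * al * be + _ = th + al ^+ 2 * u ^+ 2 + be ^+ 2 / u ^+ 2); last by field.
  rewrite (_ : th - 2 * al * be + _ = th + al ^+ 2 * u ^+ 2 + be ^+ 2 / u ^+ 2); last by field.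
  by rewrite /f; move: (cos _) => x; field.
rewrite -/(F b) -/(F a) -(Rintegral_FTC ab dF cf2) RintegralZl//.
exact: continuous_integrable_itv.
Qed.

Lemma fresnel_window_le th al be a b : 0 < a <= b -> 0 <= al ->
  `|al * \int[mu]_(u in `[a, b]) cos (th + al ^+ 2 * u ^+ 2 + be ^+ 2 / u ^+ 2)| <= 4 * B.
Proof.
move=> ab al0; have := fresnel_window th al be ab.
set I := Rintegral _ _ _.
have h1 := fresnel_phase_le (th + 2 * al * be) (al * b - be / b).
have h2 := fresnel_phase_le (th - 2 * al * be) (al * b + be / b).
have h3 := fresnel_phase_le (th + 2 * al * be) (al * a - be / a).
have h4 := fresnel_phase_le (th - 2 * al * be) (al * a + be / a).
move: h1 h2 h3 h4; move: (fresnel_phase _ _) (fresnel_phase _ _) (fresnel_phase _ _) (fresnel_phase _ _).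
move=> x y z w; rewrite -mulrA; move: (al * I) => p.
by rewrite !ler_norml; lra.
Qed.

(** As the window grows, [al b - be / b] and [al u + be / u] at both ends tend
    to infinity while [al a - be / a] tends to minus infinity; so the two limits
    of phase [th - 2 al be] cancel and those of phase [th + 2 al be] add up. *)
Lemma fresnel_window_limit th al be l a b M : 1 <= M -> 0 <= be -> 0 < l <= al ->
  al <= 4 -> 0 < a <= 1 -> 1 <= b -> M + 4 <= be / a -> M + be <= l * b ->
  `|al * \int[mu]_(u in `[a, b]) cos (th + al ^+ 2 * u ^+ 2 + be ^+ 2 / u ^+ 2)
    - fresnel_end (th + 2 * al * be)| <= 4 * M^-1.
Proof.
move=> M1 be0 /andP[l0 lal] al4 /andP[a0 a1] b1 aM bM.
have ab : 0 < a <= b by lra.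
have := fresnel_window th al be ab; set I := Rintegral _ _ _ => E.
have be_b : 0 <= be / b <= be.
  by rewrite divr_ge0//= ?ler_pdivrMr ?ler_peMr//; lra.
have lb : l * b <= al * b by rewrite ler_wpM2r//; lra.
have ala : 0 <= al * a <= 4.
  apply/andP; split; first by apply: mulr_ge0; lra.
  by rewrite -[leRHS]mulr1; apply: ler_pM; lra.
have v1 : M <= al * b - be / b by lra.
have v2 : M <= al * b + be / b by lra.
have v3 : al * a - be / a <= - M by lra.
have v4 : M <= al * a + be / a by lra.
have Mi v : M <= v -> 2 * v^-1 <= 2 * M^-1.
  by move=> Mv; rewrite ler_pM2l// lef_pV2 ?posrE//; lra.
have h1 := le_trans (fresnel_phase_near (th + 2 * al * be) (le_trans M1 v1)) (Mi _ v1).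
have h2 := le_trans (fresnel_phase_near (th - 2 * al * be) (le_trans M1 v2)) (Mi _ v2).
have h3 : `|fresnel_phase (th + 2 * al * be) (al * a - be / a) + fresnel_end (th + 2 * al * be)| <= 2 * M^-1.
  by apply: le_trans (Mi _ (_ : M <= - (al * a - be / a))); [apply: fresnel_phase_far|]; lra.
have h4 := le_trans (fresnel_phase_near (th - 2 * al * be) (le_trans M1 v4)) (Mi _ v4).
by apply: (limit_arith h1 h2 h3 h4); rewrite mulrA.
Qed.

(** As a function of the phase, [fresnel_end] is a sinusoid of nonzero amplitude;
    it and its translate by a quarter period span the sine. *)
Lemma sin_fresnel_end x : (K1 ^+ 2 + K2 ^+ 2) * sin x =
  K1 * fresnel_end (x - pi / 2) - K2 * fresnel_end x.
Proof.
rewrite /fresnel_end cosBpihalf (_ : sin (x - pi / 2) = - cos x); first by ring.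
by rewrite sinB cos_pihalf sin_pihalf; ring.
Qed.

End Subordination.

Section DispersiveEstimate.
Local Open Scope classical_set_scope.
Local Open Scope ring_scope.
Context {R : realType}.
Implicit Types (n : 'I_4 -> R) (a b c t l psi u v M th : R).
Local Notation mu := (@lebesgue_measure R).
Local Notation mR := (measurableTypeR R).
Local Notation mR4 := (mR * mR * mR * mR)%type.

Definition propagator t (xi : mR4) : R := sin (t * omega xi) / omega xi.

Lemma symbol_ge0 (xi : mR4) : 0 <= symbol xi.
Proof.
by apply: sumr_ge0 => j _; have := cos_le1 (coord4 xi j); lra.
Qed.

Lemma omega_sqr (xi : mR4) : omega xi ^+ 2 = symbol xi.
Proof. by rewrite sqr_sqrtr// symbol_ge0. Qed.

Lemma omega_le4 (xi : mR4) : omega xi <= 4.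
Proof.
have -> : 4 = Num.sqrt (4 ^+ 2) :> R by rewrite sqrtr_sqr ger0_norm.
rewrite ler_sqrt ?exprn_ge0// /symbol.
apply: (@le_trans _ _ (\sum_(j < 4) (4 : R))).
  by apply: ler_sum => j _; have := cos_geN1 (coord4 xi j); lra.
by rewrite sumr_const card_ord -[leLHS]mulr_natl expr2.
Qed.

Lemma measurable_omega : measurable_fun setT (@omega R : mR4 -> R).
Proof.
apply: (measurableT_comp _ (@measurable_symbol R)).
by apply: continuous_measurable_fun; exact: sqrt_continuous.
Qed.

Lemma bmeas_propagator t : bmeas (propagator t).
Proof.
split.
  apply: measurable_funM.
    by apply/measurable_sin/measurable_funM; [exact: measurable_cst|exact: measurable_omega].
  exact: (measurableT_comp measurable_invr measurable_omega).
exists `|t| => xi; rewrite /propagator.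
have [->|o0] := eqVneq (omega xi) 0; first by rewrite invr0 mulr0 normr0.
rewrite normrM normfV ler_pdivrMr ?normr_gt0// -normrM.
exact: norm_sin_le.
Qed.

Lemma origin_trig_sqr (xi : mR4) :
  trig_sqr [:: 0] (fun y : lattice4 => (y == 0)%:R) xi = 1.
Proof.
rewrite /trig_sqr /trig_re /trig_im !big_seq1 eqxx !mul1r.
have -> : dot4 (0 : lattice4) xi = 0.
  by rewrite /dot4 big1// => j _; rewrite mxE mul0r.
by rewrite cos0 sin0; ring.
Qed.

(** A function with a singularity of order [1 / omega] is square integrable, so
    that small frequencies carry little of its integral. *)
Lemma Ibox_small (h : mR4 -> R) (H l e : R) : bmeas h -> 0 < H -> 0 < l -> 0 <= e ->
  (forall xi, box4 xi -> `|omega xi * h xi| <= H) ->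
  (forall xi, box4 xi -> l <= omega xi -> `|omega xi * h xi| <= e) ->
  `|Ibox h| <= pi ^+ 4 * (1 + 203 * H ^+ 2) / 2 * l ^+ 2 + (2 * pi) ^+ 4 * (e / l).
Proof.
move=> bh H0 l0 e0 hH he; have bl := bmeas_low_freq l.
have bh2 := bmeas_sqr bh.
have babs := bmeas_norm bh.
have bw : bmeas (fun xi => H ^- 2 * h xi ^+ 2) by apply: bmeas_mul => //; exact: bmeas_cst.
have H2 : 0 < H ^+ 2 by rewrite exprn_gt0.
have sq : Ibox (fun xi => h xi ^+ 2) <= pi ^+ 4 * (203 * H ^+ 2).
  have S1 : 1 = \sum_(y <- [:: 0 : lattice4]) ((y == 0)%:R : R) ^+ 4.
    by rewrite big_seq1 eqxx expr1n.
  have a0 (y : lattice4) : 0 <= (y == 0)%:R :> R by exact: ler0n.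
  have fa (y : lattice4) : `|(y == 0)%:R| = (y == 0)%:R ^+ 3 :> R.
    by case: (y == 0); rewrite ?normr1 ?expr1n ?normr0 ?expr0n.
  have w0 (xi : mR4) : 0 <= H ^- 2 * h xi ^+ 2.
    by rewrite mulr_ge0 ?sqr_ge0// invr_ge0 ltW.
  have w1 (xi : mR4) : box4 xi -> H ^- 2 * h xi ^+ 2 * symbol xi <= 1.
    move=> bxi; rewrite -omega_sqr -mulrA mulrC ler_pdivrMr// mul1r.
    rewrite mulrC -exprMn -real_normK ?num_real//.
    by apply: lerXn2r; rewrite ?nnegrE ?(ltW H0)//; exact: hH.
  have := weighted_parseval (erefl true : uniq [:: 0 : lattice4]) S1 a0 fa bw w0 w1.
  have -> : Ibox (fun xi => H ^- 2 * h xi ^+ 2 *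
      trig_sqr [:: 0] (fun y : lattice4 => (y == 0)%:R) xi) =
      H ^- 2 * Ibox (fun xi => h xi ^+ 2).
    by rewrite -IboxZ//; apply: eq_Ibox => xi _; rewrite origin_trig_sqr mulr1.
  rewrite mulrC ler_pdivrMr// => /le_trans; apply.
  rewrite le_eqVlt; apply/orP; left; apply/eqP; ring.
apply: (le_trans (le_normr_Ibox bh)).
have bB : bmeas (fun xi => l ^- 2 / 2 * low_freq l xi + (l ^+ 2 / 2 * h xi ^+ 2 + e / l)).
  apply: bmeas_add; first by apply: bmeas_mul => //; exact: bmeas_cst.
  by apply: bmeas_add; [apply: bmeas_mul => //|]; exact: bmeas_cst.
apply: (@le_trans _ _ (Ibox (fun xi => l ^- 2 / 2 * low_freq l xi + (l ^+ 2 / 2 * h xi ^+ 2 + e / l)))).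
  apply: le_Ibox => // xi bxi.
  have q0 : 0 <= l ^+ 2 / 2 * h xi ^+ 2.
    by apply: mulr_ge0; [apply: divr_ge0; [exact: sqr_ge0|]|exact: sqr_ge0].
  have el0 : 0 <= e / l by rewrite divr_ge0// ltW.
  rewrite low_freqE; have [low|high] := leP (symbol xi) (l ^+ 2).
    have := sqr_ge0 (l * `|h xi| - l^-1).
    rewrite sqrrB exprMn real_normK ?num_real// exprVn.
    have -> : l * `|h xi| * l^-1 = `|h xi| by field; rewrite gt_eqF.
    by rewrite mulr1; lra.
  have lo : l <= omega xi.
    rewrite -(ger0_norm (ltW l0)) -sqrtr_sqr ler_sqrt; last exact: symbol_ge0.
    exact: ltW.
  have om0 : 0 <= omega xi by exact: sqrtr_ge0.
  have := he _ bxi lo; rewrite normrM (ger0_norm om0).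
  have : l * `|h xi| <= omega xi * `|h xi| by rewrite ler_wpM2r.
  move=> h1 h2; have : `|h xi| <= e / l by rewrite ler_pdivlMr//; lra.
  by rewrite mulr0; lra.
rewrite IboxD; last 2 first.
- by apply: bmeas_mul => //; exact: bmeas_cst.
- by apply: bmeas_add; [apply: bmeas_mul => //|]; exact: bmeas_cst.
rewrite IboxZ// IboxD//; last 2 first.
- by apply: bmeas_mul => //; exact: bmeas_cst.
- exact: bmeas_cst.
rewrite IboxZ// Ibox_cst.
have i0 : 0 <= l ^- 2 / 2 by rewrite divr_ge0// invr_ge0 sqr_ge0.
have j0 : 0 <= l ^+ 2 / 2 by rewrite divr_ge0// sqr_ge0.
have := ler_wpM2l i0 (low_freq_volume (ltW l0)); have := ler_wpM2l j0 sq.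
have -> : l ^- 2 / 2 * (pi * l) ^+ 4 = pi ^+ 4 * l ^+ 2 / 2.
  by move: (pi : R) => P; field; rewrite gt_eqF.
move: (Ibox _) (Ibox _) (pi ^+ 4) ((2 * pi) ^+ 4) (e / l) (H ^+ 2) (l ^- 2).
by clear; move=> A A' P Q E K I; lra.
Qed.

Lemma omega_propagator t (xi : mR4) : omega xi * propagator t xi = sin (t * omega xi).
Proof.
have [e0|n0] := eqVneq (omega xi) 0; first by rewrite e0 mul0r mulr0 sin0.
by rewrite /propagator mulrCA divff// mulr1.
Qed.

Local Notation L c := (ln (1 + c ^+ 4)).

Let comb4_le (k1 k2 x y z w e : R) : `|x| <= e -> `|y| <= e -> `|z| <= e -> `|w| <= e ->
  `|k1 * x - k2 * y + (k1 * z - k2 * w)| <= 2 * (`|k1| + `|k2|) * e.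
Proof.
move=> xe ye ze we.
have P (k v : R) : `|v| <= e -> `|k * v| <= `|k| * e by move=> ve; rewrite normrM ler_wpM2l.
apply: (le_trans (ler_normD _ _)).
have := le_trans (ler_normB (k1 * x) (k2 * y)) (lerD (P _ _ xe) (P _ _ ye)).
have := le_trans (ler_normB (k1 * z) (k2 * w)) (lerD (P _ _ ze) (P _ _ we)).
lra.
Qed.

Let cos_mul_sin (x y : R) : 2 * (cos x * sin y) = sin (x + y) + sin (- x + y).
Proof. by rewrite !sinD cosN sinN; ring. Qed.

Let defect (o x k1 k2 kap j1 j2 j3 j4 e1 e2 e3 e4 : R) : kap != 0 ->
  2 * x = kap^-1 * (k1 * e1 - k2 * e2 + (k1 * e3 - k2 * e4)) ->
  x - o * ((2 * kap)^-1 * (k1 * j1 - k2 * j2 + (k1 * j3 - k2 * j4))) =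
  - ((2 * kap)^-1 * (k1 * (o * j1 - e1) - k2 * (o * j2 - e2) +
      (k1 * (o * j3 - e3) - k2 * (o * j4 - e4)))).
Proof.
move=> k0 h; have -> : x = 2 * x / 2 by field.
by rewrite h; field.
Qed.

Let tail_arith (P k M l e : R) : 0 < M -> 0 < l -> 8 * k * P <= M * (l * e) ->
  P * (k * (4 * M^-1) / l) <= e / 2.
Proof.
move=> M0 l0 h; have ln := lt0r_neq0 l0; have Mn := lt0r_neq0 M0.
have -> : P * (k * (4 * M^-1) / l) = (8 * k * P) / (2 * M * l) by field; rewrite ln Mn.
rewrite ler_pdivrMr ?mulr_gt0//; apply: (le_trans h).
by rewrite le_eqVlt; apply/orP; left; apply/eqP; field.
Qed.

(** The propagator, times a cosine, is approximated by the combination [comb] of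
    window integrals that tends to it. The error stays bounded after
    multiplication by [omega], and is uniformly small where [omega >= l], so its
    integral is as small as desired; each window integral obeys the window bound,
    with [g = (t / 2)^2 = c^4 / 4]. *)
Lemma dispersive_estimate : exists D : R, 0 < D /\ forall c n th, 1 <= c ->
  `|Ibox (fun xi => cos (th + \sum_(j < 4) n j * coord4 xi j) * propagator (c ^+ 2) xi)|
  <= D * ((L c + 1) / c ^+ 3).
Proof.
have [C [S [K1 [K2 [B [CS K10]]]]]] := @fresnel_exists R.
have kap0 : 0 < K1 ^+ 2 + K2 ^+ 2 by rewrite ltr_pwDl ?exprn_gt0 ?sqr_ge0.
set kap := K1 ^+ 2 + K2 ^+ 2 in kap0.
pose q := (`|K1| + `|K2|) / kap.
have q0 : 0 < q by rewrite divr_gt0// ltr_pwDl// normr_gt0 gt_eqF.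
have W0 : 0 < @window_const R.
  have k m : 0 < m.+1%:R :> R by rewrite ltr0n.
  apply: (ltr_pwDl (mulr_gt0 (mulr_gt0 (k 7) (exprn_gt0 7 (k 9))) (k 1271))).
  by rewrite mulr_ge0// exprn_ge0// mulr_ge0// pi_ge0.
have B0 : 0 <= B.
  by have [_ _ _ _ CB] := CS; have [+ _] := CB 0; apply: le_trans.
exists (q * @window_const R); split; first exact: mulr_gt0.
move=> c n th c1; set t := c ^+ 2; pose be := t / 2.
have t1 : 1 <= t by rewrite /t exprn_ege1.
have be0 : 0 < be by rewrite /be; lra.
set X := (L c + 1) / c ^+ 3.
apply/ler_addgt0Pr => eps eps0.
pose H := 1 + q * (4 * B).
have H0 : 0 < H by exact: (ltr_pwDl ltr01 (mulr_ge0 (ltW q0) (mulr_ge0 (ler0n R 4) B0))).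
pose P : R := pi ^+ 4 * (1 + 203 * H ^+ 2).
pose Q : R := (2 * pi) ^+ 4.
have P0 : 0 < P.
  apply: mulr_gt0; first by rewrite exprn_gt0// pi_gt0.
  exact: (ltr_pwDl ltr01 (mulr_ge0 (ler0n R 203) (sqr_ge0 H))).
have Q0 : 0 < Q by rewrite exprn_gt0// mulr_gt0// pi_gt0.
(* [l] makes the low frequencies negligible, and [M], the distance from which
   the Fresnel integrals are near their limits, does so for the others; [a] and
   [b] are then dictated by [M] and [l]. *)
pose l := Num.min 1 (eps / P).
have l0 : 0 < l by rewrite lt_min ltr01 divr_gt0.
have l1 : l <= 1 by rewrite /l ge_min lexx.
have lP : P * l <= eps by rewrite mulrC -ler_pdivlMr// /l ge_min lexx orbT.
pose M := Num.max 1 (8 * q * Q / (l * eps)).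
have M1 : 1 <= M by rewrite /M le_max lexx.
have MQ : 8 * q * Q <= M * (l * eps).
  by rewrite -ler_pdivrMr ?mulr_gt0// /M le_max lexx orbT.
pose a := Num.min 1 (be / (M + 4)).
have M4 : 0 < M + 4 by lra.
have a0 : 0 < a by rewrite lt_min ltr01 divr_gt0.
have a1 : a <= 1 by rewrite /a ge_min lexx.
have aM : M + 4 <= be / a.
  by rewrite ler_pdivlMr// mulrC -ler_pdivlMr// /a ge_min lexx orbT.
pose b := Num.max c ((M + be) / l).
have cb : c <= b by rewrite /b le_max lexx.
have bM : M + be <= l * b by rewrite mulrC -ler_pdivrMr// /b le_max lexx orbT.
have ab : 0 < a <= b by rewrite a0 (le_trans a1)// (le_trans c1).
pose J p m xi := oscillating (c ^+ 4 / 4) a b (fun=> 1) m p xi.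
pose n' : 'I_4 -> R := fun j => - n j.
pose phi p m (xi : mR4) : R := p + \sum_(j < 4) m j * coord4 xi j.
pose fe := fresnel_end K1 K2.
have JE p m xi : J p m xi = \int[mu]_(u in `[a, b])
    cos (phi p m xi + omega xi ^+ 2 * u ^+ 2 + be ^+ 2 / u ^+ 2).
  apply: eq_Rintegral => u _; rewrite mul1r; congr cos.
  rewrite /wave_phase omega_sqr /phi (mulrC (u ^+ 2)).
  have -> : be ^+ 2 = c ^+ 4 / 4 by rewrite /be /t; field.
  by move: (c ^+ 4 / 4 / u ^+ 2) (\sum_(j < 4) _) (symbol xi * _) => x y z; ring.
have two_be xi : 2 * omega xi * be = t * omega xi by rewrite /be; field.
have Jle p m xi : `|omega xi * J p m xi| <= 4 * B.
  by rewrite JE; apply: (fresnel_window_le CS); rewrite ?sqrtr_ge0.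
have Jlim p m xi : l <= omega xi ->
    `|omega xi * J p m xi - fe (phi p m xi + t * omega xi)| <= 4 * M^-1.
  move=> lo; rewrite JE -two_be; apply: (@fresnel_window_limit R C S K1 K2 B CS _ _ _ l) => //.
  - exact: ltW.
  - by rewrite l0.
  - exact: omega_le4.
  - by rewrite a0.
  - exact: le_trans cb.
have phin p xi : phi (- p) n' xi = - phi p n xi.
  by rewrite /phi /n' opprD -sumrN; congr (_ + _); apply: eq_bigr => j _; rewrite mulNr.
have sin2 xi : 2 * (cos (phi th n xi) * sin (t * omega xi)) =
    kap^-1 * (K1 * fe (phi (th - pi / 2) n xi + t * omega xi)
      - K2 * fe (phi th n xi + t * omega xi)
      + (K1 * fe (phi (- th - pi / 2) n' xi + t * omega xi)
      - K2 * fe (phi (- th) n' xi + t * omega xi))).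
  have sh p m : phi (p - pi / 2) m xi + t * omega xi = phi p m xi + t * omega xi - pi / 2.
    by rewrite /phi; ring.
  by rewrite !sh -!sin_fresnel_end -/kap phin -mulrDr mulKf ?gt_eqF// cos_mul_sin.
pose comb xi := (2 * kap)^-1 * (K1 * J (th - pi / 2) n xi - K2 * J th n xi +
  (K1 * J (- th - pi / 2) n' xi - K2 * J (- th) n' xi)).
have bJ p m : bmeas (J p m) by apply: bmeas_window; case/andP: ab.
have bKJ k p m : bmeas (fun xi => k * J p m xi) by apply: bmeas_mul => //; exact: bmeas_cst.
have bs k k' p m p' m' : bmeas (fun xi => k * J p m xi - k' * J p' m' xi) by exact: bmeas_sub.
have b4 : bmeas (fun xi => K1 * J (th - pi / 2) n xi - K2 * J th n xi +
  (K1 * J (- th - pi / 2) n' xi - K2 * J (- th) n' xi)) by exact: bmeas_add.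
have bcomb : bmeas comb by apply: bmeas_mul => //; exact: bmeas_cst.
pose p xi := cos (phi th n xi) * propagator t xi.
have bp : bmeas p.
  apply: bmeas_mul; last exact: bmeas_propagator.
  apply: bmeas_cos; apply: measurable_funD; [exact: measurable_cst|exact: measurable_linear].
have kq e : (2 * kap)^-1 * (2 * (`|K1| + `|K2|) * e) = q * e.
  by rewrite /q; field; rewrite gt_eqF.
have k20 : 0 <= (2 * kap)^-1 by rewrite invr_ge0 mulr_ge0// ltW.
have op xi : omega xi * p xi = cos (phi th n xi) * sin (t * omega xi).
  by rewrite /p mulrCA omega_propagator.
have hH xi : `|omega xi * (p xi - comb xi)| <= H.
  rewrite mulrBr op; apply: (le_trans (ler_normB _ _)); apply: lerD.
    rewrite normrM -[leRHS]mulr1; apply: ler_pM => //; [exact: cos_max|exact: sin_max].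
  have -> : omega xi * comb xi = (2 * kap)^-1 * (K1 * (omega xi * J (th - pi / 2) n xi)
     - K2 * (omega xi * J th n xi) + (K1 * (omega xi * J (- th - pi / 2) n' xi)
     - K2 * (omega xi * J (- th) n' xi))) by rewrite /comb; ring.
  rewrite normrM (ger0_norm k20) -kq ler_wpM2l//.
  by apply: comb4_le.
have he xi : l <= omega xi -> `|omega xi * (p xi - comb xi)| <= q * (4 * M^-1).
  move=> lo; have -> : omega xi * (p xi - comb xi) = - ((2 * kap)^-1 *
     (K1 * (omega xi * J (th - pi / 2) n xi - fe (phi (th - pi / 2) n xi + t * omega xi))
     - K2 * (omega xi * J th n xi - fe (phi th n xi + t * omega xi))
     + (K1 * (omega xi * J (- th - pi / 2) n' xi - fe (phi (- th - pi / 2) n' xi + t * omega xi))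
     - K2 * (omega xi * J (- th) n' xi - fe (phi (- th) n' xi + t * omega xi))))).
    rewrite [omega xi * (p xi - comb xi)]mulrBr op.
    rewrite /comb; refine (defect _ _ _ _ _ (lt0r_neq0 kap0) (sin2 xi)).
  rewrite normrN normrM (ger0_norm k20) -kq ler_wpM2l//.
  by apply: comb4_le; exact: Jlim.
have small : `|Ibox (fun xi => p xi - comb xi)| <= eps.
  have e0 : 0 <= q * (4 * M^-1) by apply: (mulr_ge0 (ltW q0)); apply: mulr_ge0 => //; rewrite invr_ge0; lra.
  apply: (le_trans (Ibox_small (bmeas_sub bp bcomb) H0 l0 e0 (fun xi _ => hH xi) (fun xi _ => he xi))).
  rewrite -/P -/Q.
  have h1 : P / 2 * l ^+ 2 <= eps / 2.
    have : P * l * l <= eps * 1 by apply: (ler_pM (mulr_ge0 (ltW P0) (ltW l0)) (ltW l0)).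
    by rewrite expr2; lra.
  have h2 : Q * (q * (4 * M^-1) / l) <= eps / 2.
    exact: (tail_arith (lt_le_trans ltr01 M1) l0 MQ).
  apply: (le_trans (lerD h1 h2)); lra.
have Ic : `|Ibox comb| <= q * @window_const R * X.
  rewrite /comb IboxZ// IboxD// !IboxB// !IboxZ//.
  rewrite normrM (ger0_norm k20) -mulrA -kq ler_wpM2l//.
  have win p' m := norm_Ibox_window_le m p' c1 (a := a) (b := b) _ cb.
  by apply: comb4_le; apply: win; rewrite a0.
have -> : Ibox (fun xi => cos (th + \sum_(j < 4) n j * coord4 xi j) * propagator t xi) =
    Ibox comb + Ibox (fun xi => p xi - comb xi).
  by rewrite IboxB// addrC subrK.
by apply: (le_trans (ler_normD _ _)); apply: lerD.
Qed.

End DispersiveEstimate.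

(** * Interpolation by dyadic layers *)

Section FiniteMinkowski.
Local Open Scope ring_scope.
Context {R : realType} (X : Type).
Implicit Types (F : seq X) (u v : X -> R) (a b r : R).

(** Convexity at the weights [a / (a + b)] and [b / (a + b)], which are those
    that make the triangle inequality come out. *)
Lemma powR_convex2 a b r (x y : R) : 0 < a -> 0 < b -> 1 <= r -> 0 <= x -> 0 <= y ->
  (x + y) `^ r <= (a + b) `^ r * (a / (a + b) * (x / a) `^ r + b / (a + b) * (y / b) `^ r).
Proof.
move=> a0 b0 r1 x0 y0; have ab0 : 0 < a + b by lra.
have t01 : 0 <= a / (a + b) <= 1.
  by rewrite divr_ge0 ?(ltW a0) ?(ltW ab0)//= ler_pdivrMr// mul1r; lra.
have xa : 0 <= x / a by rewrite divr_ge0// ltW.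
have yb : 0 <= y / b by rewrite divr_ge0// ltW.
pose t := Itv01 (proj1 (andP t01)) (proj2 (andP t01)).
have := @convex_powR R r r1 t (x / a) (y / b).
rewrite !inE /= !in_itv/= xa yb => /(_ isT isT).
rewrite !convRE /= => h.
have {}h : (a / (a + b) * (x / a) + (1 - a / (a + b)) * (y / b)) `^ r <=
    a / (a + b) * (x / a) `^ r + (1 - a / (a + b)) * (y / b) `^ r by exact: h.
have -> : x + y = (a + b) * (a / (a + b) * (x / a) + (1 - a / (a + b)) * (y / b)).
  by field; rewrite !gt_eqF.
rewrite powRM ?(ltW ab0)//; last first.
  by apply: addr_ge0; apply: mulr_ge0 => //; lra.
rewrite ler_wpM2l ?powR_ge0//; apply: (le_trans h).
rewrite (_ : 1 - a / (a + b) = b / (a + b))//.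
by field; rewrite gt_eqF.
Qed.

Lemma minkowski2 F u v a b r : 0 < a -> 0 < b -> 1 <= r ->
  \sum_(x <- F) `|u x| `^ r <= a `^ r -> \sum_(x <- F) `|v x| `^ r <= b `^ r ->
  \sum_(x <- F) `|u x + v x| `^ r <= (a + b) `^ r.
Proof.
move=> a0 b0 r1 ua vb; have ab0 : 0 < a + b by lra.
have r0 : 0 <= r by lra.
apply: (@le_trans _ _ (\sum_(x <- F) (a + b) `^ r *
    (a / (a + b) * (`|u x| / a) `^ r + b / (a + b) * (`|v x| / b) `^ r))).
  apply: ler_sum => x _.
  apply: (@le_trans _ _ ((`|u x| + `|v x|) `^ r)).
    by rewrite ge0_ler_powR ?nnegrE ?addr_ge0 ?ler_normD.
  exact: powR_convex2.
rewrite -mulr_sumr big_split/= -!mulr_sumr -[leRHS]mulr1 ler_wpM2l ?powR_ge0//.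
have S c w : 0 < c -> \sum_(x <- F) `|w x| `^ r <= c `^ r -> \sum_(x <- F) (`|w x| / c) `^ r <= 1.
  move=> c0 wc; under eq_bigr do rewrite powRM ?invr_ge0 ?(ltW c0)//.
  rewrite -mulr_suml -powR_inv1 ?(ltW c0)// -powRrM mulN1r powRN.
  by rewrite ler_pdivrMr ?powR_gt0// mul1r.
have h1 : a / (a + b) * \sum_(x <- F) (`|u x| / a) `^ r <= a / (a + b) * 1.
  by rewrite ler_wpM2l ?S// divr_ge0// ltW.
have h2 : b / (a + b) * \sum_(x <- F) (`|v x| / b) `^ r <= b / (a + b) * 1.
  by rewrite ler_wpM2l ?S// divr_ge0// ltW.
apply: (le_trans (lerD h1 h2)).
by rewrite !mulr1 -mulrDl divff ?gt_eqF.
Qed.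

Lemma minkowski_sum F (w : nat -> X -> R) (b : nat -> R) r K : 1 <= r ->
  (forall k, 0 < b k) ->
  (forall k, \sum_(x <- F) `|w k x| `^ r <= b k `^ r) ->
  \sum_(x <- F) `|\sum_(k < K) w k x| `^ r <= (\sum_(k < K) b k) `^ r.
Proof.
move=> r1 b0 wb; have r0 : r != 0 by rewrite gt_eqF//; lra.
elim: K => [|K ih].
  by rewrite big_ord0 big1 ?powR_ge0// => x _; rewrite big_ord0 normr0 powR0.
have [K0|K0] := posnP K.
  by rewrite K0 big_ord1; under eq_bigr do rewrite big_ord1.
rewrite big_ord_recr/=; under eq_bigr do rewrite big_ord_recr/=.
apply: minkowski2 => //; case: K K0 {ih} => // K _.
rewrite big_ord_recr/= ltr_wpDl//.
by apply: sumr_ge0 => k _; exact: ltW.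
Qed.

End FiniteMinkowski.

Section Interpolation.
Local Open Scope ring_scope.
Context {R : realType}.
Implicit Types (E F : seq lattice4) (f g : lattice4 -> R) (h Z p s r M : R).

Definition convolve (k : lattice4 -> R) E f x := \sum_(y <- E) k (x - y) * f y.

(** Convolution with [k] has norm at most [A] from [l^(4/3)] to [l^2]; the
    exponent [3 / 2] is that of the squared [l^(4/3)] norm. *)
Definition l43_l2_bound (k : lattice4 -> R) (A : R) := forall E F f, uniq E -> uniq F ->
  \sum_(x <- F) convolve k E f x ^+ 2 <= A ^+ 2 * (\sum_(y <- E) `|f y| `^ (4 / 3)) `^ (3 / 2).

Lemma powR_expR (a b : R) : (expR a) `^ b = expR (b * a).
Proof. by rewrite /powR gt_eqF ?expR_gt0// expRK. Qed.

Lemma le_interpolate (v a b s : R) : 0 <= s <= 1 -> 0 <= v -> v <= a -> v <= b ->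
  v <= a `^ s * b `^ (1 - s).
Proof.
move=> /andP[s0 s1] v0 va vb.
have [->|vn] := eqVneq v 0; first by rewrite mulr_ge0 ?powR_ge0.
have -> : v = v `^ s * v `^ (1 - s).
  by rewrite -powRD ?vn ?implybT// addrC subrK powRr1.
by apply: ler_pM; rewrite ?powR_ge0// ge0_ler_powR ?nnegrE//; lra.
Qed.

Section Kernel.
Variables (k : lattice4 -> R) (A d : R).
Hypotheses (A0 : 0 < A) (d0 : 0 < d) (K2 : l43_l2_bound k A) (Kd : forall x, `|k x| <= d).

(** Testing on a unit mass shows that the kernel itself is square summable. *)
Lemma kernel_l2 F : uniq F -> \sum_(x <- F) k x ^+ 2 <= A ^+ 2.
Proof.
move=> uF; have := K2 (fun=> 1) (erefl true : uniq [:: 0]) uF.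
rewrite big_seq1 normr1 !powR1 mulr1; apply: le_trans.
by apply: ler_sum => x _; rewrite /convolve big_seq1 subr0 mulr1.
Qed.

Section Layer.
Variables (E : seq lattice4) (g : lattice4 -> R) (h Z : R).
Hypotheses (uE : uniq E) (h0 : 0 < h) (Z0 : 0 < Z) (sZ : (size E)%:R <= Z).
Hypothesis gh : forall y, `|g y| <= h.

Lemma layer_sup_decay x : `|convolve k E g x| <= d * Z * h.
Proof.
apply: (le_trans (ler_norm_sum _ _ _)).
apply: (@le_trans _ _ (\sum_(y <- E) d * h)).
  by apply: ler_sum => y _; rewrite normrM; apply: ler_pM.
rewrite big_const_seq count_predT iter_addr addr0 -mulr_natl mulrCA -mulrA.
by rewrite ler_wpM2l ?(ltW d0)// ler_wpM2r// ltW.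
Qed.

(** Cauchy-Schwarz between the kernel and a layer, both square summable. *)
Lemma layer_sup_l2 x : `|convolve k E g x| <= A * Z `^ (1 / 2) * h.
Proof.
have rZ0 : 0 < Z `^ (1 / 2) by exact: powR_gt0.
have rZ2 : Z `^ (1 / 2) ^+ 2 = Z.
  by rewrite -powR_mulrn ?powR_ge0// -powRrM (_ : 1 / 2 * 2%:R = 1) ?powRr1 ?(ltW Z0)//; field.
set z := Z `^ (1 / 2) in rZ0 rZ2 *.
pose la := h * z / A; have la0 : 0 < la by rewrite divr_gt0// mulr_gt0.
have l2 : \sum_(y <- E) k (x - y) ^+ 2 <= A ^+ 2.
  have := @kernel_l2 [seq x - y | y <- E]; rewrite map_inj_uniq; last first.
    by move=> y y' /(congr1 (fun z => x - z)); rewrite !subKr.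
  by move=> /(_ uE); rewrite big_map.
have g2 : \sum_(y <- E) g y ^+ 2 <= z ^+ 2 * h ^+ 2.
  apply: (@le_trans _ _ (\sum_(y <- E) h ^+ 2)).
    apply: ler_sum => y _; rewrite -real_normK ?num_real//.
    by apply: lerXn2r; rewrite ?nnegrE ?(ltW h0).
  rewrite big_const_seq count_predT iter_addr addr0 -mulr_natl rZ2.
  by rewrite ler_wpM2r// sqr_ge0.
apply: (@le_trans _ _ (la / 2 * \sum_(y <- E) k (x - y) ^+ 2 + (2 * la)^-1 * \sum_(y <- E) g y ^+ 2)).
  rewrite !mulr_sumr -big_split/=; apply: (le_trans (ler_norm_sum _ _ _)).
  apply: ler_sum => y _; rewrite normrM.
  have := sqr_ge0 (la * `|k (x - y)| - `|g y|).
  rewrite sqrrB exprMn !real_normK ?num_real// => sq.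
  rewrite -(ler_pM2l la0) mulrDr.
  have -> : la * ((2 * la)^-1 * g y ^+ 2) = g y ^+ 2 / 2 by field; rewrite gt_eqF.
  lra.
have e1 : la / 2 * \sum_(y <- E) k (x - y) ^+ 2 <= la / 2 * A ^+ 2.
  by rewrite ler_wpM2l// divr_ge0// ltW.
have e2 : (2 * la)^-1 * \sum_(y <- E) g y ^+ 2 <= (2 * la)^-1 * (z ^+ 2 * h ^+ 2).
  by rewrite ler_wpM2l// invr_ge0 mulr_ge0// ltW.
apply: (le_trans (lerD e1 e2)); rewrite le_eqVlt; apply/orP; left; apply/eqP.
by rewrite /la; field; rewrite !gt_eqF.
Qed.

Lemma layer_l2 F : uniq F ->
  \sum_(x <- F) convolve k E g x ^+ 2 <= A ^+ 2 * (Z `^ (3 / 2) * h ^+ 2).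
Proof.
move=> uF; apply: (le_trans (K2 g uE uF)); rewrite ler_wpM2l ?sqr_ge0//.
apply: (@le_trans _ _ ((Z * h `^ (4 / 3)) `^ (3 / 2))).
  rewrite ge0_ler_powR ?nnegrE//.
  - by apply: sumr_ge0 => y _; exact: powR_ge0.
  - by rewrite mulr_ge0 ?powR_ge0// ltW.
  apply: (@le_trans _ _ (\sum_(y <- E) h `^ (4 / 3))).
    by apply: ler_sum => y _; rewrite ge0_ler_powR ?nnegrE// ltW.
  rewrite big_const_seq count_predT iter_addr addr0 -[leLHS]mulr_natl.
  by rewrite ler_wpM2r ?powR_ge0.
rewrite powRM ?powR_ge0 ?(ltW Z0)// -powRrM.
by rewrite (_ : 4 / 3 * (3 / 2) = 2%:R) ?powR_mulrn ?(ltW h0)//; field.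
Qed.

Lemma layer_sup s x : 0 <= s <= 1 ->
  `|convolve k E g x| <= d `^ s * A `^ (1 - s) * (Z `^ ((1 + s) / 2) * h).
Proof.
move=> s01; apply: (le_trans (le_interpolate s01 (normr_ge0 _) (layer_sup_decay x) (layer_sup_l2 x))).
rewrite le_eqVlt; apply/orP; left; apply/eqP.
rewrite -(lnK A0) -(lnK d0) -(lnK Z0) -(lnK h0).
rewrite !powR_expR -!expRD !powR_expR -!expRD; congr expR.
by field.
Qed.

(** The power of the number of points that the [l^r] norm of one layer costs;
    with [s (1 - 2 / r) = D] it is [(1 + 1 / r + D) / 2]. *)
Definition layer_exponent s r : R := (1 + s) * (1 - 2 / r) / 2 + 3 / (2 * r).

(** [|v|^r] is at most the supremum to the power [r - 2], times [|v|^2]. *)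
Lemma layer_lr F s r : uniq F -> 0 <= s <= 1 -> 2 < r ->
  \sum_(x <- F) `|convolve k E g x| `^ r <=
  (d `^ (s * (1 - 2 / r)) * A `^ ((1 - s) * (1 - 2 / r) + 2 / r) *
    (Z `^ (layer_exponent s r) * h)) `^ r.
Proof.
move=> uF s01 r2; pose B := d `^ s * A `^ (1 - s) * (Z `^ ((1 + s) / 2) * h).
have r0 : r != 0 by rewrite gt_eqF//; lra.
have B0 : 0 <= B by rewrite !mulr_ge0 ?powR_ge0// ltW.
apply: (@le_trans _ _ (B `^ (r - 2) * (A ^+ 2 * (Z `^ (3 / 2) * h ^+ 2)))).
  apply: le_trans (ler_wpM2l (powR_ge0 _ _) (layer_l2 uF)).
  rewrite mulr_sumr; apply: ler_sum => x _.
  have -> : convolve k E g x ^+ 2 = `|convolve k E g x| `^ 2%:R.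
    by rewrite powR_mulrn// real_normK ?num_real.
  set v := `|_|; have [->|vn] := eqVneq v 0.
    by rewrite powR0// mulr_ge0 ?powR_ge0.
  rewrite -[X in v `^ X <= _](subrK 2) [v `^ _]powRD ?vn ?implybT//.
  rewrite ler_wpM2r ?powR_ge0// ge0_ler_powR ?nnegrE//; [lra|exact: normr_ge0|].
  exact: layer_sup.
rewrite le_eqVlt; apply/orP; left; apply/eqP; rewrite /B.
rewrite -!powR_mulrn ?(ltW A0) ?(ltW h0)//.
rewrite -(lnK A0) -(lnK d0) -(lnK Z0) -(lnK h0).
rewrite !powR_expR -!expRD !powR_expR -!expRD; congr expR.
by rewrite /layer_exponent; field.
Qed.

End Layer.

Section Layering.
Variables (E : seq lattice4) (f : lattice4 -> R) (p M : R).
Hypotheses (uE : uniq E) (p1 : 1 <= p) (M0 : 0 < M).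
Hypothesis fM : \sum_(y <- E) `|f y| `^ p <= M `^ p.

Definition layer (j : nat) y : R :=
  (dyadic M j.+1 < `|f y| <= dyadic M j)%R%:R * f y.

Definition layer_size (j : nat) : R := 2 `^ (p * j.+1%:R).

Lemma layer_le j y : `|layer j y| <= dyadic M j.
Proof.
rewrite /layer; case: (boolP (_ < _ <= _)) => [/andP[_]|_]; first by rewrite mul1r.
by rewrite mul0r normr0 ltW// dyadic_gt0.
Qed.

Lemma norm_le_M y : y \in E -> `|f y| <= M.
Proof.
move=> yE; have : `|f y| `^ p <= M `^ p.
  apply: le_trans fM; rewrite (bigD1_seq y)//= lerDl.
  by apply: sumr_ge0 => z _; exact: powR_ge0.
apply: contraTT; rewrite -!ltNge => h.
have p0 : 0 < p := lt_le_trans ltr01 p1.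
by rewrite (gt0_ltr_powR p0)// nnegrE// ltW.
Qed.

Lemma sum_layer K y : y \in E ->
  \sum_(j < K) layer j y = (dyadic M K < `|f y|)%R%:R * f y.
Proof.
move=> yE; have yM := norm_le_M yE; elim: K => [|K ih].
  by rewrite big_ord0 /dyadic expr0 divr1 ltNge yM mul0r.
rewrite big_ord_recr/= ih /layer -mulrDl.
have dK := dyadic_gt0 K M0; have dS := dyadicS M K.
case: (ltP (dyadic M K) `|f y|) => h1; rewrite ?andbF ?andbT.
  by rewrite addr0 (_ : dyadic M K.+1 < _)//; lra.
by rewrite add0r.
Qed.

Lemma layers_exhaust : exists K, forall y, y \in E -> f y = \sum_(j < K) layer j y.
Proof.
have [K HK] : exists K, forall y, y \in E -> f y != 0 -> dyadic M K < `|f y|.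
  elim: E => [|z s [K HK]]; first by exists 0%N.
  have [z0|zn] := eqVneq (f z) 0.
    by exists K => y /[!inE] /predU1P[->|]; [rewrite z0 eqxx|exact: HK].
  have zp : 0 < `|f z| / 2 by rewrite divr_gt0// normr_gt0.
  have [J HJ] := dyadic_le_eps M 1 zp.
  exists (maxn K J) => y.
  have mono a b : (a <= b)%N -> dyadic M b <= dyadic M a.
    move=> ab; rewrite /dyadic ler_pM2l// lef_pV2 ?posrE ?exprn_gt0//.
    by rewrite ler_weXn2l// ler1n.
  rewrite inE => /predU1P[->|ys] yn.
    by apply: le_lt_trans (mono _ _ (leq_maxr K J)) _; move: HJ zp; lra.
  exact: le_lt_trans (mono _ _ (leq_maxl K J)) (HK y ys yn).
exists K => y yE; rewrite sum_layer//.
have [->|fn] := eqVneq (f y) 0; first by rewrite mulr0.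
by rewrite HK// mul1r.
Qed.

Definition layer_support j :=
  [seq y <- E | dyadic M j.+1 < `|f y| <= dyadic M j].

Lemma convolve_layer j x :
  convolve k E (layer j) x = convolve k (layer_support j) (layer j) x.
Proof.
rewrite /convolve /layer_support big_filter [RHS]big_mkcond/=.
apply: eq_bigr => y _; case: ifP => // h.
by rewrite /layer h mul0r mulr0.
Qed.

(** Chebyshev: a layer of height [M 2^-j] has at most [2^(p (j+1))] points. *)
Lemma layer_support_size j : (size (layer_support j))%:R <= layer_size j.
Proof.
have dp : 0 < dyadic M j.+1 `^ p by rewrite powR_gt0// dyadic_gt0.
have e : M `^ p = layer_size j * dyadic M j.+1 `^ p.
  rewrite /dyadic powRM ?(ltW M0) ?invr_ge0 ?exprn_ge0//.
  have -> : (2 ^+ j.+1)^-1 `^ p = (layer_size j)^-1.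
    rewrite /layer_size -powR_mulrn// -[X in X `^ p = _]powR_inv1 ?powR_ge0//.
    rewrite -[LHS]powRrM -[LHS]powRrM -powRN.
    by congr (_ `^ _); ring.
  by rewrite mulrCA divff ?mulr1// gt_eqF// powR_gt0.
rewrite -(ler_pM2r dp) -e; apply: le_trans fM.
rewrite /layer_support size_filter -sum1_count natr_sum mulr_suml.
rewrite big_mkcond/=; apply: ler_sum => y _; case: ifP => [/andP[h _]|_].
  rewrite mul1r ge0_ler_powR ?nnegrE ?(ltW h)//; first exact: le_trans p1.
  by rewrite ltW// dyadic_gt0.
exact: powR_ge0.
Qed.

Lemma geometric_le (x : R) K : 0 <= x < 1 -> \sum_(j < K) x ^+ j <= (1 - x)^-1.
Proof.
move=> /andP[x0 x1]; have x10 : 0 < 1 - x by lra.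
rewrite -[leRHS]mul1r ler_pdivlMr//.
suff -> : (\sum_(j < K) x ^+ j) * (1 - x) = 1 - x ^+ K by have := exprn_ge0 K x0; lra.
elim: K => [|K ih]; first by rewrite big_ord0 mul0r expr0 subrr.
by rewrite big_ord_recr/= mulrDl ih exprS; ring.
Qed.

(** The sum over [j] of [2^(p (j + 1) e) 2^-j]. *)
Definition layer_series (e : R) : R := 2 `^ (p * e) / (1 - 2 `^ (p * e - 1)).

Lemma powR2_lt1 (x : R) : x < 0 -> 2 `^ x < 1.
Proof.
move=> x0; rewrite /powR pnatr_eq0/= -[ltRHS]expR0 ltr_expR nmulr_rlt0//.
by apply: ln_gt0; rewrite ltr1n.
Qed.

Lemma layer_series_gt0 e : p * e < 1 -> 0 < layer_series e.
Proof.
move=> pe; rewrite divr_gt0 ?powR_gt0// subr_gt0.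
by apply: powR2_lt1; lra.
Qed.

Lemma layer_series_le B e K : 0 <= B -> p * e < 1 ->
  \sum_(j < K) B * (layer_size j `^ e * dyadic M j) <= B * layer_series e * M.
Proof.
move=> B0 pe; rewrite -mulr_sumr -mulrA ler_wpM2l//.
set x := 2 `^ (p * e - 1).
have x0 : 0 <= x by exact: powR_ge0.
have x1 : x < 1.
  by apply: powR2_lt1; lra.
rewrite (eq_bigr (fun j : 'I_K => 2 `^ (p * e) * M * x ^+ j)); last first.
  move=> j _; rewrite /layer_size /dyadic /x -!powR_mulrn ?powR_ge0// -!powRrM.
  rewrite -(lnK M0) -[2]lnK ?posrE// -powR_inv1 ?powR_ge0//.
  rewrite !powR_expR -!expRD; congr expR.
  by rewrite -natr1; ring.
rewrite -mulr_sumr /layer_series -/x -mulrA -[leRHS]mulrA ler_wpM2l ?powR_ge0//.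
by rewrite mulrC ler_wpM2r ?(ltW M0)// geometric_le// x0.
Qed.

(** A layer of height [M 2^-j] contributes at most a constant times
    [2^(p (j + 1) e) M 2^-j] with [e] the layer exponent, and these sum up
    because [p e < 1]: the strict inequality is what replaces an interpolation
    theorem. *)
Lemma interpolation_lr F s r : uniq F -> 0 <= s <= 1 -> 2 < r ->
  p * layer_exponent s r < 1 ->
  \sum_(x <- F) `|convolve k E f x| `^ r <=
  (d `^ (s * (1 - 2 / r)) * A `^ ((1 - s) * (1 - 2 / r) + 2 / r) *
    layer_series (layer_exponent s r) * M) `^ r.
Proof.
move=> uF s01 r2 pe; set B := d `^ _ * A `^ _; set e := layer_exponent s r in pe *.
have B0 : 0 < B by rewrite mulr_gt0 ?powR_gt0.
have [K fK] := layers_exhaust.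
have r0 : 0 <= r by lra.
have r1 : 1 <= r by lra.
pose b j := B * (layer_size j `^ e * dyadic M j).
have b0 j : 0 < b j by rewrite !mulr_gt0 ?powR_gt0 ?dyadic_gt0.
have lj j : \sum_(x <- F) `|convolve k E (layer j) x| `^ r <= b j `^ r.
  under eq_bigr do rewrite convolve_layer.
  apply: layer_lr => //.
  - exact: filter_uniq.
  - exact: dyadic_gt0.
  - exact: powR_gt0.
  - exact: layer_support_size.
  - exact: layer_le.
have := minkowski_sum K r1 b0 lj => mink.
apply: (@le_trans _ _ ((\sum_(j < K) b j) `^ r)).
  apply: le_trans mink; rewrite le_eqVlt; apply/orP; left; apply/eqP.
  apply: eq_bigr => x _; congr (`|_| `^ _).
  rewrite /convolve exchange_big/= big_seq [RHS]big_seq; apply: eq_bigr => y yE.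
  by rewrite fK// mulr_sumr.
have S0 : 0 <= \sum_(j < K) b j by apply: sumr_ge0 => j _; exact: ltW.
have le := layer_series_le K (ltW B0) pe.
by rewrite ge0_ler_powR ?nnegrE// (le_trans S0).
Qed.

Lemma interpolation_sup s x : 0 <= s <= 1 -> p * ((1 + s) / 2) < 1 ->
  `|convolve k E f x| <= d `^ s * A `^ (1 - s) * layer_series ((1 + s) / 2) * M.
Proof.
move=> s01 pe; set B := d `^ _ * A `^ _; have B0 : 0 < B by rewrite mulr_gt0 ?powR_gt0.
have [K fK] := layers_exhaust.
apply: le_trans (layer_series_le K (ltW B0) pe).
have -> : convolve k E f x = \sum_(j < K) convolve k E (layer j) x.
  rewrite /convolve exchange_big/= big_seq [RHS]big_seq; apply: eq_bigr => y yE.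
  by rewrite fK// mulr_sumr.
apply: (le_trans (ler_norm_sum _ _ _)); apply: ler_sum => j _.
rewrite convolve_layer; apply: layer_sup => //.
- exact: filter_uniq.
- exact: dyadic_gt0.
- exact: powR_gt0.
- exact: layer_support_size.
- exact: layer_le.
Qed.

End Layering.
End Kernel.
End Interpolation.

(** * Sums over the lattice *)

Section CountingMeasure.
Local Open Scope classical_set_scope.
Local Open Scope ring_scope.
Context {R : realType}.
Implicit Types (E F : seq lattice4) (g h f : lattice4 -> R) (r B e : R).
Local Notation nu := (@counting lattice4 R : {measure set lattice4 -> \bar R}).

Lemma measurable_lattice4 d (T : measurableType d) (f : lattice4 -> T) (D : set lattice4) :
  measurable_fun D f.
Proof. by []. Qed.

(** Finite sets that exhaust the lattice, in the order of its enumeration. *)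
Definition exhaustion n : seq lattice4 :=
  undup (pmap (fun i => unpickle i : option 'rV[int]_4) (iota 0 n)).

Lemma exhaustion_uniq n : uniq (exhaustion n).
Proof. exact: undup_uniq. Qed.

Lemma mem_exhaustion n (x : lattice4) :
  (pickle (x : 'rV[int]_4) < n)%N -> x \in exhaustion n.
Proof.
move=> xn; rewrite mem_undup mem_pmap; apply/mapP.
by exists (pickle (x : 'rV[int]_4)); rewrite ?mem_iota// pickleK.
Qed.

Let atom (g : lattice4 -> R) (y x : lattice4) : R := g y * \1_[set y] x.

Let counting_set1 y : nu [set y] = 1%E.
Proof.
rewrite /=/counting asboolT; last exact: finite_set1.
by rewrite fset_set1 finmap.cardfs1.
Qed.

Let integrable_indic1 y : nu.-integrable setT (EFin \o \1_[set y]).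
Proof.
apply/integrableP; split; first exact: measurable_lattice4.
rewrite (_ : (fun x => _) = EFin \o \1_[set y]); last first.
  by apply/funext => x /=; rewrite ger0_norm// indicE ler0n.
by rewrite integral_indic// setIT counting_set1 ltry.
Qed.

Let integrable_atom g y : nu.-integrable setT (EFin \o atom g y).
Proof.
rewrite (_ : EFin \o atom g y = (fun x => (g y)%:E * (EFin \o \1_[set y]) x)%E)//.
exact: (integrableZl measurableT (g y) (integrable_indic1 y)).
Qed.

Let integrable_atoms g E : nu.-integrable setT (EFin \o (fun x => \sum_(y <- E) atom g y x)).
Proof.
elim: E => [|z E ih].
  by rewrite (_ : _ \o _ = cst 0%E); [exact: integrable0|apply/funext => x; rewrite /= big_nil].
rewrite (_ : _ \o _ = (fun x => (atom g z x)%:E + (\sum_(y <- E) atom g y x)%:E)%E).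
  apply: integrableD => //; exact: integrable_atom.
by apply/funext => x; rewrite /= big_cons EFinD.
Qed.

Let Rintegral_atoms g E : \int[nu]_x (\sum_(y <- E) atom g y x) = \sum_(y <- E) g y.
Proof.
elim: E => [|z E ih].
  under eq_Rintegral do rewrite big_nil.
  by rewrite big_nil /Rintegral integral0.
under eq_Rintegral do rewrite big_cons.
rewrite RintegralD//.
rewrite ih big_cons; congr (_ + _).
rewrite /atom RintegralZl//.
by rewrite /Rintegral integral_indic// setIT counting_set1/= mulr1.
Qed.

Let atomsE g E x : uniq E -> \sum_(y <- E) atom g y x = (x \in E)%:R * g x.
Proof.
move=> uE; have [xE|xE] := boolP (x \in E).
  rewrite (bigD1_seq x)//= /atom indicE mem_set//= mulr1 mul1r big1 ?addr0// => y yx.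
  by rewrite indicE memNset ?mulr0//= => xy; move: yx; rewrite xy eqxx.
rewrite mul0r big_seq big1// => y yE; rewrite /atom indicE memNset ?mulr0//= => xy.
by move: xE; rewrite xy yE.
Qed.

Lemma integrable_finite g E : uniq E ->
  nu.-integrable setT (EFin \o (fun x => (x \in E)%:R * g x)).
Proof.
move=> uE; have := integrable_atoms g E; congr (integrable _ _ _).
by apply/funext => x /=; rewrite atomsE.
Qed.

Lemma Rintegral_finite g E : uniq E ->
  \int[nu]_x ((x \in E)%:R * g x) = \sum_(y <- E) g y.
Proof.
move=> uE; rewrite -Rintegral_atoms; apply: eq_Rintegral => x _.
by rewrite atomsE.
Qed.

Lemma integral_finite g E : uniq E ->
  (\int[nu]_x ((x \in E)%:R * g x)%:E = (\sum_(y <- E) g y)%:E)%E.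
Proof.
move=> uE; rewrite -(Rintegral_finite g uE) /Rintegral fineK//.
by apply: integrable_fin_num => //; exact: integrable_finite.
Qed.

Lemma sum_le_counting h E : uniq E -> (forall x, 0 <= h x) ->
  ((\sum_(y <- E) h y)%:E <= \int[nu]_x (h x)%:E)%E.
Proof.
move=> uE h0; rewrite -integral_finite//; apply: ge0_le_integral => //.
- by move=> x _; rewrite lee_fin mulr_ge0.
- by move=> x _; rewrite lee_fin; case: (x \in E); rewrite ?mul1r// mul0r.
Qed.

Lemma exhaustion_cvg g : nu.-integrable setT (EFin \o g) ->
  \sum_(y <- exhaustion n) g y @[n --> \oo] --> \int[nu]_x g x.
Proof.
move=> ig.
have : (\int[nu]_x ((x \in exhaustion n)%:R * g x)%:E)%E @[n --> \oo] --> (\int[nu]_x (g x)%:E)%E.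
  apply: (@dominated_cvg _ _ _ nu setT _ _ _ (fun x => `|g x|%:E)) => //.
  - move=> x _; apply: cvg_near_cst.
    exists (pickle (x : 'rV[int]_4)).+1 => // n /= xn.
    by rewrite mem_exhaustion// mul1r.
  - exact: (integrable_abse ig).
  - move=> n x _ /=; rewrite lee_fin normrM.
    by case: (x \in _); rewrite ?normr1 ?mul1r// normr0 mul0r.
have igf := integrable_fin_num measurableT ig.
rewrite -(fineK igf) => /fine_cvg; apply: cvg_trans.
rewrite (_ : (fun n => \sum_(y <- exhaustion n) g y) = fine \o (fun n => (\int[nu]_x ((x \in exhaustion n)%:R * g x)%:E)%E)) //.
by apply/funext => n /=; rewrite integral_finite ?exhaustion_uniq.
Qed.

Lemma counting_le h B : (forall x, 0 <= h x) ->
  (forall E, uniq E -> \sum_(y <- E) h y <= B) -> (\int[nu]_x (h x)%:E <= B%:E)%E.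
Proof.
move=> h0 hB.
have mono (x : lattice4) n m : (n <= m)%N -> x \in exhaustion n -> x \in exhaustion m.
  move=> nm; rewrite !mem_undup !mem_pmap => /mapP[i + e]; rewrite mem_iota => /andP[_ im].
  by apply/mapP; exists i => //; rewrite mem_iota (leq_trans im).
have cv : (\int[nu]_x ((x \in exhaustion n)%:R * h x)%:E)%E @[n --> \oo] --> (\int[nu]_x (h x)%:E)%E.
  have := @cvg_monotone_convergence _ _ _ nu setT measurableT
    (fun n x => ((x \in exhaustion n)%:R * h x)%:E).
  rewrite (_ : (fun x => limn _) = (fun x => (h x)%:E)); last first.
    apply/funext => x; apply/cvg_lim => //; apply: cvg_near_cst.
    exists (pickle (x : 'rV[int]_4)).+1 => // n /= xn.
    by rewrite mem_exhaustion// mul1r.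
  apply => //.
  - by move=> n x _; rewrite lee_fin mulr_ge0.
  - move=> x _ n m nm; rewrite lee_fin ler_wpM2r// ler_nat.
    by case: (boolP (x \in exhaustion n)) => // /(mono _ _ _ nm) ->.
apply: cvge_le cv; apply: nearW => n.
by rewrite integral_finite ?exhaustion_uniq// lee_fin hB// exhaustion_uniq.
Qed.

End CountingMeasure.

Section InfiniteConvolution.
Local Open Scope classical_set_scope.
Local Open Scope ring_scope.
Context {R : realType}.
Implicit Types (E F : seq lattice4) (k f : lattice4 -> R) (r B W e : R).
Local Notation nu := (@counting lattice4 R : {measure set lattice4 -> \bar R}).

Definition convolution k f x : R := \int[nu]_y (k (x - y) * f y).

Lemma integrable_convolution k f x W :
  (forall E, uniq E -> \sum_(y <- E) `|k (x - y) * f y| <= W) ->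
  nu.-integrable setT (EFin \o (fun y => k (x - y) * f y)).
Proof.
move=> hW; apply/integrableP; split; first exact: measurable_lattice4.
apply: le_lt_trans (ltry W).
by apply: counting_le.
Qed.

Section Limit.
Variables (k f : lattice4 -> R) (W : R).
Hypothesis absolute : forall x E, uniq E -> \sum_(y <- E) `|k (x - y) * f y| <= W.

Lemma convolution_approx F e : 0 < e -> exists2 E, uniq E &
  forall x, x \in F -> `|convolution k f x - convolve k E f x| <= e.
Proof.
move=> e0; suff : \forall n \near \oo, forall x, x \in F ->
    `|convolution k f x - convolve k (exhaustion n) f x| <= e.
  move=> [N _ HN]; exists (exhaustion N); first exact: exhaustion_uniq.
  exact: HN (leqnn N).
elim: F => [|z F ih]; first exact: nearW.
have cz := exhaustion_cvg (integrable_convolution (absolute z)).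
have {}cz : \forall n \near \oo, `|convolution k f z - convolve k (exhaustion n) f z| <= e.
  by move/cvgrPdist_le: cz => /(_ e e0).
near=> n => x; rewrite inE => /predU1P[->|xF]; first by near: n.
by move: x xF; near: n.
Unshelve. all: by end_near. Qed.

(** On a finite set [F] the convolution is a uniform limit of finite ones;
    Minkowski's inequality lets the error into the bound. *)
Lemma convolution_lr F r B : 0 < B -> 1 <= r ->
  (forall E, uniq E -> \sum_(x <- F) `|convolve k E f x| `^ r <= B `^ r) ->
  \sum_(x <- F) `|convolution k f x| `^ r <= B `^ r.
Proof.
move=> B0 r1 hB; have r0 : 0 <= r by lra.
set S := \sum_(x <- F) _; have S0 : 0 <= S by apply: sumr_ge0 => x _; exact: powR_ge0.
have rn : r != 0 by rewrite gt_eqF//; lra.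
suff : S `^ r^-1 <= B.
  move=> h; have : (S `^ r^-1) `^ r <= B `^ r by rewrite ge0_ler_powR ?nnegrE ?powR_ge0// ltW.
  by rewrite -powRrM mulVf// powRr1.
apply/ler_addgt0Pr => e e0.
pose m : R := (size F).+1%:R; have m0 : 0 < m by rewrite ltr0n.
have [E uE hE] := @convolution_approx F (e / m) (divr_gt0 e0 m0).
have : S <= (B + e) `^ r.
  apply: le_trans (minkowski2 (u := fun x => convolve k E f x)
    (v := fun x => (x \in F)%:R * (convolution k f x - convolve k E f x)) B0 e0 r1 (hB E uE) _).
    rewrite /S big_seq [leRHS]big_seq; apply: ler_sum => x xF.
    by rewrite xF mul1r addrC subrK.
  apply: (@le_trans _ _ (\sum_(x <- F) (e / m) `^ r)).
    apply: ler_sum => x _; rewrite ge0_ler_powR ?nnegrE ?divr_ge0 ?(ltW e0) ?(ltW m0)//.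
    case: (boolP (x \in F)) => xF; first by rewrite mul1r hE.
    by rewrite mul0r normr0 divr_ge0 ?(ltW e0) ?(ltW m0).
  rewrite big_const_seq count_predT iter_addr addr0 -mulr_natr.
  rewrite powRM ?invr_ge0 ?(ltW e0) ?(ltW m0)// -mulrA ler_piMr ?powR_ge0//.
  rewrite -powR_inv1 ?(ltW m0)// -powRrM mulN1r powRN mulrC ler_pdivrMr ?powR_gt0// mul1r.
  apply: (@le_trans _ _ m); first by rewrite ler_nat.
  by apply: le1r_powR => //; rewrite ler1n.
move=> h; have : S `^ r^-1 <= ((B + e) `^ r) `^ r^-1.
  by rewrite ge0_ler_powR ?nnegrE ?powR_ge0 ?invr_ge0.
by rewrite -powRrM divff// powRr1//; lra.
Qed.

Lemma convolution_sup x B :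
  (forall E, uniq E -> `|convolve k E f x| <= B) -> `|convolution k f x| <= B.
Proof.
move=> hB; apply/ler_addgt0Pr => e e0.
have [E uE hE] := @convolution_approx [:: x] e e0.
have h1 := hB E uE; have h2 := hE x (mem_head _ _).
have := ler_normD (convolution k f x - convolve k E f x) (convolve k E f x).
by rewrite subrK; lra.
Qed.

End Limit.
End InfiniteConvolution.

(** * The kernel of the wave equation *)

Section WaveKernel.
Local Open Scope classical_set_scope.
Local Open Scope ring_scope.
Context {R : realType}.
Implicit Types (E F : seq lattice4) (f : lattice4 -> R) (t th : R).
Local Notation mR := (measurableTypeR R).
Local Notation mR4 := (mR * mR * mR * mR)%type.

(** [th = 0] and [th = - pi / 2] give the real and the imaginary part of the
    fundamental solution, up to the normalisation. *)
Definition wave_kernel th t (x : lattice4) : R :=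
  Ibox (fun xi => cos (th + dot4 x xi) * propagator t xi).

Definition l43_const : R := Num.sqrt ((2 * pi) ^+ 4 * (203 * pi ^+ 4)).

Lemma l43_const_gt0 : 0 < l43_const.
Proof.
have p0 : 0 < pi ^+ 4 :> R by rewrite exprn_gt0// pi_gt0.
rewrite sqrtr_gt0 (mulr_gt0 _ (mulr_gt0 (ltr0n R 203) p0))//.
by rewrite exprn_gt0// mulr_gt0// pi_gt0.
Qed.

Lemma propagator_symbol t (xi : mR4) : propagator t xi ^+ 2 * symbol xi <= 1.
Proof.
rewrite -omega_sqr -exprMn mulrC omega_propagator.
by rewrite -real_normK ?num_real// expr_le1// sin_max.
Qed.

Lemma bmeas_shifted_trig (tr : R -> R) E f th : (tr = @cos R \/ tr = @sin R) ->
  bmeas (fun xi : mR4 => \sum_(y <- E) f y * tr (th - dot4 y xi)).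
Proof.
move=> trE; apply: bmeas_sum => y; apply: bmeas_mul; first exact: bmeas_cst.
have m : measurable_fun setT (fun xi : mR4 => th - dot4 y xi).
  by apply: measurable_funB; [exact: measurable_cst|exact: measurable_dot4].
by case: trE => ->; [exact: bmeas_cos|exact: bmeas_sin].
Qed.

Lemma shifted_trig_sqr E f th (xi : mR4) :
  (\sum_(y <- E) f y * cos (th - dot4 y xi)) ^+ 2 +
  (\sum_(y <- E) f y * sin (th - dot4 y xi)) ^+ 2 = trig_sqr E f xi.
Proof.
have -> : \sum_(y <- E) f y * cos (th - dot4 y xi) =
    cos th * trig_re E f xi + sin th * trig_im E f xi.
  rewrite /trig_re /trig_im !mulr_sumr -big_split/=; apply: eq_bigr => y _.
  by rewrite cosB; ring.
have -> : \sum_(y <- E) f y * sin (th - dot4 y xi) =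
    sin th * trig_re E f xi - cos th * trig_im E f xi.
  rewrite /trig_re /trig_im !mulr_sumr -sumrB; apply: eq_bigr => y _.
  by rewrite sinB; ring.
rewrite /trig_sqr; have := cos2Dsin2 th.
move: (trig_re _ _ _) (trig_im _ _ _) => a b cs.
transitivity ((cos th ^+ 2 + sin th ^+ 2) * (a ^+ 2 + b ^+ 2)); first by ring.
by rewrite cs mul1r.
Qed.

Lemma convolve_wave_kernel th t E f x : convolve (wave_kernel th t) E f x =
  Ibox (fun xi => (propagator t xi * \sum_(y <- E) f y * cos (th - dot4 y xi)) * cos (dot4 x xi)
    - (propagator t xi * \sum_(y <- E) f y * sin (th - dot4 y xi)) * sin (dot4 x xi)).
Proof.
rewrite /convolve /wave_kernel.
have bk y : bmeas (fun xi : mR4 => cos (th + dot4 (x - y) xi) * propagator t xi).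
  apply: bmeas_mul; last exact: bmeas_propagator.
  by apply/bmeas_cos/measurable_funD; [exact: measurable_cst|exact: measurable_dot4].
transitivity (\sum_(y <- E) Ibox (fun xi => f y * (cos (th + dot4 (x - y) xi) * propagator t xi))).
  by apply: eq_bigr => y _; rewrite IboxZ// mulrC.
rewrite -Ibox_sum; last by move=> y; apply: bmeas_mul => //; exact: bmeas_cst.
apply: eq_Ibox => xi _; rewrite -2!mulrA -mulrBr mulr_suml [in X in _ - X]mulr_suml.
rewrite -sumrB mulr_sumr; apply: eq_bigr => y _; rewrite dot4B.
rewrite (_ : th + (dot4 x xi - dot4 y xi) = th - dot4 y xi + dot4 x xi); last by ring.
by rewrite cosD; ring.
Qed.

(** [weighted_parseval] is not homogeneous in [f]; applying it after
    normalising the [l^(4/3)] norm by [c] restores homogeneity. *)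
Lemma propagator_parseval E f t : uniq E ->
  Ibox (fun xi => propagator t xi ^+ 2 * trig_sqr E f xi) <=
  203 * pi ^+ 4 * (\sum_(y <- E) `|f y| `^ (4 / 3)) `^ (3 / 2).
Proof.
move=> uE; set S := \sum_(y <- E) _.
have S0 : 0 <= S by apply: sumr_ge0 => y _; exact: powR_ge0.
have pi4 : 0 <= 203 * pi ^+ 4 :> R.
  exact: (mulr_ge0 (ler0n R 203) (exprn_ge0 4 (pi_ge0 R))).
have bP : bmeas (fun xi : mR4 => propagator t xi ^+ 2).
  by apply: bmeas_sqr; exact: bmeas_propagator.
have [Sz|Sn] := eqVneq S 0.
  have f0 y : y \in E -> f y = 0.
    move=> yE; have : `|f y| `^ (4 / 3) <= 0.
      rewrite -Sz /S (bigD1_seq y)//= lerDl.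
      by apply: sumr_ge0 => z _; exact: powR_ge0.
    rewrite le_eqVlt ltNge powR_ge0 orbF => /eqP /powR_eq0_eq0 /eqP.
    by rewrite normr_eq0 => /eqP.
  rewrite (eq_Ibox (g := fun=> 0)).
    by rewrite Ibox_cst mul0r mulr_ge0 ?powR_ge0.
  move=> xi _; rewrite /trig_sqr /trig_re /trig_im.
  rewrite big_seq big1 => [|y yE]; last by rewrite f0// mul0r.
  by rewrite big_seq big1 => [|y yE]; [ring|rewrite f0// mul0r].
have Sp : 0 < S by rewrite lt_def Sn.
pose c := S `^ (- (3 / 4)); have c0 : 0 < c by exact: powR_gt0.
pose a y := (c * `|f y|) `^ (1 / 3).
have a0 y : 0 <= a y by exact: powR_ge0.
have fa y : `|c * f y| = a y ^+ 3.
  rewrite normrM (gtr0_norm c0) /a -powR_mulrn ?powR_ge0// -powRrM.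
  by rewrite (_ : 1 / 3 * 3%:R = 1) ?powRr1 ?mulr_ge0 ?(ltW c0)//; field.
have S1 : 1 = \sum_(y <- E) a y ^+ 4.
  have -> : \sum_(y <- E) a y ^+ 4 = c `^ (4 / 3) * S.
    rewrite /S mulr_sumr; apply: eq_bigr => y _.
    rewrite /a -powR_mulrn ?powR_ge0// -powRrM (_ : 1 / 3 * 4%:R = 4 / 3); last by field.
    by rewrite powRM// ltW.
  rewrite /c -powRrM (_ : - (3 / 4) * (4 / 3) = -1); last by field.
  by rewrite powR_inv1 ?mulVf// ltW.
have w0 (xi : mR4) : 0 <= propagator t xi ^+ 2 by exact: sqr_ge0.
have := weighted_parseval uE S1 a0 fa bP w0 (fun xi _ => propagator_symbol t xi).
have -> : Ibox (fun xi => propagator t xi ^+ 2 * trig_sqr E (fun y => c * f y) xi) =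
    c ^+ 2 * Ibox (fun xi => propagator t xi ^+ 2 * trig_sqr E f xi).
  rewrite -IboxZ; last by apply: bmeas_mul => //; exact: bmeas_trig_sqr.
  apply: eq_Ibox => xi _; rewrite /trig_sqr.
  have -> : trig_re E (fun y => c * f y) xi = c * trig_re E f xi.
    by rewrite /trig_re mulr_sumr; apply: eq_bigr => y _; rewrite mulrA.
  have -> : trig_im E (fun y => c * f y) xi = c * trig_im E f xi.
    by rewrite /trig_im mulr_sumr; apply: eq_bigr => y _; rewrite mulrA.
  by ring.
have -> : S `^ (3 / 2) = c ^- 2.
  rewrite /c -powR_invn ?powR_ge0// -powRrM; congr (_ `^ _).
  by field.
have -> : pi ^+ 4 * (171 * 1 + 32 * 1 ^+ 2) = 203 * pi ^+ 4 :> R by ring.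
by rewrite ler_pdivlMr ?exprn_gt0// mulrC.
Qed.

Lemma wave_kernel_l43_l2 th t : l43_l2_bound (wave_kernel th t) l43_const.
Proof.
move=> E F f uE uF; under eq_bigr do rewrite convolve_wave_kernel.
have bs tr : (tr = @cos R \/ tr = @sin R) ->
    bmeas (fun xi : mR4 => propagator t xi * \sum_(y <- E) f y * tr (th - dot4 y xi)).
  by move=> trE; apply: bmeas_mul; [exact: bmeas_propagator|exact: bmeas_shifted_trig].
apply: (le_trans (bessel_inequality uF (bs cos (or_introl erefl)) (bs sin (or_intror erefl)))).
rewrite sqr_sqrtr; last first.
  by rewrite mulr_ge0 ?exprn_ge0 ?mulr_ge0 ?pi_ge0 ?ler0n.
rewrite -[leRHS]mulrA ler_wpM2l ?exprn_ge0 ?mulr_ge0 ?pi_ge0 ?ler0n//.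
rewrite (eq_Ibox (g := fun xi => propagator t xi ^+ 2 * trig_sqr E f xi)).
  exact: propagator_parseval.
by move=> xi _; rewrite -(shifted_trig_sqr E f th) !exprMn mulrDr.
Qed.

Lemma propagatorN t (xi : mR4) : propagator (- t) xi = - propagator t xi.
Proof. by rewrite /propagator mulNr sinN mulNr. Qed.

Lemma norm_wave_kernelN th t x : `|wave_kernel th (- t) x| = `|wave_kernel th t x|.
Proof.
rewrite -[RHS]normrN /wave_kernel -[- Ibox _]mulN1r -IboxZ.
  by congr `|_|; apply: eq_Ibox => xi _; rewrite propagatorN; ring.
apply: bmeas_mul; last exact: bmeas_propagator.
by apply/bmeas_cos/measurable_funD; [exact: measurable_cst|exact: measurable_dot4].
Qed.

Lemma ln_le_powR (x a : R) : 0 < a -> 0 < x -> ln x <= a^-1 * x `^ a.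
Proof.
move=> a0 x0; rewrite ler_pdivlMl// -ln_powR.
have xa : 0 < x `^ a by exact: powR_gt0.
have := @le_ln1Dx R (x `^ a - 1) ltac:(lra).
by rewrite addrCA subrr addr0; lra.
Qed.

(** The logarithm costs an arbitrarily small power of [t]. *)
Lemma wave_kernel_decay (eta : R) : 0 < eta -> exists K : R, 0 < K /\
  forall th t x, `|wave_kernel th t x| <= K * (Num.max 1 `|t|) `^ (eta - 3 / 2).
Proof.
move=> eta0; have [D [D0 HD]] := @dispersive_estimate R.
have A0 := l43_const_gt0.
exists (l43_const + D * (2 + 2 / eta)); split.
  by rewrite addr_gt0// mulr_gt0// addr_gt0// divr_gt0.
move=> th t x; set p := eta - 3 / 2.
have d0 : 0 < D * (2 + 2 / eta) by rewrite mulr_gt0// addr_gt0// divr_gt0.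
have [t1|t1] := leP `|t| 1.
  rewrite powR1 mulr1.
  have := kernel_l2 (@wave_kernel_l43_l2 th t) (erefl true : uniq [:: x]).
  rewrite big_seq1 -real_normK ?num_real// ler_pXn2r ?nnegrE ?(ltW A0)//.
  lra.
wlog tp : t t1 / 0 < t => [hw|].
  have [t0|t0] := ltP 0 t; first exact: hw.
  have t0' : t < 0.
    by rewrite lt_neqAle t0 andbT; apply: contraTneq t1 => ->; rewrite normr0 ltr10.
  by rewrite -norm_wave_kernelN -[X in X `^ p]normrN; apply: hw; rewrite ?normrN ?oppr_gt0.
rewrite (gtr0_norm tp) in t1 *.
pose c := Num.sqrt t; have c2 : c ^+ 2 = t by rewrite sqr_sqrtr// ltW.
have c0 : 0 < c by rewrite sqrtr_gt0.
have c1 : 1 <= c by rewrite -sqrtr1 ler_sqrt// ltW.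
have := HD c (fun j => (x ord0 j)%:~R) th c1; rewrite c2 => hd.
apply: (le_trans hd).
have c3 : (c ^+ 3)^-1 = t `^ (- (3 / 2)).
  rewrite -c2 -powR_invn ?(ltW c0)// -powR_mulrn ?(ltW c0)// -powRrM.
  by congr (_ `^ _); field.
have c4 : c ^+ 4 = t ^+ 2 by rewrite -c2 -exprM.
have te1 : 1 <= t `^ eta.
  by rewrite -(powRr0 t) ler_powR ?ltW.
have log : ln (1 + c ^+ 4) + 1 <= (2 + 2 / eta) * t `^ eta.
  have : ln (1 + c ^+ 4) <= 1 + 2 * ln t.
    have l2 : ln 2 <= 1 :> R by have := @le_ln1Dx R 1 ltac:(lra).
    apply: (@le_trans _ _ (ln (2 * t ^+ 2))).
      rewrite c4 ler_ln ?posrE; last 2 first.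
      - by rewrite ltr_pwDl// sqr_ge0.
      - by rewrite mulr_gt0// exprn_gt0.
      have : 1 <= t ^+ 2 by rewrite exprn_ege1// ltW.
      lra.
    by rewrite lnM ?posrE ?exprn_gt0// lnXn// -[ln t *+ 2]mulr_natl; lra.
  have := ln_le_powR eta0 tp; rewrite [2 / eta]mulrC mulrDl => h1 h2.
  have : 2 * ln t <= 2 * (eta^-1 * t `^ eta) by rewrite ler_pM2l.
  lra.
rewrite c3.
have -> : t `^ p = t `^ eta * t `^ (- (3 / 2)).
  by rewrite /p powRD// [t == 0]gt_eqF// implybT.
rewrite !mulrA ler_wpM2r ?powR_ge0//.
have : D * (ln (1 + c ^+ 4) + 1) <= D * ((2 + 2 / eta) * t `^ eta).
  by rewrite ler_pM2l.
have : 0 <= l43_const * t `^ eta by rewrite mulr_ge0 ?powR_ge0// ltW.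
move=> h0 h1; rewrite [leRHS]mulrDl -[D * _ * _]mulrA; lra.
Qed.

End WaveKernel.

(** * Norms of the solution at a fixed time *)

Section SequenceNorms.
Local Open Scope classical_set_scope.
Local Open Scope ring_scope.
Context {R : realType}.
Implicit Types (E F : seq lattice4) (k f u v w : lattice4 -> R) (p M B A : R) (r : \bar R).

(** For finite [r] only the points of [F] are tested; for [r = +oo] all of them
    are, since no limit over finite sets is then called for. *)
Definition lr_le r F v B : Prop :=
  match r with
  | EFin a => \sum_(x <- F) `|v x| `^ a <= B `^ a
  | +oo%E => forall x, `|v x| <= B
  | -oo%E => False
  end.

Lemma lr_le_add r F u v (B B' : R) : (1 <= r)%E -> 0 < B -> 0 < B' ->
  lr_le r F u B -> lr_le r F v B' -> lr_le r F (fun x => u x + v x) (B + B').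
Proof.
case: r => [r| |] //= r1 B0 B'0 uB vB; first exact: minkowski2.
by move=> x; apply: (le_trans (ler_normD _ _)); apply: lerD.
Qed.

Lemma lr_le_scale r F v w (c B : R) : (1 <= r)%E -> 0 < c -> 0 < B ->
  (forall x, `|w x| <= c * `|v x|) -> lr_le r F v B -> lr_le r F w (c * B).
Proof.
case: r => [r| |] //= r1 c0 B0 wv vB; last first.
  by move=> x; apply: (le_trans (wv x)); rewrite ler_pM2l.
have r0 : 0 <= r by rewrite lee_fin in r1; lra.
rewrite powRM ?(ltW c0) ?(ltW B0)//.
apply: le_trans (ler_wpM2l (powR_ge0 _ _) vB); rewrite mulr_sumr.
apply: ler_sum => x _; rewrite -powRM ?(ltW c0)//.
by rewrite ge0_ler_powR ?nnegrE ?mulr_ge0 ?(ltW c0).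
Qed.

Lemma lr_le_lnorm r (g : lattice4 -> R[i]) B : (1 <= r)%E -> 0 < B ->
  (forall F, uniq F -> lr_le r F (fun x => Normc.normc (g x)) B) ->
  (lnorm r g <= B%:E)%E.
Proof.
rewrite /lnorm unlock; case: r => [r| |] //= r1 B0 h.
  have r0 : 0 < r by rewrite lee_fin in r1; lra.
  have := @counting_le R (fun x => `|Normc.normc (g x)| `^ r) (B `^ r)
    (fun x => powR_ge0 _ _) h.
  move=> le; have ri : 0 <= r^-1 by rewrite invr_ge0 ltW.
  apply: (le_trans (gt0_ler_poweR ri _ _ le)).
  - by rewrite in_itv/= leey andbT integral_ge0.
  - by rewrite in_itv/= leey andbT lee_fin powR_ge0.
  by rewrite poweR_EFin -powRrM divff ?gt_eqF// powRr1 ?(ltW B0).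
case: ifPn => [_|_]; last by rewrite lee_fin ltW.
apply/ess_sup_inf.ess_supP; apply: nearW => x /=.
by rewrite lee_fin; exact: (h [::]).
Qed.

Lemma lnorm_sum_le p (g : lattice4 -> R[i]) (N : R) E : 0 < p -> uniq E ->
  lnorm p%:E g = N%:E -> \sum_(y <- E) `|Normc.normc (g y)| `^ p <= N `^ p.
Proof.
move=> p0 uE gN; have pn : p != 0 by rewrite gt_eqF.
have := poweR_Lnorm (@counting lattice4 R : {measure set lattice4 -> \bar R})
  (fun x => (Normc.normc (g x))%:E) pn.
rewrite -/(lnorm p%:E g) gN poweR_EFin => e.
rewrite -lee_fin e; apply: le_trans (sum_le_counting (h := fun y => `|Normc.normc (g y)| `^ p) uE _) _.
  by move=> x; exact: powR_ge0.
by [].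
Qed.

(** The bound for finite convolutions applies to every choice of signs of [f],
    and one of them turns the sum at [x] into the sum of absolute values. *)
Lemma absolute_convolution k A p M f : 0 < A -> l43_l2_bound k A -> 1 <= p < 2 -> 0 < M ->
  (forall E, uniq E -> \sum_(y <- E) `|f y| `^ p <= M `^ p) ->
  forall x E, uniq E -> \sum_(y <- E) `|k (x - y) * f y| <= A * layer_series p (1 / 2) * M.
Proof.
move=> A0 K2 /andP[p1 p2] M0 fM x E uE.
have kA z : `|k z| <= A.
  have := kernel_l2 K2 (erefl true : uniq [:: z]).
  by rewrite big_seq1 -real_normK ?num_real// ler_pXn2r ?nnegrE ?(ltW A0).
pose g y := if 0 <= k (x - y) then `|f y| else - `|f y|.
have gf y : `|g y| = `|f y| by rewrite /g; case: ifP => _; rewrite ?normrN normr_id.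
have gM : \sum_(y <- E) `|g y| `^ p <= M `^ p by under eq_bigr do rewrite gf; exact: fM.
have s01 : 0 <= (0 : R) <= 1 by rewrite lexx ler01.
have h := interpolation_sup A0 A0 K2 kA uE p1 M0 gM x s01.
rewrite addr0 powRr0 subr0 powRr1 ?(ltW A0)// (mul1r A) in h.
have {}h := h ltac:(lra).
apply: le_trans h; rewrite /convolve; apply: le_trans (ler_norm _).
apply: ler_sum => y _; rewrite normrM /g.
by case: (lerP 0 (k (x - y))) => h; [rewrite ger0_norm|rewrite ltr0_norm// mulrN mulNr].
Qed.

Lemma convolution_lr_le r F k f W B : (1 <= r)%E -> 0 < B ->
  (forall x E, uniq E -> \sum_(y <- E) `|k (x - y) * f y| <= W) ->
  (forall E, uniq E -> lr_le r F (convolve k E f) B) -> lr_le r F (convolution k f) B.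
Proof.
case: r => [r| |] //= r1 B0 hW h; last first.
  by move=> x; apply: (convolution_sup hW) => E uE; exact: h.
by apply: (convolution_lr hW B0) => //; rewrite -lee_fin.
Qed.

End SequenceNorms.

Section SolutionBound.
Local Open Scope classical_set_scope.
Local Open Scope ring_scope.
Context {R : realType}.
Implicit Types (E F : seq lattice4) (p M B t : R) (r : \bar R).

Local Notation nu := (@counting lattice4 R : {measure set lattice4 -> \bar R}).

Let kap : R := ((2 * pi) ^+ 4)^-1.

Lemma ReM (x y : R[i]) : complex.Re (x * y) =
  complex.Re x * complex.Re y - complex.Im x * complex.Im y.
Proof. by case: x y => [a b] [c d]. Qed.

Lemma ImM (x y : R[i]) : complex.Im (x * y) =
  complex.Re x * complex.Im y + complex.Im x * complex.Re y.
Proof. by case: x y => [a b] [c d]. Qed.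

Lemma G_Re x t : complex.Re (G x t) = kap * wave_kernel 0 t x.
Proof.
rewrite /G ReM/= mul0r subr0; congr (_ * _).
apply: eq_Ibox => xi _; by rewrite mulr0 subr0 add0r.
Qed.

Lemma G_Im x t : complex.Im (G x t) = kap * wave_kernel (- (pi / 2)) t x.
Proof.
rewrite /G ImM/= mul0r addr0; congr (_ * _).
apply: eq_Ibox => xi _; by rewrite mulr0 add0r addrC -sin_cosB.
Qed.

Lemma normc_le (z : R[i]) : Normc.normc z <= `|complex.Re z| + `|complex.Im z|.
Proof.
case: z => a b /=; rewrite -(ger0_norm (addr_ge0 (normr_ge0 a) (normr_ge0 b))) -sqrtr_sqr.
rewrite ler_sqrt ?sqr_ge0// sqrrD !real_normK ?num_real//.
have : 0 <= `|a| * `|b| by rewrite mulr_ge0.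
by rewrite -mulr_natl; lra.
Qed.

Lemma normc_ge0 (z : R[i]) : 0 <= Normc.normc z.
Proof. by case: z => a b /=; rewrite sqrtr_ge0. Qed.

Lemma norm_Re_le (z : R[i]) : `|complex.Re z| <= Normc.normc z.
Proof. by case: z => a b /=; rewrite -sqrtr_sqr ler_wsqrtr// lerDl sqr_ge0. Qed.

Lemma norm_Im_le (z : R[i]) : `|complex.Im z| <= Normc.normc z.
Proof. by case: z => a b /=; rewrite -sqrtr_sqr ler_wsqrtr// lerDr sqr_ge0. Qed.

(** Real and imaginary parts of [G] and of [f] give four real convolutions. *)
Lemma solution_lr_le r t (f : lattice4 -> R[i]) p M B : (1 <= r)%E -> 1 <= p < 2 ->
  0 < M -> 0 < B ->
  (forall E, uniq E -> \sum_(y <- E) `|Normc.normc (f y)| `^ p <= M `^ p) ->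
  (forall th E F (h : lattice4 -> R), uniq E -> uniq F ->
     \sum_(y <- E) `|h y| `^ p <= M `^ p ->
     lr_le r F (convolve (wave_kernel th t) E h) B) ->
  (lnorm r (solution f ^~ t) <= (4 * kap * B)%:E)%E.
Proof.
move=> r1 p12 M0 B0 fM TB; have /andP[p1 p2] := p12.
have kap0 : 0 < kap by rewrite invr_gt0 exprn_gt0// mulr_gt0// pi_gt0.
have p0 : 0 <= p by lra.
pose f1 y := complex.Re (f y); pose f2 y := complex.Im (f y).
pose g1 := wave_kernel 0 t; pose g2 := wave_kernel (- (pi / 2)) t.
have dom (h : lattice4 -> R) : (forall y, `|h y| <= Normc.normc (f y)) ->
    forall E, uniq E -> \sum_(y <- E) `|h y| `^ p <= M `^ p.
  move=> hf E uE; apply: le_trans (fM E uE); apply: ler_sum => y _.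
  by rewrite ge0_ler_powR ?nnegrE// (le_trans (hf y)) ?ler_norm.
have f1M := dom f1 (fun y => norm_Re_le (f y)).
have f2M := dom f2 (fun y => norm_Im_le (f y)).
have A0 := @l43_const_gt0 R.
have abs th h := absolute_convolution A0 (@wave_kernel_l43_l2 R th t) p12 M0 (f := h).
have int th h (hM : forall E, uniq E -> \sum_(y <- E) `|h y| `^ p <= M `^ p) x :=
  integrable_convolution (abs th h hM x).
have lr th h F (hM : forall E, uniq E -> \sum_(y <- E) `|h y| `^ p <= M `^ p) (uF : uniq F) :
    lr_le r F (convolution (wave_kernel th t) h) B.
  by apply: (convolution_lr_le r1 B0 (abs th h hM)) => E uE; apply: TB => //; exact: hM.
have iD (u v : lattice4 -> R) : nu.-integrable setT (EFin \o u) ->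
    nu.-integrable setT (EFin \o v) -> nu.-integrable setT (EFin \o (fun y => u y + v y)).
  by move=> iu iv; apply: eq_integrable (integrableD _ iu iv).
have iB (u v : lattice4 -> R) : nu.-integrable setT (EFin \o u) ->
    nu.-integrable setT (EFin \o v) -> nu.-integrable setT (EFin \o (fun y => u y - v y)).
  by move=> iu iv; apply: eq_integrable (integrableB _ iu iv).
have ReS x : complex.Re (solution f x t) = kap * (convolution g1 f1 x - convolution g2 f2 x).
  rewrite /solution /cintegral/= /convolution -RintegralB//; last 2 first.
  - exact: int.
  - exact: int.
  rewrite -RintegralZl//; last by apply: iB; exact: int.
  by apply: eq_Rintegral => y _; rewrite ReM G_Re G_Im /g1 /g2 /f1 /f2; ring.
have ImS x : complex.Im (solution f x t) = kap * (convolution g1 f2 x + convolution g2 f1 x).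
  rewrite /solution /cintegral/= /convolution -RintegralD//; last 2 first.
  - exact: int.
  - exact: int.
  rewrite -RintegralZl//; last by apply: iD; exact: int.
  by apply: eq_Rintegral => y _; rewrite ImM G_Re G_Im /g1 /g2 /f1 /f2; ring.
have -> : 4 * kap * B = kap * (B + B + (B + B)) by ring.
apply: lr_le_lnorm => //; first by rewrite mulr_gt0// !addr_gt0.
move=> F uF; pose n (h : lattice4 -> R) x := `|h x|.
have lrn th h (hM : forall E, uniq E -> \sum_(y <- E) `|h y| `^ p <= M `^ p) : lr_le r F (n (convolution (wave_kernel th t) h)) B.
  rewrite -[B]mul1r; apply: (lr_le_scale r1 ltr01 B0 _ (lr th h F hM uF)) => x.
  by rewrite /n normr_id mul1r.
have BB : 0 < B + B by rewrite addr_gt0.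
have s1 := lr_le_add r1 B0 B0 (lrn 0 f1 f1M) (lrn (- (pi / 2)) f2 f2M).
have s2 := lr_le_add r1 B0 B0 (lrn 0 f2 f2M) (lrn (- (pi / 2)) f1 f1M).
have s := lr_le_add r1 BB BB s1 s2.
apply: (lr_le_scale r1 kap0 (addr_gt0 BB BB) _ s) => x; rewrite (ger0_norm (normc_ge0 _)).
apply: (le_trans (normc_le _)); rewrite ReS ImS !normrM (gtr0_norm kap0) -mulrDr ler_pM2l//.
rewrite [leRHS]ger0_norm; last by rewrite /n !addr_ge0.
by apply: lerD; [exact: ler_normB|exact: ler_normD].
Qed.

End SolutionBound.

(** * Integration in time *)

Section TimeIntegral.
Local Open Scope classical_set_scope.
Local Open Scope ring_scope.
Context {R : realType}.
Implicit Types (q b B t : R) (r : \bar R).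

Local Notation mu := (@lebesgue_measure R).

(** The integral of a nonnegative function is the supremum of the integrals of
    the simple functions below it, hence it is monotone on all functions. *)
Lemma le_nonneg_integral (f g : R -> \bar R) : (forall x, (0 <= f x)%E) ->
  (forall x, (f x <= g x)%E) -> (\int[mu]_x f x <= \int[mu]_x g x)%E.
Proof.
move=> f0 fg; rewrite !ge0_integralTE//; last by move=> x; exact: le_trans (fg x).
apply: le_ereal_sup => _ [h hf <-]; exists h => // x.
exact: le_trans (hf x) (fg x).
Qed.

Lemma integral_one_add_powR tau : 1 < tau ->
  (\int[mu]_t ((1 + `|t|) `^ (- tau))%:E = (2 / (tau - 1))%:E)%E.
Proof.
move=> tau1; have p0 (x : R) : 0 < 1 + `|x| by rewrite ltr_pwDl.
have a0 : 0 < tau - 1 by lra.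
rewrite (ge0_symfun_integralT (f := fun t : R => (1 + `|t|) `^ (- tau))); first last.
- by move=> x /=; rewrite normrN.
- move=> x; apply: (@continuous_comp _ _ _ (fun y : R => 1 + `|y|) (fun y => y `^ (- tau))).
    by apply: cvgD; [exact: cvg_cst|exact: norm_continuous].
  by have := is_derive1_powR (- tau) (p0 x) => /der_cont.
- by move=> x; exact: powR_ge0.
rewrite /=.
pose F (x : R) := - (tau - 1)^-1 * (1 + x) `^ (1 - tau).
have dF (x : R) : - 1 < x -> is_derive x 1 F ((1 + x) `^ (- tau)).
  move=> x1; have x0 : 0 < 1 + x by lra.
  have d1 : is_derive x 1 (fun y : R => 1 + y) (0 + 1).
    exact: der_add (der_cst _ _) (der_id _).
  have d2 := der_comp (is_derive1_powR (1 - tau) x0) d1.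
  apply: der_eq (der_mul (der_cst (- (tau - 1)^-1) x) d2) _.
  rewrite mulr0 addr0 add0r mulr1 mulrA.
  have -> : - (tau - 1)^-1 * (1 - tau) = 1 by field; rewrite gt_eqF.
  by rewrite mul1r; congr (_ `^ _); ring.
rewrite -set_itvcy.
have -> : (\int[mu]_(x in `[0%R, +oo[) ((1 + `|x|) `^ (- tau))%:E =
    \int[mu]_(x in `[0%R, +oo[) ((1 + x) `^ (- tau))%:E)%E.
  apply: eq_integral => x; rewrite inE/= in_itv/= andbT => x0.
  by rewrite ger0_norm.
rewrite (@ge0_continuous_FTC2y R _ F 0 0).
- rewrite /F addr0 powR1 mulr1 -EFinB -EFinM; congr EFin.
  by rewrite sub0r opprK.
- by move=> x _; exact: powR_ge0.
- apply: continuous_in_subspaceT => x; rewrite inE/= in_itv/= andbT => x0.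
  have x1 : 0 < 1 + x by lra.
  apply: (@continuous_comp _ _ _ (fun y : R => 1 + y) (fun y => y `^ (- tau))).
    by apply: cvgD; [exact: cvg_cst|exact: cvg_id].
  by have := is_derive1_powR (- tau) x1 => /der_cont.
- rewrite -(mulr0 (- (tau - 1)^-1)); apply: cvgMr.
  apply/cvgr0Pnorm_le => e e0; near=> x.
  have x1 : (e^-1) `^ (tau - 1)^-1 <= 1 + x.
    apply: (@le_trans _ _ x); last by rewrite lerDr.
    by near: x; apply: nbhs_pinfty_ge; rewrite num_real.
  have x0 : 0 < 1 + x by apply: lt_le_trans x1; rewrite powR_gt0 ?invr_gt0.
  rewrite ger0_norm ?powR_ge0// -opprB powRN -[e]invrK lef_pV2 ?posrE ?powR_gt0 ?invr_gt0//.
  have -> : e^-1 = (e^-1 `^ (tau - 1)^-1) `^ (tau - 1).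
    by rewrite -powRrM mulVf ?lt0r_neq0// powRr1// invr_ge0 ltW.
  by rewrite ge0_ler_powR ?nnegrE ?powR_ge0 ?(ltW a0) ?(ltW x0).
- by move=> x x0; apply: ex_derive; apply: dF; lra.
- apply: cvg_at_right_filter; apply: der_cont (dF 0 _); lra.
- move=> x; rewrite in_itv/= andbT => x0; rewrite derive1E.
  by have [_ ->] := dF x ltac:(lra).
Unshelve. all: by end_near. Qed.

Lemma time_decay_mixed_norm q b : 0 < q -> 1 < b * q -> exists W : R, 0 < W /\
  forall r (u : lattice4 -> R -> R[i]) B, 0 < B ->
  (forall t, (lnorm r (u ^~ t) <= (B * (Num.max 1 `|t|) `^ (- b))%:E)%E) ->
  (mixed_norm q%:E r u <= (W * B)%:E)%E.
Proof.
move=> q0 bq; set tau := b * q in bq; pose c : R := 2 `^ tau * (2 / (tau - 1)).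
have c0 : 0 < c by rewrite mulr_gt0 ?powR_gt0// divr_gt0// subr_gt0.
exists (c `^ q^-1); split; first exact: powR_gt0.
move=> r u B B0 hu; rewrite /mixed_norm unlock /=.
have le : (\int[mu]_t (`|lnorm r (u ^~ t)| `^ q) <= (B `^ q * c)%:E)%E.
  apply: (@le_trans _ _ (\int[mu]_t ((B `^ q * 2 `^ tau) * (1 + `|t|) `^ (- tau))%:E)%E).
    apply: le_nonneg_integral => t; first exact: poweR_ge0.
    have m0 : 0 < Num.max 1 `|t| by rewrite lt_max ltr01.
    have n0 : (0 <= lnorm r (u ^~ t))%E by exact: Lnorm_ge0.
    have := gt0_ler_poweR (ltW q0) _ _ (hu t).
    rewrite gee0_abs// !in_itv/= !leey !andbT n0 lee_fin mulr_ge0 ?powR_ge0 ?(ltW B0)//.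
    move=> /(_ erefl erefl) h; apply: (le_trans h).
    rewrite lee_fin powRM ?powR_ge0 ?(ltW B0)// -mulrA ler_wpM2l ?powR_ge0//.
    rewrite -powRrM mulNr -/tau !powRN.
    have -> : 2 `^ tau * ((1 + `|t|) `^ tau)^-1 = (((1 + `|t|) / 2) `^ tau)^-1.
      have i2 : 2^-1 `^ tau = (2 `^ tau)^-1 :> R.
        by rewrite -[2^-1]powR_inv1// -powRrM mulN1r powRN.
      by rewrite powRM ?invr_ge0// i2 invfM invrK mulrC.
    have h2 : 0 < (1 + `|t|) / 2 by rewrite divr_gt0// ltr_pwDl.
    rewrite lef_pV2 ?posrE ?powR_gt0// ge0_ler_powR ?nnegrE ?(ltW m0) ?(ltW h2)//; last first.
      by case: (lerP 1 `|t|) => ?; lra.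
    lra.
  under eq_integral do rewrite EFinM.
  rewrite ge0_integralZl_EFin//; last 2 first.
  - apply/measurable_EFinP; apply: (measurableT_comp (measurable_powR _)).
    by apply: measurable_funD => //; exact: normr_measurable.
  - by rewrite mulr_ge0 ?powR_ge0.
  by rewrite integral_one_add_powR// -EFinM -mulrA.
have qi : 0 <= q^-1 by rewrite invr_ge0 ltW.
apply: (le_trans (gt0_ler_poweR qi _ _ le)).
- by rewrite in_itv/= leey andbT integral_ge0// => t _; exact: poweR_ge0.
- by rewrite in_itv/= leey andbT lee_fin mulr_ge0 ?powR_ge0 ?(ltW c0).
rewrite poweR_EFin powRM ?powR_ge0 ?(ltW c0)// -powRrM divff ?gt_eqF// powRr1 ?(ltW B0)//.
by rewrite mulrC.
Qed.

Lemma sup_mixed_norm r (u : lattice4 -> R -> R[i]) B :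
  (forall t, (lnorm r (u ^~ t) <= B%:E)%E) -> 0 < B ->
  (mixed_norm +oo r u <= B%:E)%E.
Proof.
move=> hu B0; rewrite /mixed_norm unlock /=.
case: ifPn => [_|_]; last by rewrite lee_fin ltW.
apply/ess_sup_inf.ess_supP; apply: nearW => t /=.
by rewrite gee0_abs//; exact: Lnorm_ge0.
Qed.

End TimeIntegral.

(** * Space-time estimates *)

Section StrichartzEstimate.
Local Open Scope classical_set_scope.
Local Open Scope ring_scope.
Context {R : realType}.
Implicit Types (E F : seq lattice4) (M : R) (r : \bar R).

(** [D] is the share of the dispersive bound in the interpolation. Writing
    [1 / r] as [rho] treats [r = +oo], where [rho = 0], with the same numbers. *)
Lemma wave_lr_decay (p rho D beta : R) : 1 <= p -> 0 <= rho < 1 / 2 ->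
  0 <= D <= 1 - 2 * rho -> p * ((1 + rho + D) / 2) < 1 -> beta < 3 / 2 ->
  exists C : R, 0 < C /\ forall t th E F (h : lattice4 -> R) M,
    uniq E -> uniq F -> 0 < M -> \sum_(y <- E) `|h y| `^ p <= M `^ p ->
    lr_le (rho%:E^-1)%E F (convolve (wave_kernel th t) E h)
      (C * (Num.max 1 `|t|) `^ (- (beta * D)) * M).
Proof.
move=> p1 /andP[rho0 rho2] /andP[D0 D1] pe beta1.
have [K [K0 dec]] := @wave_kernel_decay R (3 / 2 - beta) ltac:(lra).
pose A : R := l43_const; have A0 : 0 < A := l43_const_gt0.
pose w (t : R) := Num.max 1 `|t|; have w0 t : 0 < w t by rewrite lt_max ltr01.
have d0 t : 0 < K * w t `^ (- beta) by rewrite mulr_gt0 ?powR_gt0.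
have dk th t x : `|wave_kernel th t x| <= K * w t `^ (- beta).
  by apply: le_trans (dec th t x) _; rewrite (_ : 3 / 2 - beta - 3 / 2 = - beta)//; ring.
have dD t : (K * w t `^ (- beta)) `^ D = K `^ D * w t `^ (- (beta * D)).
  by rewrite powRM ?powR_ge0 ?(ltW K0)// -powRrM mulNr.
have [r0|rn] := eqVneq rho 0.
  rewrite r0 inve0 in D1 pe *; rewrite addr0 in pe.
  exists (K `^ D * A `^ (1 - D) * layer_series p ((1 + D) / 2)); split.
    by apply: mulr_gt0; [rewrite mulr_gt0 ?powR_gt0|exact: layer_series_gt0].
  move=> t th E F h M uE uF M0 hM x.
  have s01 : 0 <= D <= 1 by rewrite D0; lra.
  have := interpolation_sup A0 (d0 t) (@wave_kernel_l43_l2 R th t) (dk th t) uE p1 M0 hM x s01 pe.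
  rewrite dD => hx; apply: (le_trans hx); rewrite le_eqVlt; apply/orP; left; apply/eqP.
  by rewrite /w; ring.
have rp : 0 < rho by rewrite lt_neqAle eq_sym rn.
pose a := rho^-1; have a2 : 2 < a by rewrite /a -[2]invrK ltf_pV2 ?posrE//; lra.
have ai : a^-1 = rho by rewrite /a invrK.
have m0 : 0 < 1 - 2 / a by rewrite ai; lra.
pose s := D / (1 - 2 / a).
have sD : s * (1 - 2 / a) = D by rewrite /s divfK// gt_eqF.
have s01 : 0 <= s <= 1.
  rewrite /s divr_ge0 ?(ltW m0)//= ler_pdivrMr// mul1r ai; lra.
have le : layer_exponent s a = (1 + rho + D) / 2.
  rewrite /layer_exponent invfM ai.
  rewrite -[in 1 - 2 * rho]ai mulrDl mul1r sD ai.
  by field.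
have pe' : p * layer_exponent s a < 1 by rewrite le.
rewrite inver (negbTE rn) -/a.
pose k := (1 - s) * (1 - 2 / a) + 2 / a.
exists (K `^ D * A `^ k * layer_series p (layer_exponent s a)); split.
  by apply: mulr_gt0; [rewrite mulr_gt0 ?powR_gt0|exact: layer_series_gt0].
move=> t th E F h M uE uF M0 hM.
have := interpolation_lr A0 (d0 t) (@wave_kernel_l43_l2 R th t) (dk th t) uE p1 M0 hM uF s01 a2 pe'.
rewrite sD dD -/k => hx; apply: (le_trans hx); rewrite le_eqVlt; apply/orP; left; apply/eqP.
by congr (_ `^ _); rewrite /w; ring.
Qed.

(** The bounds need a positive size [M] of [f]; any [M] above the norm will do,
    and it may then decrease to the norm. *)
Lemma strichartz_of_bound (p C : R) (q r : \bar R) : 0 < p -> 0 < C ->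
  (forall (f : lattice4 -> R[i]) M, 0 < M ->
     (forall E, uniq E -> \sum_(y <- E) `|Normc.normc (f y)| `^ p <= M `^ p) ->
     (mixed_norm q r (solution f) <= (C * M)%:E)%E) ->
  strichartz p%:E q r.
Proof.
move=> p0 C0 bound; exists C => f.
have : (0 <= lnorm p%:E f)%E by exact: Lnorm_ge0.
case fN : (lnorm p%:E f) => [N| |]// N0 _; rewrite lee_fin in N0.
apply/lee_addgt0Pr => e e0; have CN : e / C > 0 by rewrite divr_gt0.
have -> : (C%:E * N%:E + e%:E = (C * (N + e / C))%:E)%E.
  by rewrite -EFinM -EFinD mulrDr mulrCA divff ?gt_eqF// mulr1.
apply: bound => [|E uE]; first by rewrite ltr_wpDl.
apply: le_trans (lnorm_sum_le p0 uE fN) _.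
by rewrite ge0_ler_powR ?nnegrE ?(ltW p0)// ?addr_ge0 ?lerDl// ltW.
Qed.

(** The decay exponent [beta] may be taken anywhere below [3 / 2]; as
    [D > 2 / (3 q)] this leaves room for [beta D q > 1]. *)
Lemma strichartz_finite_time (p q rho D : R) : 1 <= p -> 0 < q -> 0 <= rho < 1 / 2 ->
  2 / (3 * q) < D <= 1 - 2 * rho -> p * ((1 + rho + D) / 2) < 1 ->
  strichartz p%:E q%:E (rho%:E^-1)%E.
Proof.
move=> p1 q0 /andP[rho0 rho2] /andP[Dq D1] pe.
have Dq0 : 0 < 2 / (3 * q) by rewrite divr_gt0// mulr_gt0.
have D0 : 0 < D by lra.
have iDq : (D * q)^-1 < 3 / 2.
  rewrite -[ltRHS]invrK ltf_pV2 ?posrE ?mulr_gt0// ?invr_gt0//.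
  by move: Dq; rewrite ltr_pdivrMr ?mulr_gt0//; lra.
pose beta := ((D * q)^-1 + 3 / 2) / 2.
have b1 : (D * q)^-1 < beta by rewrite /beta; lra.
have b2 : beta < 3 / 2 by rewrite /beta; lra.
have bq : 1 < beta * D * q.
  by rewrite -mulrA -(@mulVf _ (D * q)) ?ltr_pM2r ?mulr_gt0// gt_eqF// mulr_gt0.
have rho02 : 0 <= rho < 1 / 2 by rewrite rho0.
have D01 : 0 <= D <= 1 - 2 * rho by rewrite (ltW D0).
have [C [C0 hC]] := wave_lr_decay p1 rho02 D01 pe b2.
have [W [W0 hW]] := time_decay_mixed_norm q0 bq.
have p2 : p < 2.
  have h : p * (1 / 2) <= p * ((1 + rho + D) / 2) by rewrite ler_pM2l; lra.
  lra.
have p12 : 1 <= p < 2 by rewrite p1.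
have r1 : (1 <= rho%:E^-1)%E.
  rewrite inver; case: eqVneq => [_|rn]; first exact: leey.
  rewrite lee_fin -[leLHS]invr1 lef_pV2 ?posrE//; first lra.
  by rewrite lt_neqAle eq_sym rn.
have kap0 : 0 < 4 * ((2 * pi) ^+ 4)^-1 :> R.
  by rewrite mulr_gt0// invr_gt0 exprn_gt0// mulr_gt0// pi_gt0.
apply: (@strichartz_of_bound _ (W * (4 * ((2 * pi) ^+ 4)^-1 * C))).
- lra.
- exact: mulr_gt0 W0 (mulr_gt0 kap0 C0).
move=> f M M0 fM; rewrite -mulrA; apply: hW; first exact: mulr_gt0 (mulr_gt0 kap0 C0) M0.
move=> t; set w := _ `^ _; have w0 : 0 < w by rewrite powR_gt0// lt_max ltr01.
have B0 : 0 < C * w * M by rewrite !mulr_gt0.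
have := solution_lr_le r1 p12 M0 B0 fM (t := t).
have -> : 4 * ((2 * pi) ^+ 4)^-1 * C * M * w = 4 * ((2 * pi) ^+ 4)^-1 * (C * w * M).
  by move: (_ ^-1 : R) => k; ring.
by apply => th E F h uE uF hM; exact: hC.
Qed.

(** The [l^(4/3) -> l^2] bound is uniform in time. *)
Lemma strichartz_endpoint : strichartz (4 / 3 : R)%:E +oo 2%:E.
Proof.
pose A : R := l43_const; have A0 : 0 < A := l43_const_gt0.
have kap0 : 0 < 4 * ((2 * pi) ^+ 4)^-1 :> R.
  by rewrite mulr_gt0// invr_gt0 exprn_gt0// mulr_gt0// pi_gt0.
apply: (@strichartz_of_bound _ (4 * ((2 * pi) ^+ 4)^-1 * A)).
- lra.
- exact: mulr_gt0.
move=> f M M0 fM; apply: sup_mixed_norm; last exact: mulr_gt0 (mulr_gt0 kap0 A0) M0.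
move=> t; rewrite -[_ * A * M]mulrA.
have r1 : (1 <= 2%:E :> \bar R)%E by rewrite lee_fin; lra.
pose p : R := 4 / 3; have p12 : 1 <= p < 2 by rewrite /p; apply/andP; split; lra.
have := solution_lr_le r1 p12 M0 (mulr_gt0 A0 M0) fM (t := t); apply.
move=> th E F h uE uF hM /=.
rewrite powR_mulrn ?mulr_ge0 ?(ltW A0) ?(ltW M0)// exprMn.
under eq_bigr do rewrite powR_mulrn// real_normK ?num_real//.
apply: le_trans (wave_kernel_l43_l2 th t h uE uF) _.
rewrite ler_wpM2l ?sqr_ge0// -powR_mulrn ?(ltW M0)//.
have -> : M `^ 2%:R = (M `^ p) `^ (3 / 2).
  by rewrite -powRrM; congr (_ `^ _); rewrite /p; field.
by rewrite ge0_ler_powR ?nnegrE ?powR_ge0 ?sumr_ge0// => y _; exact: powR_ge0.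
Qed.

End StrichartzEstimate.

(** * The range of exponents *)

Section Exponents.
Local Open Scope ring_scope.
Context {R : realType}.

(** The conditions say that an interval of admissible [D] is nonempty. *)
Lemma strichartz_finite_time_region (p q rho : R) : 1 <= p -> 0 < q -> 0 <= rho < 1 / 2 ->
  2 / (3 * q) < 1 - 2 * rho -> 2 / (3 * q) < 2 / p - 1 - rho ->
  strichartz p%:E q%:E (rho%:E^-1)%E.
Proof.
move=> p1 q0 rho02 h1 h2; pose m := Num.min (1 - 2 * rho) (2 / p - 1 - rho).
have hm : 2 / (3 * q) < m by rewrite /m lt_min h1.
have m1 : m <= 1 - 2 * rho by rewrite /m ge_min lexx.
have m2 : m <= 2 / p - 1 - rho by rewrite /m ge_min lexx orbT.
apply: (@strichartz_finite_time _ p q rho ((2 / (3 * q) + m) / 2)) => //.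
  by apply/andP; split; lra.
have p0 : 0 < p by exact: lt_le_trans ltr01 p1.
rewrite -ltr_pdivlMl// mulr1.
have -> : p^-1 = 2 / p / 2 by rewrite mulrAC divff// mul1r.
rewrite ltr_pM2r//; lra.
Qed.

Lemma real_exponent (q : \bar R) : (0 < q)%E -> (q < +oo)%E -> exists2 a : R, 0 < a & q = a%:E.
Proof. by case: q => [a| |]// q0 _; exists a. Qed.

Lemma inverse_triple (a : R) : 0 < a -> ((3%:E * a%:E)^-1 = (3 * a)^-1%:E)%E.
Proof. by move=> a0; rewrite -EFinM inver gt_eqF// mulr_gt0. Qed.

End Exponents.

Local Open Scope ring_scope.
Local Open Scope ereal_scope.

Theorem corollary5p2 (R : realType) :
  (forall p q r : \bar R,
     1 <= p -> p < r -> 0 < q -> q < +oo ->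
     (1 / 2)%:E + r^-1 + (3%:E * q)^-1 < p^-1 ->
     strichartz p q r) /\
  (forall p q r : \bar R,
     (exists s : R, [/\ (0 <= s <= 1)%R,
        p^-1 = ((1 - s) * (3 / 4) + s * 1)%:E &
        r^-1 = ((1 - s) * (1 / 2) + s * 0)%:E]) ->
     ([/\ 0 < q, q < +oo & r^-1 + (3%:E * q)^-1 < (1 / 2)%:E] \/
      [/\ p = (4 / 3)%:E, q = +oo & r = 2%:E]) ->
     strichartz p q r).
Proof.
split=> [p q r p1 pr q0 qy|p q r [s [/andP[s0 s1] ps rs]]].
  have [b b0 ->] := real_exponent q0 qy; rewrite inverse_triple//.
  have [a a0 pa] := real_exponent (lt_le_trans lte01 p1) (lt_le_trans pr (leey r)).
  rewrite pa in p1 pr *; rewrite lee_fin in p1.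
  have an : a != 0%R by rewrite gt_eqF.
  have [rho [rho0 rE]] : exists rho : R, (0 <= rho)%R /\ r^-1 = rho%:E.
    case: r pr => [c| |]// pr; last by exists 0%R; rewrite invey.
    have c0 : (0 < c)%R by exact: lt_trans a0 pr.
    by exists c^-1%R; split; [rewrite invr_ge0 ltW|rewrite inver gt_eqF].
  rewrite -[in strichartz _ _ r](inveK r) rE inver (negbTE an) -!EFinD lte_fin => h.
  have a1 : (a^-1 <= 1)%R by rewrite invf_le1.
  have b3 : (0 < (3 * b)^-1)%R by rewrite invr_gt0 mulr_gt0.
  apply: strichartz_finite_time_region => //; first by apply/andP; split; lra.
    lra.
  lra.
case=> [[q0 qy]|[-> -> ->]]; last exact: strichartz_endpoint.
have [b b0 ->] := real_exponent q0 qy; rewrite inverse_triple//.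
rewrite -[in strichartz _ _ r](inveK r) rs -EFinD lte_fin => h.
set x := ((1 - s) * (3 / 4) + s * 1)%R in ps; have xE : x = ((3 + s) / 4)%R by rewrite /x; field.
have x0 : (0 < x)%R by rewrite xE; lra.
have xn : x != 0%R by rewrite gt_eqF.
have b3 : (0 < (3 * b)^-1)%R by rewrite invr_gt0 mulr_gt0.
rewrite -(inveK p) ps inver (negbTE xn).
apply: strichartz_finite_time_region => //.
- by rewrite invf_ge1// xE; lra.
- by apply/andP; split; lra.
- lra.
- by rewrite invrK xE; lra.
Qed.
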